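(* Let $n$ be a positive integer with $n\equiv 0$ or $1 \pmod 3$, and let $c\in\{3,\dots,n\}$. Let $K_n$ be the random knot of the random billiard table model with $n$ crossings, and let $\mathrm{c}(K_n)$ denote its crossing number. Then $$ P\left[\mathrm{c}(K_n)=c\right] \;=\; \sum_{\substack{k\in\{0,\dots,c-2\}\\ c+k\equiv n \ (\mathrm{mod}\ 3)}} \frac{\binom{c-2}{k}}{2^{n-1}}\cdot F\left(\frac{n-c-k}{3},\; c+k\right), $$ where $$ F(m,\ell) \;:=\; \frac{m^2+(\ell+5)m+2}{2}\binom{3m+\ell}{m} \;-\; \frac{m^2+(2\ell+9)m+(\ell^2+7\ell+2)}{2}\binom{3m+\ell}{<m}. $$
   Context: Notation: $\binom{N}{<m} := \binom{N}{0}+\binom{N}{1}+\dots+\binom{N}{m-1}$ (an empty sum, equal to $0$, if $m\le 0$), and $\binom{N}{m}:=0$ for $m<0$. Random model: let $n\equiv 0$ or $1 \pmod 3$, so that $3$ and $n+1$ are coprime. Consider the planar trajectory of a billiard ball in the rectangle of width $n+1$ and height $3$, $[0,n+1]\times[0,3]$, fired at slope one from the lower left corner $(0,0)$, reflecting off the sides until it ends in another corner. This curve has exactly $n$ transversal self-crossings, one on each vertical line $x=1,\dots,n$; they are ordered from left to right. A word $w\in\{0,1\}^n$ assigns crossing information: the $i$th crossing has the strand of positive slope on top if the $i$th letter is $0$, and the strand of negative slope on top if the $i$th letter is $1$. Connecting the two ends of the trajectory by a simple arc outside the rectangle gives a knot diagram. $K_n$ is the knot represented by this diagram when $w$ is chosen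 uniformly at random from $\{0,1\}^n$. The crossing number of a knot is the minimal number of crossings in any of its diagrams. *)

(* Defs.v *)
From Stdlib Require Import Relation_Operators.
From mathcomp Require Import all_boot all_order all_algebra.
From mathcomp Require Import boolp.

Set Implicit Arguments.
Unset Strict Implicit.
Unset Printing Implicit Defensive.

Import Order.TTheory GRing.Theory Num.Theory.

Local Open Scope nat_scope.

(* Knot diagrams (on the sphere) are encoded by signed Gauss codes.  Follow the
   curve once around, from some base point in some direction, and record one
   letter for each passage through a crossing: the name of the crossing,
   whether the passage is the over-strand, and whether the crossing is
   positive, i.e. whether the pair (direction of the over-strand, direction of
   the under-strand) is positively oriented.  The empty code is the diagram
   without crossings. *)

Definition letter : Type := (nat * bool * bool)%type.
Definition name (a : letter) : nat := a.1.1.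
Definition over (a : letter) : bool := a.1.2.
Definition positive (a : letter) : bool := a.2.

(* The other passage through the same crossing. *)
Definition mate (a : letter) : letter := (name a, ~~ over a, positive a).

Definition gauss_code (G : seq letter) : bool :=
  uniq [seq (name a, over a) | a <- G] && all (fun a => mate a \in G) G.

Definition crossings (G : seq letter) : nat := (size G)./2.

Section Faces.
Variable G : seq letter.

Definition mate_pos (i : 'I_(size G)) : 'I_(size G) :=
  insubd i (index (mate (tnth (in_tuple G) i)) G).

(* The pair (i, d) is the oriented edge that leaves the i-th passage forward
   (d = true) or backward (d = false).  [next_side] goes along that edge and
   turns left at its end; the orbits are the boundaries of the faces of the
   surface carrying the diagram.  Seen by somebody who runs forward through a
   letter a, the other strand goes from right to left iff
   over a = positive a. *)
Definition next_side (x : 'I_(size G) * bool) : 'I_(size G) * bool :=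
  let j := if x.2 then ordS x.1 else ord_pred x.1 in
  let a := tnth (in_tuple G) j in
  (mate_pos j, (over a == positive a) == x.2).

Definition faces : nat := fcard next_side predT.

(* Euler's formula V - E + F = 2, with E = size G. *)
Definition spherical : bool :=
  (G == [::]) || (crossings G + faces == size G + 2).

End Faces.

Definition diagram (G : seq letter) : bool := gauss_code G && spherical G.

Definition rename (f : nat -> nat) (a : letter) : letter :=
  (f (name a), over a, positive a).

Definition ordered_pair (b : bool) (x y : letter) : seq letter :=
  if b then [:: x; y] else [:: y; x].

(* The three strands of a third Reidemeister move: the top strand passes over
   crossings i and j, the middle one under i and over k, the bottom one under j
   and k.  The booleans a, b, c tell whether these crossings are met in the
   listed order on the top, middle and bottom strand.  For three lines in the
   plane, writing the vectors between the vertices of the triangle as multiples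
   of the directions of the lines shows that the signs of i, j, k are, up to a
   common factor (here e), those of c, b, a respectively; all 16
   configurations arise. *)
Section ThirdMove.
Variables (i j k : nat) (si sj sk : bool).
Definition top_strand (a : bool) : seq letter :=
  ordered_pair a (i, true, si) (j, true, sj).
Definition middle_strand (b : bool) : seq letter :=
  ordered_pair b (i, false, si) (k, true, sk).
Definition bottom_strand (c : bool) : seq letter :=
  ordered_pair c (j, false, sj) (k, false, sk).
End ThirdMove.

(* The first three constructors change the arbitrary choices (base point,
   direction, names of the crossings) made in writing down the code of a
   diagram; the others are the Reidemeister moves. *)
Inductive move : seq letter -> seq letter -> Prop :=
| MoveBasePoint m G : move G (rot m G)
| MoveReverse G : move G (rev G)
| MoveRename f G : injective f -> move G (map (rename f) G)
| MoveR1 i o s A :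
    move ([:: (i, o, s); (i, ~~ o, s)] ++ A) A
| MoveR2 i j s d A B :
    move ([:: (i, true, s); (j, true, ~~ s)] ++ A ++
          ordered_pair d (i, false, s) (j, false, ~~ s) ++ B)
         (A ++ B)
| MoveR3 i j k a b c e A B C :
    let T := top_strand i j (e == c) (e == b) in
    let M := middle_strand i k (e == c) (e == a) in
    let L := bottom_strand j k (e == b) (e == a) in
    move (T a ++ A ++ M b ++ B ++ L c ++ C)
         (T (~~ a) ++ A ++ M (~~ b) ++ B ++ L (~~ c) ++ C)
| MoveR3' i j k a b c e A B C :
    let T := top_strand i j (e == c) (e == b) in
    let M := middle_strand i k (e == c) (e == a) in
    let L := bottom_strand j k (e == b) (e == a) in
    move (T a ++ A ++ L c ++ B ++ M b ++ C)
         (T (~~ a) ++ A ++ L (~~ c) ++ B ++ M (~~ b) ++ C).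

(* Two diagrams represent the same (unoriented) knot iff they are related by
   Reidemeister moves.  Requiring both ends of each step to be diagrams makes
   the inverse of a second move legal only along a common face. *)
Definition same_knot : seq letter -> seq letter -> Prop :=
  clos_refl_sym_trans _ (fun G H => [/\ diagram G, diagram H & move G H]).

Lemma same_knot_diagram G H : same_knot G H -> diagram G = diagram H.
Proof. by elim=> // [x y [-> ->]|x y z _ -> _ ->]. Qed.

Lemma has_crossings G :
  exists m, `[< exists2 H, same_knot G H & crossings H = m >].
Proof. by exists (crossings G); apply/asboolP; exists G => //; apply: rst_refl. Qed.

(* The crossing number of the knot represented by the diagram G. *)
Definition crossing_number (G : seq letter) : nat := ex_minn (has_crossings G).

(* Coordinate at time t, and its derivative just after time t, of a point that
   moves at unit speed in the interval [0, p] starting from 0. *)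
Definition bounce (p t : nat) : nat :=
  let r := t %% (2 * p) in if r <= p then r else 2 * p - r.
Definition bounce_dir (p t : nat) : int :=
  if t %% (2 * p) < p then 1%R else (-1)%R.

Section Billiard.
Variables (n : nat) (w : n.-tuple bool).

Definition ball (t : nat) : nat * nat := (bounce n.+1 t, bounce 3 t).
Definition velocity (t : nat) : int * int :=
  (bounce_dir n.+1 t, bounce_dir 3 t).

(* The first positive time at which the ball is in a corner is
   lcmn 3 n.+1 = 3 * n.+1.  Strands lie on lines x - y = 2a or x + y = 2b, so
   they cross at integral points, at integral times. *)
Definition times : seq nat := iota 0 (lcmn 3 n.+1).+1.

Definition other_times (t : nat) : seq nat :=
  [seq t' <- times | (t' != t) && (ball t' == ball t)].

Definition ascending (t : nat) : bool := (velocity t).1 == (velocity t).2.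

(* The i-th crossing is on the line x = i; the letters 0 and 1 of w are false
   and true. *)
Definition on_top (t : nat) : bool :=
  let one := nth false w (ball t).1.-1 in
  if one then ~~ ascending t else ascending t.

Definition det2 (u v : int * int) : int := (u.1 * v.2 - u.2 * v.1)%R.

Definition passage (t : nat) : letter :=
  let t' := head t (other_times t) in
  let: (u, v) := if on_top t then (velocity t, velocity t')
                 else (velocity t', velocity t) in
  ((ball t).1, on_top t, (0 < det2 u v)%R).

(* The arc that closes up the trajectory outside of the rectangle has no
   crossings, hence contributes no letters. *)
Definition billiard_diagram : seq letter :=
  [seq passage t | t <- times & other_times t != [::]].

End Billiard.

Local Open Scope ring_scope.

Definition uniform_prob (T : finType) (E : T -> Prop) : rat :=
  #|[pred x | `[< E x >]]|%:R / #|T|%:R.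

Definition binz (N : nat) (m : int) : nat :=
  if m is Posz k then 'C(N, k) else 0%N.

Definition binz_lt (N : nat) (m : int) : nat :=
  if m is Posz k then (\sum_(i < k) 'C(N, i))%N else 0%N.

(* Only used when 3 m + l >= 0, so that the absolute value is harmless. *)
Definition F (m : int) (l : nat) : rat :=
  let N := absz (3 * m + l%:Z) in
  let x : rat := m%:~R in
  let y : rat := l%:R in
  (x ^+ 2 + (y + 5) * x + 2) / 2 * (binz N m)%:R
  - (x ^+ 2 + (2 * y + 9) * x + (y ^+ 2 + 7 * y + 2)) / 2 * (binz_lt N m)%:R.

(* Main.v *)
(** A word in {0,1}^n describes a plat on three strands whose crossings lie
alternately between the two lower and the two upper strands.  A half twist of
the three strands can be pushed to the right end and absorbed there, so three
consecutive equal letters may be deleted, and so may the first or last three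
letters if the outermost two of them agree; a block of two equal letters
inside the word is a single crossing followed by a half twist.  What remains
is a word with single letters at both ends and inner blocks of one or two
letters, which gives an alternating plat with one crossing per block.

That this diagram is minimal follows from the Kauffman bracket.  The loops of
a state of a Gauss code are counted by the 2-colourings of the arcs that are
constant on loops, and such a colouring amounts to the set of crossings at
which the colour changes.  Being solutions of linear equations, the colourings
can be summed tangle by tangle, which reduces invariance under the Reidemeister
moves to finite computations.  The sets that come from the all-A and from the
all-B state meet only in the empty set, so the bracket of a diagram with c
crossings has span at most 4c, and a 2x2 transfer matrix shows equality for the
plats above.  Plats are spherical because Euler's inequality, again a count of
2-colourings, is attained by an explicit labelling of the regions.

Finally the words that reduce to a given word satisfy a ballot recursion. *)
Require Import Defs.
From mathcomp Require Import all_boot all_algebra.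
From mathcomp Require Import zify ring boolp.
From Stdlib Require Import Relation_Operators.

Set Implicit Arguments.
Unset Strict Implicit.
Unset Printing Implicit Defensive.

(* [over] is also a constant of the ssreflect library. *)
Import Defs.
Import GRing.Theory Num.Theory.

Local Open Scope nat_scope.

(** * Sets of crossings as bit assignments *)

Section Assignments.
Variable T : eqType.
Implicit Types (x y z : T -> bool) (i j k : T) (ns : seq T) (P Q : pred (T -> bool)).

Definition xorp x y : T -> bool := fun k => x k (+) y k.
Definition update x i b : T -> bool := fun k => if k == i then b else x k.
Definition supported ns x := forall k, k \notin ns -> x k = false.

Fixpoint assignments ns : seq (T -> bool) :=
  if ns is i :: ns' then
    [seq update x i false | x <- assignments ns']
      ++ [seq update x i true | x <- assignments ns']
  else [:: xpred0].

Lemma xorpA : associative xorp.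
Proof. by move=> x y z; apply: funext => k; rewrite /xorp addbA. Qed.

Lemma xorpC : commutative xorp.
Proof. by move=> x y; apply: funext => k; rewrite /xorp addbC. Qed.

Lemma xorpp x : xorp x x = xpred0.
Proof. by apply: funext => k; rewrite /xorp addbb. Qed.

Lemma xorp0 : right_id xpred0 xorp.
Proof. by move=> x; apply: funext => k; rewrite /xorp addbF. Qed.

Lemma xorpK y : cancel (xorp^~ y) (xorp^~ y).
Proof. by move=> x; rewrite -xorpA xorpp xorp0. Qed.

Lemma update_at x i b : update x i b i = b.
Proof. by rewrite /update eqxx. Qed.

Lemma update_off x i b k : k != i -> update x i b k = x k.
Proof. by rewrite /update => /negbTE ->. Qed.

Lemma update_id x i : update x i (x i) = x.
Proof. by apply: funext => k; rewrite /update; case: eqP => [->|]. Qed.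

Lemma update0 i : update xpred0 i false = xpred0.
Proof. exact: (update_id xpred0 i). Qed.

Lemma updateC x i j b c : i != j ->
  update (update x i b) j c = update (update x j c) i b.
Proof.
move=> nij; apply: funext => k; rewrite /update; case: (eqVneq k j) => // ->.
by rewrite eq_sym (negbTE nij).
Qed.

Lemma update_xorp x y i b c :
  update (xorp x y) i (b (+) c) = xorp (update x i b) (update y i c).
Proof. by apply: funext => k; rewrite /update /xorp; case: ifP. Qed.

Lemma supported_xorp ns x y :
  supported ns x -> supported ns y -> supported ns (xorp x y).
Proof. by move=> sx sy k kns; rewrite /xorp sx ?sy. Qed.

Lemma supported_update ns x i b : supported ns x -> supported (i :: ns) (update x i b).
Proof.
by move=> sx k; rewrite inE negb_or => /andP[ki kns]; rewrite update_off ?sx.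
Qed.

Lemma supported_tail ns x i : supported (i :: ns) x -> supported ns (update x i false).
Proof.
move=> sx k kns; rewrite /update; case: eqP => // /eqP ki.
by rewrite sx // inE negb_or ki.
Qed.

Lemma size_assignments ns : size (assignments ns) = 2 ^ size ns.
Proof. by elim: ns => //= i ns IH; rewrite size_cat !size_map IH addnn expnS mul2n. Qed.

Section Sums.
Local Open Scope ring_scope.
Variable V : nmodType.
Implicit Type F : (T -> bool) -> V.

Lemma sum_assignments_cons i ns F :
  \sum_(x <- assignments (i :: ns)) F x =
  \sum_(x <- assignments ns) F (update x i false)
    + \sum_(x <- assignments ns) F (update x i true).
Proof. by rewrite /= big_cat !big_map. Qed.

Lemma eq_sum_assignments ns F1 F2 : (forall x, supported ns x -> F1 x = F2 x) ->
  \sum_(x <- assignments ns) F1 x = \sum_(x <- assignments ns) F2 x.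
Proof.
elim: ns F1 F2 => [|i ns IH] F1 F2 eqF; first by rewrite !big_seq1 eqF.
by rewrite !sum_assignments_cons; congr (_ + _); apply: IH => x sx;
   apply: eqF; apply: supported_update.
Qed.

Lemma sum_assignments_cat L ns F : {in ns, forall k, k \notin L} ->
  \sum_(x <- assignments (L ++ ns)) F x =
  \sum_(x <- assignments ns) \sum_(y <- assignments L) F (xorp y x).
Proof.
elim: L F => [|i L IH] F disj.
  by apply: eq_bigr => x _; rewrite big_seq1 xorpC xorp0.
rewrite cat_cons sum_assignments_cons !IH; try by move=> k /disj; case/norP.
rewrite -big_split; apply: eq_sum_assignments => x sx.
have xi : x i = false by apply: sx; apply/negP => /disj; rewrite mem_head.
rewrite sum_assignments_cons; congr (_ + _); apply: eq_bigr => y _;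
  by rewrite -[in RHS](update_id x i) xi -update_xorp addbF.
Qed.

Lemma sum_assignments_catCA i s1 s2 F :
  \sum_(x <- assignments (s1 ++ i :: s2)) F x
  = \sum_(x <- assignments (i :: s1 ++ s2)) F x.
Proof.
elim: s1 F => [//|j s1 IH] F; have [<-|nij] := eqVneq i j.
  by rewrite !cat_cons sum_assignments_cons !IH -sum_assignments_cons.
rewrite !cat_cons sum_assignments_cons !IH !sum_assignments_cons addrACA.
by congr (_ + _ + (_ + _)); apply: eq_bigr => x _; rewrite updateC.
Qed.

Lemma perm_sum_assignments ns ns' F : perm_eq ns ns' ->
  \sum_(x <- assignments ns) F x = \sum_(x <- assignments ns') F x.
Proof.
move=> pe; pose S ns F' := \sum_(x <- assignments ns) F' x.
rewrite -!/(S _ F); congr (_ F); apply: catCA_perm_subst pe => s1 s2 s3.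
apply: funext => {}F; rewrite /S; elim: s1 F => //= i s1 IH F.
by rewrite sum_assignments_catCA -cat_cons !sum_assignments_cons !IH.
Qed.

Lemma sum_assignments_shift ns y F : supported ns y ->
  \sum_(x <- assignments ns) F (xorp x y) = \sum_(x <- assignments ns) F x.
Proof.
elim: ns y F => [|i ns IH] y F sy.
  by rewrite !big_seq1; congr (F _); apply: funext => k; rewrite /xorp sy.
have updE b x : xorp (update x i b) y = update (xorp x (update y i false)) i (b (+) y i).
  rewrite -[in LHS](update_id y i) -update_xorp.
  by apply: funext => k; rewrite /update /xorp; case: eqP.
rewrite !sum_assignments_cons; under eq_bigr => x _ do rewrite updE.
under [X in _ + X]eq_bigr => x _ do rewrite updE.
rewrite !(IH _ (fun x => F (update x i _)) (supported_tail sy)).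
by case: (y i) => //=; rewrite addrC.
Qed.

End Sums.

Definition nsat ns P : nat := count P (assignments ns).

Lemma nsatE ns P : nsat ns P = \sum_(x <- assignments ns) P x.
Proof. by rewrite /nsat -sum1_count big_mkcond; apply: eq_bigr => x _; case: (P x). Qed.

Lemma nsat_cons i ns P :
  nsat (i :: ns) P
  = nsat ns (fun x => P (update x i false)) + nsat ns (fun x => P (update x i true)).
Proof. by rewrite /nsat /= count_cat !count_map. Qed.

Lemma nsat_le ns P : nsat ns P <= 2 ^ size ns.
Proof. by rewrite -size_assignments count_size. Qed.

Lemma eq_nsat ns P Q : (forall x, supported ns x -> P x = Q x) -> nsat ns P = nsat ns Q.
Proof. by move=> PQ; rewrite !nsatE; apply: eq_sum_assignments => x sx; rewrite PQ. Qed.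

Lemma perm_nsat ns ns' P : perm_eq ns ns' -> nsat ns P = nsat ns' P.
Proof. by move=> pe; rewrite !nsatE; apply: perm_sum_assignments. Qed.

Lemma nsat_shift ns y P : supported ns y -> nsat ns (fun x => P (xorp x y)) = nsat ns P.
Proof.
by move=> sy; rewrite !nsatE; apply: (sum_assignments_shift (fun x => nat_of_bool (P x))).
Qed.

Lemma nsat_gt0 ns P : 0 < nsat ns P -> exists2 y, supported ns y & P y.
Proof.
elim: ns P => [|i ns IH] P.
  by rewrite /nsat /= addn0 lt0b => P0; exists xpred0.
rewrite nsat_cons addn_gt0 => /orP[] /IH [y sy Py]; eexists; try exact: Py;
  exact: supported_update.
Qed.

Lemma nsat_pos ns P : P xpred0 -> 0 < nsat ns P.
Proof.
elim: ns P => [|i ns IH] P P0; first by rewrite /nsat /= P0.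
by rewrite nsat_cons addn_gt0 IH ?update0.
Qed.

Definition subspace P := P xpred0 /\ forall x y, P x -> P y -> P (xorp x y).

Lemma subspaceT : subspace predT. Proof. by []. Qed.

Lemma subspaceI P Q : subspace P -> subspace Q -> subspace (predI P Q).
Proof.
case=> P0 PD [Q0 QD]; split=> [|x y]; first by rewrite /= P0.
by move=> /andP[Px Qx] /andP[Py Qy]; rewrite /= PD ?QD.
Qed.

Lemma subspace_xorp P x y : subspace P -> P y -> P (xorp x y) = P x.
Proof.
move=> [_ PD] Py; apply/idP/idP => Px; last exact: PD.
by rewrite -(xorpK y x); apply: PD.
Qed.

Lemma subspace_update P i : subspace P -> subspace (fun x => P (update x i false)).
Proof.
move=> [P0 PD]; split=> [|x y Px Py]; first by rewrite update0.
by rewrite -[false](addbb false) update_xorp; apply: PD.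
Qed.

Lemma nsat_subspace_pow2 ns P : subspace P -> exists l, nsat ns P = 2 ^ l.
Proof.
elim: ns P => [|i ns IH] P sP; first by exists 0; rewrite /nsat /= sP.1.
have [l El] := IH _ (subspace_update i sP).
rewrite nsat_cons El.
case: (posnP (nsat ns (fun x => P (update x i true)))) => [->|/nsat_gt0[y sy Py]].
  by exists l; rewrite addn0.
exists l.+1; rewrite expnS mul2n -addnn; congr (_ + _); rewrite -El.
rewrite -(nsat_shift (fun x => P (update x i true)) sy); apply: eq_count => x.
by rewrite -[true]/(false (+) true) update_xorp subspace_xorp.
Qed.

Lemma nsat_subspace_half ns P (q : (T -> bool) -> bool) :
  subspace P -> {morph q : x y / xorp x y >-> x (+) y} ->
  nsat ns P <= 2 * nsat ns (fun x => P x && ~~ q x).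
Proof.
move=> sP qD; pose onP Q := nsat ns (fun x => P x && Q x).
have -> : nsat ns P = onP (predC q) + onP q.
  by rewrite /onP !nsatE -big_split; apply: eq_bigr => x _ /=; case: (P x) (q x) => [] [].
rewrite -/(onP (predC q)) mul2n -addnn leq_add2l.
case: (posnP (onP q)) => [->//|/nsat_gt0[y sy /andP[Py qy]]].
rewrite /onP -(nsat_shift (fun x => P x && q x) sy).
by apply: sub_count => x; rewrite subspace_xorp // qD qy addbT.
Qed.

Lemma nsat_le1 ns P : uniq ns ->
  (forall x y, supported ns x -> supported ns y -> P x -> P y -> x = y) -> nsat ns P <= 1.
Proof.
elim: ns P => [|i ns IH] P /=; first by rewrite /nsat /= addn0 leq_b1.
case/andP=> i_ns u_ns inj; rewrite nsat_cons.
have half_le1 b : nsat ns (fun x => P (update x i b)) <= 1.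
  apply: IH => // x y sx sy Px Py; apply: funext => k.
  have := congr1 (fun z => z k)
    (inj _ _ (supported_update (i := i) b sx) (supported_update b sy) Px Py).
  by rewrite /update; case: eqP => // ->; rewrite sx ?sy.
case: (posnP (nsat ns (fun x => P (update x i false)))) => [->|]; first by rewrite add0n.
case/nsat_gt0=> y sy Py.
case: (posnP (nsat ns (fun x => P (update x i true)))) => [->|]; first by rewrite addn0.
case/nsat_gt0=> z sz Pz.
have := inj _ _ (supported_update (i := i) false sy) (supported_update true sz) Py Pz.
by move/(congr1 (fun f => f i)); rewrite !update_at.
Qed.

Lemma nsat_transversal ns P Q : uniq ns -> subspace P -> subspace Q ->
    (forall z, supported ns z -> P z -> Q z -> z = xpred0) ->
  nsat ns P * nsat ns Q <= 2 ^ size ns.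
Proof.
move=> u_ns sP sQ PQ0.
have -> : nsat ns P * nsat ns Q
    = \sum_(z <- assignments ns) nsat ns (fun x => P x && Q (xorp z x)).
  under [RHS]eq_bigr => z _ do rewrite nsatE.
  rewrite exchange_big nsatE big_distrl; apply: eq_sum_assignments => x sx /=.
  rewrite -(nsat_shift Q sx) nsatE big_distrr /=; apply: eq_bigr => z _.
  by rewrite -mulnb.
rewrite -size_assignments -sum1_size.
apply: leq_sum => z _; apply: nsat_le1 => // x y sx sy /andP[Px Qx] /andP[Py Qy].
have xy0 : xorp x y = xpred0.
  apply: PQ0; first exact: supported_xorp.
    by rewrite subspace_xorp.
  have -> : xorp x y = xorp (xorp z x) (xorp z y).
    by rewrite (xorpC z y) xorpA -(xorpA z) (xorpC z) xorpK.
  by rewrite subspace_xorp.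
by rewrite -(xorpK y x) xy0 xorpC xorp0.
Qed.

End Assignments.

Lemma sum_assignments_map (V : nmodType) (T U : eqType) (f : T -> U) (ns : seq T)
    (F : (T -> bool) -> V) : injective f ->
  (\sum_(x <- assignments (map f ns)) F (x \o f) = \sum_(x <- assignments ns) F x)%R.
Proof.
move=> injf; elim: ns F => [|i ns IH] F; first by rewrite !big_seq1.
rewrite [map _ _]/= !sum_assignments_cons.
have updE b x : update x (f i) b \o f = update (x \o f) i b.
  by apply: funext => k; rewrite /update /= (inj_eq injf).
by congr (_ + _)%R; under eq_bigr => x _ do rewrite updE; apply: (IH (fun x => F (update x i _))).
Qed.

Lemma nsat_map (T U : eqType) (f : T -> U) (ns : seq T) (P : pred (T -> bool)) : injective f ->
  nsat (map f ns) (fun x => P (x \o f)) = nsat ns P.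
Proof.
by move=> injf; rewrite !nsatE (sum_assignments_map _ (fun x => nat_of_bool (P x)) injf).
Qed.

(** * The bracket of a Gauss code *)

Section Colourings.
Variable T : eqType.
Implicit Types (x y s sg : T -> bool) (i k : T) (g ns : seq T) (c d : bool).

Definition parity x g : bool := odd (count x g).

(* The bits x record at which crossings the colour of the arcs changes; starting
   with colour c, [entry_parity x i c g] is the sum of the colours of the arcs by
   which the code g enters its passages through i. *)
Fixpoint entry_parity x i c g : bool :=
  if g is a :: g' then ((a == i) && c) (+) entry_parity x i (c (+) x a) g' else false.

Lemma parity_cat x g1 g2 : parity x (g1 ++ g2) = parity x g1 (+) parity x g2.
Proof. by rewrite /parity count_cat oddD. Qed.

Lemma parity_cons x a g : parity x (a :: g) = x a (+) parity x g.
Proof. by rewrite /parity /= oddD oddb. Qed.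

Lemma parity_rev x g : parity x (rev g) = parity x g.
Proof. by rewrite /parity count_rev. Qed.

Lemma parity0 g : parity xpred0 g = false.
Proof. by rewrite /parity count_pred0. Qed.

Lemma eq_in_parity x y g : {in g, x =1 y} -> parity x g = parity y g.
Proof. by move=> xy; rewrite /parity (eq_in_count xy). Qed.

Lemma entry_parity_cat x i c g1 g2 :
  entry_parity x i c (g1 ++ g2)
  = entry_parity x i c g1 (+) entry_parity x i (c (+) parity x g1) g2.
Proof.
elim: g1 c => [|a g1 IH] c /=; first by rewrite addbF.
by rewrite IH parity_cons !addbA.
Qed.

Lemma entry_parity_notin x i c g : i \notin g -> entry_parity x i c g = false.
Proof.
by elim: g c => //= a g IH c; rewrite inE negb_or eq_sym => /andP[/negbTE-> /IH->].
Qed.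

Lemma entry_parity_start x i c g :
  entry_parity x i c g = entry_parity x i false g (+) (c && odd (count_mem i g)).
Proof.
elim: g c => [|a g IH] c /=; first by rewrite andbF.
rewrite (IH (c (+) x a)) (IH (false (+) x a)) oddD oddb.
by case: (a == i) c (x a) (entry_parity _ _ _ _) (odd _) => [] [] [] [] [].
Qed.

Lemma entry_parity0 i g : entry_parity xpred0 i false g = false.
Proof. by elim: g => //= a g ->; rewrite andbF. Qed.

Lemma entry_parity_xorp x y i c d g :
  entry_parity (xorp x y) i (c (+) d) g = entry_parity x i c g (+) entry_parity y i d g.
Proof.
elim: g c d => //= a g IH c d.
have -> : c (+) d (+) xorp x y a = (c (+) x a) (+) (d (+) y a) by rewrite /xorp addbACA.
by rewrite IH andb_addr addbACA.
Qed.

Lemma eq_in_entry_parity x y i c g :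
  {in g, x =1 y} -> entry_parity x i c g = entry_parity y i c g.
Proof.
elim: g c => //= a g IH c xy; rewrite xy ?mem_head // IH // => k kg.
by rewrite xy // inE kg orbT.
Qed.

Lemma entry_parity_rev x i c g :
  entry_parity x i c (rev g)
  = entry_parity x i (c (+) parity x g) g (+) (odd (count_mem i g) && x i).
Proof.
elim: g c => [|a g IH] c //=.
rewrite rev_cons -cats1 entry_parity_cat IH parity_rev parity_cons /= addbF oddD oddb.
rewrite [c (+) (x a (+) _)]addbCA -addbA [_ (+) x a]addbC !addbA addbb /=.
by case: eqP => [->|_] /=; rewrite ?addbF //;
   case: (x i) c (parity x g) (entry_parity _ _ _ _) (odd _) => [] [] [] [] [].
Qed.

(* The two arcs entering a crossing have different colours exactly when the
   colour changes there (oriented smoothing), or equal colours (the other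
   smoothing).  The A-smoothing, s i = true, is the oriented one iff the crossing
   is positive, i.e. sg i = true.  Since one colour may be chosen freely, there
   are twice as many 2-colourings as solutions x. *)
Definition loop_colouring ns sg g s x : bool :=
  all (fun i => entry_parity x i false g == ((s i == sg i) && x i)) ns.

Lemma subspace_loop_colouring ns sg g s : subspace (loop_colouring ns sg g s).
Proof.
split; first by apply/allP => i _; rewrite entry_parity0 andbF.
move=> x y /allP cx /allP cy; apply/allP => i ins.
rewrite -[false](addbb false) entry_parity_xorp (eqP (cx _ ins)) (eqP (cy _ ins)).
by rewrite -andb_addr.
Qed.

End Colourings.

Lemma entry_parity_map (T U : eqType) (f : T -> U) (x : U -> bool) i c (g : seq T) :
  injective f -> entry_parity x (f i) c (map f g) = entry_parity (x \o f) i c g.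
Proof. by move=> injf; elim: g c => //= a g IH c; rewrite IH (inj_eq injf). Qed.

Lemma logn2_le N c : N <= 2 ^ c -> logn 2 N <= c.
Proof.
case: (posnP N) => [->|N0 NL]; first by rewrite logn0.
rewrite -(@leq_exp2l 2) //; apply: leq_trans NL.
by apply: dvdn_leq => //; apply: pfactor_dvdnn.
Qed.

Section Bracket.
Local Open Scope ring_scope.

(* With t = A^2 and c crossings, [code_bracket] is A^(3c) times the Kauffman
   bracket: a state with a A-smoothings and l + 1 loops contributes
   t^a t^(c - l) (- (1 + t^2))^l, and N = 2^l. *)
Definition loop_value : {poly int} := - (1 + 'X^2).

Definition state_weight (c N : nat) : {poly int} :=
  'X^(c - logn 2 N) * loop_value ^+ logn 2 N.

Definition code_bracket (T : eqType) (ns : seq T) (sg : T -> bool) (g : seq T) : {poly int} :=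
  \sum_(s <- assignments ns)
    'X^(count s ns) * state_weight (size ns) (nsat ns (loop_colouring ns sg g s)).

Lemma state_weight_double c N : (0 < N)%N ->
  state_weight c.+1 (2 * N) = loop_value * state_weight c N.
Proof.
by move=> N0; rewrite /state_weight lognM // logn_prime //= add1n subSS exprS mulrCA.
Qed.

Lemma state_weight_addX m c N : (N <= 2 ^ c)%N ->
  state_weight (m + c) N = 'X^m * state_weight c N.
Proof. by move=> /logn2_le lN; rewrite /state_weight -addnBA // exprD mulrA. Qed.

Section BracketInvariance.
Variable T : eqType.
Implicit Types (ns g : seq T) (sg : T -> bool).

Lemma eq_code_bracket ns sg sg' g g' : {in ns, sg =1 sg'} ->
    (forall x, {in ns, forall i, entry_parity x i false g = entry_parity x i false g'}) ->
  code_bracket ns sg g = code_bracket ns sg' g'.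
Proof.
move=> eq_sg eq_g; apply: eq_bigr => s _; congr (_ * state_weight _ _).
by apply: eq_nsat => x _; apply: eq_in_all => i ins; rewrite eq_sg ?eq_g.
Qed.

Lemma perm_code_bracket ns ns' sg g : perm_eq ns ns' ->
  code_bracket ns sg g = code_bracket ns' sg g.
Proof.
move=> pe; rewrite /code_bracket (perm_sum_assignments _ pe); apply: eq_bigr => s _.
rewrite (permP pe) (perm_size pe) (perm_nsat _ pe).
by congr (_ * state_weight _ _); apply: eq_count => x; rewrite /loop_colouring (perm_all _ pe).
Qed.

Lemma code_bracket_catC ns sg g1 g2 : (forall x, parity x (g1 ++ g2) = false) ->
  code_bracket ns sg (g1 ++ g2) = code_bracket ns sg (g2 ++ g1).
Proof.
move=> even; apply: eq_code_bracket => // x i _; rewrite !entry_parity_cat /=.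
rewrite (entry_parity_start _ _ (parity x g1)) (entry_parity_start _ _ (parity x g2)).
have := even x; have := even (pred1 i); rewrite !parity_cat {1 2}/parity /=.
by case: (parity x g1) (parity x g2) (entry_parity _ _ _ _) (entry_parity _ _ _ _)
  (odd _) (odd _) => [] [] [] [] [] [].
Qed.

Lemma code_bracket_rev ns sg g : (forall x, parity x g = false) ->
  code_bracket ns sg (rev g) = code_bracket ns sg g.
Proof.
move=> even; apply: eq_code_bracket => // x i _; rewrite entry_parity_rev even.
by have := even (pred1 i); rewrite /parity /= => ->; rewrite addbF.
Qed.

End BracketInvariance.

Lemma code_bracket_map (T U : eqType) (f : T -> U) ns sg g : injective f ->
  code_bracket (map f ns) sg (map f g) = code_bracket ns (sg \o f) g.
Proof.
move=> injf; rewrite /code_bracket -(sum_assignments_map _ _ injf).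
apply: eq_bigr => s _; rewrite count_map size_map -(nsat_map _ _ injf).
congr (_ * state_weight _ _); apply: eq_count => x; rewrite /loop_colouring all_map.
by apply: eq_all => i /=; rewrite entry_parity_map.
Qed.

End Bracket.

(** * Tangles of three strands and the Reidemeister moves *)

Lemma assignmentsP (T : eqType) (ns : seq T) (P : pred (T -> bool)) :
  all P (assignments ns) -> forall x, supported ns x -> P x.
Proof.
elim: ns P => [|i ns IH] P /=.
  by rewrite andbT => P0 x sx; have -> : x = xpred0 by apply: funext => k; apply: sx.
rewrite all_cat !all_map => /andP[Pf Pt] x sx.
have sx' := supported_tail sx; have xE : x = update (update x i false) i (x i).
  by apply: funext => k; rewrite /update; case: eqP => [->|].
by rewrite xE; case: (x i); [apply: (IH _ Pt) | apply: (IH _ Pf)].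
Qed.

(* A code t1 A t2 B t3 C is cut into the tangle (t1, t2, t3) on the crossings L and
   the outside (A, B, C).  Each sees the other only through four bits: the colour
   changes a, b along A, B and the changes u, v along t1, t2; the changes along t3
   and C are determined by them. *)
Section Tangle.
Variables (T : eqType) (L t1 t2 t3 : seq T).
Implicit Types (o s x y : T -> bool) (a b u v : bool) (l : seq nat).

(* o i tells whether the crossing i has the oriented smoothing. *)
Definition tangle_colouring o a b y : bool :=
  all (fun i => entry_parity y i false t1
                (+) entry_parity y i (parity y t1 (+) a) t2
                (+) entry_parity y i (parity y t1 (+) a (+) parity y t2 (+) b) t3
                == o i && y i) L.

Definition tangle_count o a b u v : nat :=
  nsat L (fun y => [&& tangle_colouring o a b y, parity y t1 == u & parity y t2 == v]).

Definition bit_quadruples : seq (bool * bool * bool * bool) :=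
  let bits := [:: false; true] in
  [seq (p, q.1, q.2) | p <- [seq (a, b) | a <- bits, b <- bits],
                       q <- [seq (u, v) | u <- bits, v <- bits]].

Definition tangle_table o : seq nat :=
  [seq tangle_count o q.1.1.1 q.1.1.2 q.1.2 q.2 | q <- bit_quadruples].

Definition table_entry l a b u v : nat := nth 0 l (index (a, b, u, v) bit_quadruples).

Lemma tangle_tableE o a b u v : table_entry (tangle_table o) a b u v = tangle_count o a b u v.
Proof.
have q_in : (a, b, u, v) \in bit_quadruples by case: a b u v => [] [] [] [].
by rewrite /table_entry (nth_map (a, b, u, v)) ?index_mem // nth_index.
Qed.

Lemma head_tangle_table_gt0 o : 0 < head 0 (tangle_table o).
Proof.
rewrite -[head _ _]/(tangle_count o false false false false).
rewrite /tangle_count; apply: nsat_pos; rewrite !parity0 andbT; apply/allP => i _.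
by rewrite !parity0 /= !entry_parity0 andbF.
Qed.

Definition small_table l : bool := all (fun q => q <= 1) l.
Definition even_table l : bool := all (fun q => (q == 0) || (q == 2)) l.
Definition flat_table (m : nat) l : bool := small_table l || (0 < m) && even_table l.

Variables (sg_in sg_out : T -> bool).

Definition tangle_states : seq (nat * seq nat) :=
  [seq (count s L, tangle_table (fun i => s i == sg_in i)) | s <- assignments L].

Variables (ns A B C : seq T).

Definition outside_colouring s u v x : bool :=
  all (fun m => entry_parity x m u A (+) entry_parity x m (u (+) parity x A (+) v) B
                (+) entry_parity x m (parity x A (+) parity x B) C
                == (s m == sg_out m) && x m) ns.

Definition outside_count s (l : seq nat) : nat :=
  \sum_(x <- assignments ns) \sum_(u : bool) \sum_(v : bool)
    table_entry l (parity x A) (parity x B) u v * outside_colouring s u v x.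

Lemma outside_count_gt0 s l : 0 < head 0 l -> 0 < outside_count s l.
Proof.
move=> l0; apply: leq_trans (nsat_pos ns (P := fun x =>
  [&& ~~ parity x A, ~~ parity x B & outside_colouring s false false x]) _) _.
  by rewrite !parity0; apply/allP => m _; rewrite !parity0 !entry_parity0 andbF.
rewrite nsatE; apply: leq_sum => x _; rewrite !big_bool.
case: (parity x A) (parity x B) (outside_colouring s false false x) => [] [] [] //=.
by rewrite /table_entry /= nth0 muln1; case: (head 0 l) l0 => // q _; rewrite !addnS.
Qed.

Lemma outside_count_le s l : small_table l -> outside_count s l <= 2 ^ (size ns).+2.
Proof.
move=> /allP l1; rewrite 2!expnS mulnA -size_assignments -sum1_size big_distrr.
apply: leq_sum => x _; rewrite !big_bool -[leqRHS]/(1 + 1 + (1 + 1)).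
have entry_le1 a b u v (r : bool) : table_entry l a b u v * r <= 1.
  case: r; rewrite ?muln0 // muln1 /table_entry.
  have [lt|ge] := ltnP (index (a, b, u, v) bit_quadruples) (size l).
    by apply: l1; apply: mem_nth.
  by rewrite nth_default.
by rewrite !leq_add.
Qed.

Lemma outside_count_half s l : even_table l ->
  outside_count s l = 2 * outside_count s (map half l).
Proof.
move=> /allP l2; rewrite big_distrr; apply: eq_bigr => x _.
rewrite big_distrr; apply: eq_bigr => u _; rewrite big_distrr; apply: eq_bigr => v _ /=.
rewrite mulnA; congr (_ * _); rewrite /table_entry; move: (index _ _) => n.
have [lt|ge] := ltnP n (size l); last by rewrite !nth_default ?size_map.
by rewrite (nth_map 0) //; case/orP: (l2 _ (mem_nth 0 lt)) => /eqP ->.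
Qed.

Variable sg : T -> bool.
Hypothesis sg_inE : {in L, sg =1 sg_in}.
Hypothesis sg_outE : {in ns, sg =1 sg_out}.
Hypothesis even_tangle : forall y, parity y (t1 ++ t2 ++ t3) = false.
Hypothesis tangle_names : {subset t1 ++ t2 ++ t3 <= L}.
Hypothesis outside_names : {in A ++ B ++ C, forall k, k \notin L}.
Hypothesis disjoint_names : {in ns, forall k, k \notin L}.

Let code := t1 ++ A ++ t2 ++ B ++ t3 ++ C.

Lemma entry_parity_code x k :
  let: (u, a, v, b) := (parity x t1, parity x A, parity x t2, parity x B) in
  entry_parity x k false code =
  (entry_parity x k false t1 (+) entry_parity x k (u (+) a) t2
     (+) entry_parity x k (u (+) a (+) v (+) b) t3)
  (+) (entry_parity x k u A (+) entry_parity x k (u (+) a (+) v) B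
     (+) entry_parity x k (a (+) b) C).
Proof.
have t3E : parity x t3 = parity x t1 (+) parity x t2.
  by have := even_tangle x; rewrite !parity_cat; do 3!case: (parity x _).
rewrite /code !entry_parity_cat addFb t3E.
move: (parity x t1) (parity x A) (parity x t2) (parity x B) => u a v b.
have -> : u (+) a (+) v (+) b (+) (u (+) v) = a (+) b by case: u a v b => [] [] [] [].
by do 6!case: (entry_parity _ _ _ _).
Qed.

Lemma loop_colouring_code s sL x y : supported L sL -> supported ns s ->
    supported L y -> supported ns x ->
  loop_colouring (L ++ ns) sg code (xorp sL s) (xorp y x) =
  tangle_colouring (fun i => sL i == sg_in i) (parity x A) (parity x B) y
  && outside_colouring s (parity y t1) (parity y t2) x.
Proof.
move=> ssL ss sy sx.
have off_L z : supported ns z -> {in L, forall k, z k = false}.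
  by move=> sz k kL; apply: sz; apply: contraL kL => /disjoint_names.
have on_tangle D : {subset D <= t1 ++ t2 ++ t3} -> {in D, xorp y x =1 y}.
  by move=> Dt k /Dt /tangle_names kL; rewrite /xorp (off_L x sx) // addbF.
have on_outside D : {subset D <= A ++ B ++ C} -> {in D, xorp y x =1 x}.
  by move=> DABC k /DABC /outside_names kL; rewrite /xorp sy.
have [y1 y2 y3] : [/\ {in t1, xorp y x =1 y}, {in t2, xorp y x =1 y} & {in t3, xorp y x =1 y}].
  by split; apply: on_tangle => k; rewrite !mem_cat => ->; rewrite ?orbT.
have [xA xB xC] : [/\ {in A, xorp y x =1 x}, {in B, xorp y x =1 x} & {in C, xorp y x =1 x}].
  by split; apply: on_outside => k; rewrite !mem_cat => ->; rewrite ?orbT.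
rewrite /loop_colouring all_cat; congr andb; apply: eq_in_all => k k_in.
  have notin D : {subset D <= A ++ B ++ C} -> k \notin D.
    by move=> DABC; apply: contraL k_in => /DABC /outside_names.
  rewrite entry_parity_code !(eq_in_parity y1, eq_in_parity y2, eq_in_parity xA, eq_in_parity xB).
  rewrite (eq_in_entry_parity _ _ y1) (eq_in_entry_parity _ _ y2) (eq_in_entry_parity _ _ y3).
  rewrite [X in _ (+) X == _](_ : _ = false) ?addbF.
    by rewrite sg_inE // /xorp (off_L s ss k k_in) (off_L x sx k k_in) !addbF.
  by rewrite !entry_parity_notin //; apply: notin => j; rewrite !mem_cat => ->; rewrite ?orbT.
have kL := disjoint_names k_in.
have notin D : {subset D <= t1 ++ t2 ++ t3} -> k \notin D.
  by move=> Dt; apply: contra kL => /Dt /tangle_names.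
rewrite entry_parity_code !(eq_in_parity y1, eq_in_parity y2, eq_in_parity xA, eq_in_parity xB).
rewrite (eq_in_entry_parity _ _ xA) (eq_in_entry_parity _ _ xB) (eq_in_entry_parity _ _ xC).
rewrite [X in X (+) _ == _](_ : _ = false) ?addFb.
  by rewrite sg_outE // /xorp !(ssL _ kL) (sy _ kL).
by rewrite !entry_parity_notin //; apply: notin => j; rewrite !mem_cat => ->; rewrite ?orbT.
Qed.

Lemma nsat_code s sL : supported L sL -> supported ns s ->
  nsat (L ++ ns) (loop_colouring (L ++ ns) sg code (xorp sL s))
  = outside_count s (tangle_table (fun i => sL i == sg_in i)).
Proof.
move=> ssL ss; rewrite nsatE sum_assignments_cat //; apply: eq_sum_assignments => x sx.
rewrite (eq_sum_assignments (fun y sy => congr1 nat_of_bool (loop_colouring_code ssL ss sy sx))).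
rewrite !big_bool !tangle_tableE /tangle_count !nsatE !big_distrl -!big_split /=.
apply: eq_bigr => y _; rewrite -!mulnb.
case: (parity y t1) (parity y t2) => [] []; rewrite /= ?muln1 ?muln0 ?mul0n ?addn0 ?add0n //.
Qed.

Local Open Scope ring_scope.
Implicit Type w : seq nat -> {poly int}.

Definition table_value w (m : nat) l : {poly int} :=
  if small_table l then 'X^m * w l else 'X^(m.-1) * loop_value * w (map half l).

Definition tangle_bracket w : {poly int} :=
  \sum_(p <- tangle_states) 'X^(p.1) * table_value w (size L) p.2.

Lemma state_weight_outside s l m : flat_table m l -> (0 < head 0 l)%N ->
    (outside_count s l <= 2 ^ (m + size ns))%N ->
  'X^2 * state_weight (m + size ns) (outside_count s l)
  = table_value (fun l => state_weight (size ns).+2 (outside_count s l)) m l.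
Proof.
move=> fl l0 N_le; rewrite -state_weight_addX // addnCA add2n.
rewrite /table_value; case: ifP fl => [l1 _|].
  by rewrite state_weight_addX // outside_count_le.
rewrite /flat_table => -> /=; case: m {N_le} => // m l2; have half_small : small_table (map half l).
  by rewrite /small_table all_map; apply: sub_all l2 => q /orP[] /eqP ->.
have half_gt0 : (0 < head 0%N (map half l))%N.
  by move: l2 l0; case: (l) => //= q l' /andP[/orP[]/eqP->].
rewrite outside_count_half // addSn state_weight_double ?outside_count_gt0 //.
by rewrite state_weight_addX ?outside_count_le //= mulrCA mulrA.
Qed.

Lemma code_bracket_tangle : all (flat_table (size L) \o snd) tangle_states ->
  'X^2 * code_bracket (L ++ ns) sg code =
  \sum_(s <- assignments ns) 'X^(count s ns) *
    tangle_bracket (fun l => state_weight (size ns).+2 (outside_count s l)).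
Proof.
rewrite all_map => /assignmentsP flat.
rewrite /code_bracket sum_assignments_cat // mulr_sumr; apply: eq_sum_assignments => s ss.
rewrite /tangle_bracket big_map !mulr_sumr; apply: eq_sum_assignments => sL ssL.
rewrite nsat_code // count_cat size_cat /=.
have -> : count (xorp sL s) L = count sL L.
  by apply: eq_in_count => k kL; rewrite /xorp ss ?addbF //; apply: contraL kL => /disjoint_names.
have -> : count (xorp sL s) ns = count s ns.
  by apply: eq_in_count => k /disjoint_names kL; rewrite /xorp ssL.
rewrite -state_weight_outside ?head_tangle_table_gt0 //; first by rewrite exprD; ring.
  exact: (flat sL).
by rewrite -nsat_code // -size_cat nsat_le.
Qed.

End Tangle.

(** * Invariance of the bracket *)

Definition passage_key (a : letter) : nat * bool := (name a, over a).
Definition names (G : seq letter) : seq nat := [seq name a | a <- G].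

Definition crossing_sign (G : seq letter) (i : nat) : bool :=
  has (fun a => (name a == i) && positive a) G.

Lemma mateK : involutive mate.
Proof. by move=> [[i o] s]; rewrite /mate /name /over /positive /= negbK. Qed.

Lemma perm_gauss_code G H : perm_eq G H -> gauss_code G = gauss_code H.
Proof.
move=> pGH; rewrite /gauss_code (perm_uniq (perm_map _ pGH)) (perm_all _ pGH).
by congr (_ && _); apply: eq_all => a; rewrite (perm_mem pGH).
Qed.

Lemma gauss_code_rename f G : injective f -> gauss_code (map (rename f) G) = gauss_code G.
Proof.
move=> injf; rewrite /gauss_code -map_comp all_map; congr (_ && _).
  rewrite -[RHS](map_inj_uniq (f := fun k : nat * bool => (f k.1, k.2))) -?map_comp //.
  by move=> [i o] [i' o'] [/injf -> ->].
apply: eq_all => a /=; have -> : mate (rename f a) = rename f (mate a) by [].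
rewrite mem_map // => -[[i o] s] [[i' o'] s']; rewrite /rename /name /over /positive /=.
by case=> /injf -> -> ->.
Qed.

Section GaussCode.
Variable G : seq letter.
Hypothesis gaussG : gauss_code G.

Lemma gauss_code_uniq : uniq [seq passage_key a | a <- G].
Proof. by case/andP: gaussG. Qed.

Lemma gauss_code_mate a : a \in G -> mate a \in G.
Proof. by move=> aG; case/andP: gaussG => _ /allP; apply. Qed.

Lemma passage_key_inj : {in G &, injective passage_key}.
Proof.
elim: G gauss_code_uniq => //= a s IH /andP[fa us] x y; rewrite !inE.
case/predU1P=> [->|xs] /predU1P[->|ys] // E; last exact: IH.
- by move: fa; rewrite E map_f.
- by move: fa; rewrite -E map_f.
Qed.

Lemma perm_map_mate : perm_eq (map mate G) G.
Proof.
have uG : uniq G := map_uniq gauss_code_uniq.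
have uM : uniq (map mate G) by rewrite map_inj_uniq //; apply: can_inj mateK.
apply: uniq_perm => //; apply: (uniq_min_size uM _ _).2; last by rewrite size_map.
by move=> _ /mapP[b bG ->]; apply: gauss_code_mate.
Qed.

Lemma count_names (x : pred nat) :
  count x (names G) = 2 * count (fun a => x (name a) && over a) G.
Proof.
have -> : count x (names G) =
    count (fun a => x (name a) && over a) G + count (fun a => x (name a) && ~~ over a) G.
  by rewrite count_map; elim: (G) => //= a s ->; case: (x _) (over _) => [] []; lia.
rewrite mul2n -addnn; congr (_ + _); rewrite -(permP perm_map_mate) count_map.
by apply: eq_count => -[[i o] s] /=; rewrite /mate /name /over /= negbK.
Qed.

Lemma parity_names x : parity x (names G) = false.
Proof. by rewrite /parity count_names mul2n odd_double. Qed.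

Lemma crossings_over : crossings G = count over G.
Proof. by rewrite /crossings -(size_map name) -count_predT count_names mul2n doubleK. Qed.

Lemma crossings_undup : crossings G = size (undup (names G)).
Proof.
rewrite crossings_over -size_filter -(size_map name); apply: perm_size.
apply: uniq_perm; last 1 first.
- move=> k; rewrite mem_undup; apply/mapP/mapP => -[a].
    by rewrite mem_filter => /andP[_ aG] ->; exists a.
  case: (boolP (over a)) => oa aG ->; first by exists a => //; rewrite mem_filter oa.
  by exists (mate a) => //; rewrite mem_filter gauss_code_mate // andbT.
- rewrite map_inj_in_uniq ?filter_uniq ?(map_uniq gauss_code_uniq) //.
  move=> a b; rewrite !mem_filter => /andP[/= oa aG] /andP[/= ob bG] nab.
  by apply: passage_key_inj => //; rewrite /passage_key nab oa ob.
- exact: undup_uniq.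
Qed.

Lemma crossing_signE a : a \in G -> crossing_sign G (name a) = positive a.
Proof.
move=> aG; apply/hasP/idP => [[b bG /andP[/eqP nab pb]]|pa]; last by exists a; rewrite ?eqxx.
have [oab|oab] := eqVneq (over b) (over a).
  by rewrite -(passage_key_inj bG aG) // /passage_key nab oab.
rewrite -(passage_key_inj (gauss_code_mate bG) aG) //.
by move: nab oab; rewrite /passage_key /mate /name /over /= => ->; case: b.1.2 a.1.2 => [] [].
Qed.

End GaussCode.

Lemma crossing_sign_sub G H i : gauss_code G -> gauss_code H -> {subset H <= G} ->
  i \in names H -> crossing_sign G i = crossing_sign H i.
Proof. by move=> gG gH sub /mapP[a aH ->]; rewrite !crossing_signE // sub. Qed.

Section GaussCodeCat.
Variables S K : seq letter.
Hypotheses (gaussSK : gauss_code (S ++ K)) (gaussS : gauss_code S).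

Lemma gauss_code_cat_names : {in names K, forall k, k \notin names S}.
Proof.
have := gauss_code_uniq gaussSK; rewrite map_cat cat_uniq => /and3P[_ /hasPn disj _].
move=> _ /mapP[a aK ->]; apply/mapP => -[b bS nab].
have [oab|oab] := eqVneq (over b) (over a).
  have := disj _ (map_f passage_key aK); rewrite /passage_key nab -oab.
  by rewrite -[X in X \in _]/(passage_key b) map_f.
have := disj _ (map_f passage_key aK); rewrite -[passage_key a]/(name a, over a) nab.
have -> : over a = over (mate b) by move: oab; rewrite /mate /over /=; case: b.1.2 a.1.2 => [] [].
by rewrite -[X in X \in _]/(passage_key (mate b)) map_f ?gauss_code_mate.
Qed.

Lemma gauss_code_catr : gauss_code K.
Proof.
apply/andP; split.
  by have := gauss_code_uniq gaussSK; rewrite map_cat cat_uniq => /and3P[].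
apply/allP => a aK; have := gauss_code_mate gaussSK (_ : a \in S ++ K).
rewrite !mem_cat aK orbT => /(_ isT) /orP[aS|//].
by have := gauss_code_cat_names (map_f name aK); rewrite -[name a]/(name (mate a)) map_f.
Qed.

End GaussCodeCat.

Definition bracket (G : seq letter) : {poly int} :=
  code_bracket (undup (names G)) (crossing_sign G) (names G).

Lemma bracket_rot m G : gauss_code G -> bracket (rot m G) = bracket G.
Proof.
move=> gG; rewrite /bracket /names map_rot -/(names G).
rewrite (perm_code_bracket (ns' := undup (names G))); last first.
  by apply: perm_undup => k; rewrite mem_rot.
rewrite /rot -code_bracket_catC ?cat_take_drop; last by move=> x; apply: parity_names.
by apply: eq_code_bracket => // k _; apply: perm_has; rewrite perm_rot.
Qed.

Lemma bracket_rev G : gauss_code G -> bracket (rev G) = bracket G.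
Proof.
move=> gG; rewrite /bracket /names map_rev -/(names G).
rewrite (perm_code_bracket (ns' := undup (names G))); last first.
  by apply: perm_undup => k; rewrite mem_rev.
rewrite code_bracket_rev; last by move=> x; apply: parity_names.
by apply: eq_code_bracket => // k _; apply: has_rev.
Qed.

Lemma bracket_rename f G : injective f -> bracket (map (rename f) G) = bracket G.
Proof.
move=> injf; rewrite /bracket.
have -> : names (map (rename f) G) = map f (names G) by rewrite /names -!map_comp.
rewrite undup_map_inj // code_bracket_map //; apply: eq_code_bracket => // k _.
rewrite /= /crossing_sign has_map; apply: eq_has => a /=.
by rewrite /rename /name /= (inj_eq injf).
Qed.

Section LocalReplacement.
Local Open Scope ring_scope.
Implicit Types (S A B C G H : seq letter) (w : seq nat -> {poly int}).

Definition local_bracket w S1 S2 S3 : {poly int} :=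
  tangle_bracket (undup (names (S1 ++ S2 ++ S3))) (names S1) (names S2) (names S3)
    (crossing_sign (S1 ++ S2 ++ S3)) w.

Definition local_flat S1 S2 S3 : bool :=
  let L := undup (names (S1 ++ S2 ++ S3)) in
  all (fun p => flat_table (size L) p.2)
    (tangle_states L (names S1) (names S2) (names S3) (crossing_sign (S1 ++ S2 ++ S3))).

Definition outside_weight A B C (s : nat -> bool) (l : seq nat) : {poly int} :=
  let K := A ++ B ++ C in let ns := undup (names K) in
  state_weight (size ns).+2
    (outside_count (crossing_sign K) ns (names A) (names B) (names C) s l).

Lemma bracket_local S1 S2 S3 A B C :
    let G := S1 ++ A ++ S2 ++ B ++ S3 ++ C in let ns := undup (names (A ++ B ++ C)) in
    gauss_code G -> gauss_code (S1 ++ S2 ++ S3) -> local_flat S1 S2 S3 ->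
  'X^2 * bracket G
  = \sum_(s <- assignments ns) 'X^(count s ns) * local_bracket (outside_weight A B C s) S1 S2 S3.
Proof.
move=> G ns gG; set S := S1 ++ S2 ++ S3; set K := A ++ B ++ C => gS flat.
have pG : perm_eq G (S ++ K).
  by apply/permP => P; rewrite /G /S /K !count_cat; lia.
have gSK : gauss_code (S ++ K) by rewrite -(perm_gauss_code pG).
have gK := gauss_code_catr gSK gS; have disj := gauss_code_cat_names gSK gS.
have eq_names D : {subset D <= G} -> gauss_code D ->
    {in undup (names D), crossing_sign G =1 crossing_sign D}.
  by move=> DG gD k; rewrite mem_undup; apply: crossing_sign_sub.
have namesS : names S = names S1 ++ names S2 ++ names S3 by rewrite /names !map_cat.
have namesK : names K = names A ++ names B ++ names C by rewrite /names !map_cat.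
have namesG : names G
    = names S1 ++ names A ++ names S2 ++ names B ++ names S3 ++ names C by rewrite /names !map_cat.
rewrite -(code_bracket_tangle (sg := crossing_sign G)) -?namesG; last first.
- exact: flat.
- by move=> k; rewrite !mem_undup; apply: disj.
- by move=> k; rewrite -namesK mem_undup; apply: disj.
- by move=> k; rewrite -namesS mem_undup.
- by move=> y; rewrite -namesS; apply: parity_names.
- by apply: eq_names => // a aK; rewrite (perm_mem pG) mem_cat aK orbT.
- by apply: eq_names => // a aS; rewrite (perm_mem pG) mem_cat aS.
congr (_ * _); apply: perm_code_bracket; apply: uniq_perm; rewrite ?undup_uniq //.
  rewrite cat_uniq !undup_uniq /= andbT; apply/hasPn => k.
  by rewrite !mem_undup; apply: disj.
by move=> k; rewrite mem_cat !mem_undup (perm_mem (perm_map name pG)) map_cat mem_cat.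
Qed.

Definition laurent_assoc (p q : {poly int}) : Prop :=
  exists i j (b : bool), 'X^i * p = (-1) ^+ b * 'X^j * q.

Lemma laurent_assoc_refl p : laurent_assoc p p.
Proof. by exists 0%N, 0%N, false; rewrite !expr0 !mul1r. Qed.

Lemma laurent_assoc_sym p q : laurent_assoc p q -> laurent_assoc q p.
Proof.
case=> i [j [b E]]; exists j, i, b.
by rewrite -mulrA E !mulrA -expr2 sqrr_sign mul1r.
Qed.

Lemma laurent_assoc_trans q p r :
  laurent_assoc p q -> laurent_assoc q r -> laurent_assoc p r.
Proof.
case=> i [j [b E]] [i' [j' [b' E']]]; exists (i + i')%N, (j' + j)%N, (b (+) b').
by rewrite !exprD signr_addb [LHS]mulrAC E -[LHS]mulrA [q * _]mulrC E'; ring.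
Qed.

Definition locally_assoc S1 S2 S3 T1 T2 T3 : Prop :=
  [/\ gauss_code (S1 ++ S2 ++ S3) && gauss_code (T1 ++ T2 ++ T3),
      local_flat S1 S2 S3 && local_flat T1 T2 T3 &
      exists (i j : nat) (b : bool), forall w,
      'X^i * local_bracket w S1 S2 S3 = (-1) ^+ b * 'X^j * local_bracket w T1 T2 T3].

Lemma laurent_assoc_local S1 S2 S3 T1 T2 T3 A B C : locally_assoc S1 S2 S3 T1 T2 T3 ->
    gauss_code (S1 ++ A ++ S2 ++ B ++ S3 ++ C) -> gauss_code (T1 ++ A ++ T2 ++ B ++ T3 ++ C) ->
  laurent_assoc (bracket (S1 ++ A ++ S2 ++ B ++ S3 ++ C))
                (bracket (T1 ++ A ++ T2 ++ B ++ T3 ++ C)).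
Proof.
case=> /andP[gS gT] /andP[fS fT] [i [j [b ST]]] gG gH; exists (i + 2)%N, (j + 2)%N, b.
have splitX n (p : {poly int}) : 'X^(n + 2) * p = 'X^n * ('X^2 * p) by rewrite exprD mulrA.
rewrite -[RHS]mulrA !splitX !bracket_local // !mulr_sumr; apply: eq_bigr => s _.
by rewrite mulrCA ST; ring.
Qed.

End LocalReplacement.

Ltac compute_local_bracket :=
  rewrite /local_bracket /tangle_bracket;
  repeat match goal with |- context [tangle_states ?L ?t1 ?t2 ?t3 ?sg] =>
    let states := eval vm_compute in (tangle_states L t1 t2 t3 sg) in
    change (tangle_states L t1 t2 t3 sg) with states end;
  rewrite !big_cons !big_nil /table_value /loop_value /=.

Lemma local_R1 o s : locally_assoc [:: (0, o, s); (0, ~~ o, s)] [::] [::] [::] [::] [::].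
Proof.
split; [by case: o s => [] [] | by case: o s => [] []; vm_compute |].
exists 0, (if s then 3 else 0), true => w.
by case: o s => [] []; compute_local_bracket; ring.
Qed.

Lemma local_R2 d s :
  locally_assoc [:: (0, true, s); (1, true, ~~ s)]
    (ordered_pair d (0, false, s) (1, false, ~~ s)) [::] [::] [::] [::].
Proof.
split; [by case: d s => [] [] | by case: d s => [] []; vm_compute |].
by exists 0, 3, false => w; case: d s => [] []; compute_local_bracket; ring.
Qed.

Lemma local_R3 (o : bool) a b c e :
  let T := top_strand 0 1 (e == c) (e == b) in
  let M := middle_strand 0 2 (e == c) (e == a) in
  let L := bottom_strand 1 2 (e == b) (e == a) in
  locally_assoc
    (T a) (if o then M b else L c) (if o then L c else M b)
    (T (~~ a)) (if o then M (~~ b) else L (~~ c)) (if o then L (~~ c) else M (~~ b)).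
Proof.
move=> T M L; rewrite {}/T {}/M {}/L.
split; [by case: o a b c e => [] [] [] [] [] | by case: o a b c e => [] [] [] [] []; vm_compute |].
by exists 0, 0, false => w; case: o a b c e => [] [] [] [] []; compute_local_bracket; ring.
Qed.

Lemma injective_extension (ns ms : seq nat) : uniq ns -> uniq ms -> size ns = size ms ->
  exists2 f : nat -> nat, injective f & map f ns = ms.
Proof.
move=> un um sz; pose M := (sumn ms).+1.
have ltM k : k \in ms -> k < M.
  by rewrite /M; elim: (ms) => //= m l IH; rewrite inE => /predU1P[->|/IH]; lia.
pose f k := if k \in ns then nth 0 ms (index k ns) else k + M.
have f_ms k : k \in ns -> f k \in ms.
  by move=> kns; rewrite /f kns mem_nth // -sz index_mem.
exists f.
  move=> x y; rewrite /f; case: ifP => xn; case: ifP => yn.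
  - move/eqP; rewrite nth_uniq -?sz ?index_mem // => /eqP E.
    by rewrite -(nth_index 0 xn) E nth_index.
  - by have := ltM _ (f_ms _ xn); rewrite /f xn => lt E; rewrite E in lt; lia.
  - by have := ltM _ (f_ms _ yn); rewrite /f yn => lt E; rewrite -E in lt; lia.
  - by lia.
apply: (@eq_from_nth _ 0); rewrite ?size_map // => k lt.
by rewrite (nth_map 0) // /f mem_nth // index_uniq.
Qed.

Lemma uniq_passage_keys_slots S1 S2 S3 A B C :
  gauss_code (S1 ++ A ++ S2 ++ B ++ S3 ++ C) -> uniq (map passage_key (S1 ++ S2 ++ S3)).
Proof.
move/gauss_code_uniq; apply: subseq_uniq; apply: map_subseq.
apply: cat_subseq => //; rewrite -[S2 ++ S3]cat0s; apply: cat_subseq; first exact: sub0seq.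
apply: cat_subseq => //; rewrite -[S3]cat0s; apply: cat_subseq; first exact: sub0seq.
exact: prefix_subseq.
Qed.

Lemma bracket_R1 i o s A : let G := [:: (i, o, s); (i, ~~ o, s)] ++ A in
  gauss_code G -> gauss_code A -> laurent_assoc (bracket G) (bracket A).
Proof.
have [f injf [f_i]] := @injective_extension [:: i] [:: 0] erefl erefl erefl.
rewrite /= -(gauss_code_rename _ injf) -(gauss_code_rename A injf) => gG gA.
rewrite -(bracket_rename _ injf) -(bracket_rename A injf).
rewrite /= /rename /name /over /positive /= f_i in gG *.
have := laurent_assoc_local (A := map (rename f) A) (B := [::]) (C := [::]) (local_R1 o s).
by rewrite /= cats0; apply.
Qed.

Lemma bracket_R2 i j s d A B :
  let G := [:: (i, true, s); (j, true, ~~ s)] ++ A ++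
           ordered_pair d (i, false, s) (j, false, ~~ s) ++ B in
  gauss_code G -> gauss_code (A ++ B) -> laurent_assoc (bracket G) (bracket (A ++ B)).
Proof.
move=> G gG gAB; have u_ij : uniq [:: i; j].
  have := gauss_code_uniq gG; rewrite /= !inE andbT negb_or => /andP[/andP[ij _] _].
  by apply: contra ij => /eqP ->.
have [f injf [f_i f_j]] := @injective_extension [:: i; j] [:: 0; 1] u_ij erefl erefl.
rewrite /= -(gauss_code_rename _ injf) in gG; rewrite -(gauss_code_rename _ injf) in gAB.
rewrite -(bracket_rename _ injf) -(bracket_rename (A ++ B) injf).
have := laurent_assoc_local (A := map (rename f) A) (B := map (rename f) B) (C := [::])
  (local_R2 d s).
move: gG gAB; rewrite /G /= !map_cat /ordered_pair !cats0.
by case: d {G} => /=; rewrite /rename /name /over /positive /= f_i f_j => gG gAB; apply.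
Qed.

Lemma rename_strands f i j k si sj sk a b c :
  [/\ map (rename f) (top_strand i j si sj a) = top_strand (f i) (f j) si sj a,
      map (rename f) (middle_strand i k si sk b) = middle_strand (f i) (f k) si sk b &
      map (rename f) (bottom_strand j k sj sk c) = bottom_strand (f j) (f k) sj sk c].
Proof. by split; [case: a | case: b | case: c]. Qed.

Lemma uniq_triangle i j k si sj sk a b c :
  uniq (map passage_key (top_strand i j si sj a ++ middle_strand i k si sk b
                         ++ bottom_strand j k sj sk c)) ->
  uniq [:: i; j; k].
Proof.
move=> u; rewrite /= !inE negb_or andbT -andbA; apply/and3P; split; apply: contraTneq u => ->;
  by case: a b c => [] [] []; rewrite /= !inE !eqxx ?orbT ?andbF.
Qed.

Lemma bracket_R3 (o : bool) i j k a b c e A B C :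
  let T := top_strand i j (e == c) (e == b) in
  let M := middle_strand i k (e == c) (e == a) in
  let L := bottom_strand j k (e == b) (e == a) in
  let G a b c := T a ++ A ++ (if o then M b else L c) ++ B ++ (if o then L c else M b) ++ C in
  gauss_code (G a b c) -> gauss_code (G (~~ a) (~~ b) (~~ c)) ->
  laurent_assoc (bracket (G a b c)) (bracket (G (~~ a) (~~ b) (~~ c))).
Proof.
move=> T M L G gG gH; have u_ijk : uniq [:: i; j; k].
  apply: (@uniq_triangle i j k (e == c) (e == b) (e == a) a b c).
  have := uniq_passage_keys_slots gG; rewrite -/T -/M -/L; case: (o) => //.
  by rewrite (perm_uniq (perm_map _ (_ : perm_eq _ (T a ++ M b ++ L c)))) // perm_cat2l perm_catC.
have [f injf [f_i f_j f_k]] := @injective_extension _ [:: 0; 1; 2] u_ijk erefl erefl.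
have renameG a' b' c' : map (rename f) (G a' b' c') =
    let T := top_strand 0 1 (e == c) (e == b) in
    let M := middle_strand 0 2 (e == c) (e == a) in
    let L := bottom_strand 1 2 (e == b) (e == a) in
    T a' ++ map (rename f) A ++ (if o then M b' else L c') ++ map (rename f) B ++
      (if o then L c' else M b') ++ map (rename f) C.
  have [eT eM eL] := rename_strands f i j k (e == c) (e == b) (e == a) a' b' c'.
  by rewrite !map_cat eT; case: (o); rewrite eM eL f_i f_j f_k.
rewrite -(bracket_rename (G a b c) injf) -(bracket_rename (G (~~ a) _ _) injf).
rewrite -(gauss_code_rename _ injf) in gG; rewrite -(gauss_code_rename _ injf) in gH.
by move: gG gH; rewrite !renameG; apply: laurent_assoc_local; apply: local_R3.
Qed.

Lemma bracket_move G H : gauss_code G -> gauss_code H -> move G H ->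
  laurent_assoc (bracket G) (bracket H).
Proof.
move=> gG gH mv; case: mv gG gH => {G H}.
- by move=> m G gG _; rewrite bracket_rot //; apply: laurent_assoc_refl.
- by move=> G gG _; rewrite bracket_rev //; apply: laurent_assoc_refl.
- by move=> f G injf _ _; rewrite bracket_rename //; apply: laurent_assoc_refl.
- by move=> i o s A; apply: bracket_R1.
- by move=> i j s d A B; apply: bracket_R2.
- by move=> i j k a b c e A B C T M L gG gH; apply: (bracket_R3 (o := true) gG gH).
- by move=> i j k a b c e A B C T M L gG gH; apply: (bracket_R3 (o := false) gG gH).
Qed.

Lemma bracket_same_knot G H : same_knot G H -> laurent_assoc (bracket G) (bracket H).
Proof.
elim=> [x y [/andP[gx _] /andP[gy _] mv]|x|x y _|x y z _ xy _ yz].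
- exact: bracket_move.
- exact: laurent_assoc_refl.
- exact: laurent_assoc_sym.
- exact: laurent_assoc_trans xy yz.
Qed.

(** * The span of the bracket *)

Section StateLoops.
Variable T : eqType.
Implicit Types (s sg : T -> bool) (ns L g : seq T) (P : pred (T -> bool)).

Definition state_defect sg g s i (x : T -> bool) : bool :=
  entry_parity x i false g (+) ((s i == sg i) && x i).

Lemma state_defect_xorp sg g s i :
  {morph state_defect sg g s i : x y / xorp x y >-> x (+) y}.
Proof.
move=> x y; rewrite /state_defect -[false](addbb false) entry_parity_xorp andb_addr.
exact: addbACA.
Qed.

Lemma subspace_state_defect sg g s i : subspace (predC (state_defect sg g s i)).
Proof.
split=> [|x y /negbTE Dx /negbTE Dy] /=; last by rewrite state_defect_xorp Dx Dy.
by rewrite /state_defect entry_parity0 andbF.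
Qed.

Lemma nsat_loop_colouring_le ns L sg g s s' P : subspace P ->
  nsat ns (predI (loop_colouring L sg g s) P)
  <= 2 ^ count (fun i => s i != s' i) L * nsat ns (predI (loop_colouring L sg g s') P).
Proof.
elim: L P => [|i L IH] P sP; first by rewrite mul1n.
pose D t x := ~~ state_defect sg g t i x.
have consE t : nsat ns (predI (loop_colouring (i :: L) sg g t) P)
    = nsat ns (predI (loop_colouring L sg g t) (predI (D t) P)).
  by apply: eq_count => x; rewrite /= -negb_add -andbA andbCA.
rewrite !consE [count _ _]/=; have [ss'|_] := eqVneq (s i) (s' i).
  have -> : D s = D s' by apply: funext => x; rewrite /D /= /state_defect ss'.
  by rewrite add0n; apply: IH; apply: subspaceI sP; apply: subspace_state_defect.
apply: (@leq_trans (nsat ns (predI (loop_colouring L sg g s) P))).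
  by apply: sub_count => x /and3P[/= -> _ ->].
apply: leq_trans (IH _ sP) _; rewrite add1n expnSr -mulnA leq_mul2l; apply/orP; right.
have sub := subspaceI (subspace_loop_colouring L sg g s') sP.
apply: leq_trans (nsat_subspace_half ns sub (state_defect_xorp sg g s' i)) _.
by rewrite leq_mul2l; apply/orP; right; apply: sub_count => x /= /andP[/andP[-> ->]]; rewrite andbT.
Qed.

Definition state_loops ns sg g s : nat := logn 2 (nsat ns (loop_colouring ns sg g s)).

Lemma nsat_loop_colouringE ns sg g s :
  nsat ns (loop_colouring ns sg g s) = 2 ^ state_loops ns sg g s.
Proof.
rewrite /state_loops.
by have [l ->] := nsat_subspace_pow2 ns (subspace_loop_colouring ns sg g s); rewrite pfactorK.
Qed.

Lemma state_loops_le ns sg g s s' :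
  state_loops ns sg g s <= count (fun i => s i != s' i) ns + state_loops ns sg g s'.
Proof.
rewrite -(@leq_exp2l 2) // expnD -!nsat_loop_colouringE.
have predIT t : nsat ns (loop_colouring ns sg g t)
    = nsat ns (predI (loop_colouring ns sg g t) predT).
  by apply: eq_count => x; rewrite /= andbT.
by rewrite !predIT; apply: nsat_loop_colouring_le; apply: subspaceT.
Qed.

(* A common solution for the all-A and the all-B state vanishes at each crossing:
   in one of the two states it has no oriented smoothing there. *)
Lemma state_loops_dual ns sg g : uniq ns ->
  state_loops ns sg g xpredT + state_loops ns sg g xpred0 <= size ns.
Proof.
move=> u_ns; rewrite -(@leq_exp2l 2) // expnD -!nsat_loop_colouringE.
apply: nsat_transversal => //; try exact: subspace_loop_colouring.
move=> z sz /allP solA /allP solB; apply: funext => k.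
have [kns|/sz //] := boolP (k \in ns).
by move: (solA _ kns) (solB _ kns) => /eqP -> /eqP; case: (sg k) (z k) => [] [].
Qed.

End StateLoops.

Section Window.
Local Open Scope ring_scope.

Lemma coef_state_weight a c N k : (N <= 2 ^ c)%N ->
    let l := logn 2 N in (k < a + c - l)%N || (a + c + l < k)%N ->
  ('X^a * state_weight c N)`_k = 0.
Proof.
move=> /logn2_le lc l hk; rewrite /state_weight -/l mulrA -exprD coefXnM; case: ltnP => // ka.
case/orP: hk => hk; first by exfalso; move: lc hk ka; rewrite -/l; lia.
apply: nth_default; apply: leq_trans (size_poly_exp_leq _ _) _.
have size_loop_value : (size loop_value <= 3)%N.
  rewrite /loop_value size_polyN; apply: leq_trans (size_polyD _ _) _.
  by rewrite size_poly1 size_polyXn.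
have : ((size loop_value).-1 * l <= 2 * l)%N by rewrite leq_mul2r; apply/orP; right; lia.
by move: lc; rewrite -/l; lia.
Qed.

Lemma code_bracket_span (T : eqType) (ns : seq T) sg g k k' : uniq ns ->
    (code_bracket ns sg g)`_k != 0 -> (code_bracket ns sg g)`_k' != 0 ->
  (k' <= k + 2 * size ns)%N.
Proof.
move=> u_ns.
pose lA := state_loops ns sg g xpredT; pose lB := state_loops ns sg g xpred0.
have bounds i : (code_bracket ns sg g)`_i != 0 ->
    (size ns - lB <= i <= 2 * size ns + lA)%N.
  apply: contraNT => hi; rewrite /code_bracket coef_sum big1 // => s _.
  apply: coef_state_weight; first exact: nsat_le.
  have := state_loops_le ns sg g s xpredT; have := state_loops_le ns sg g s xpred0.
  rewrite -/lA -/lB.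
  have -> : count (fun i => s i != false) ns = count s ns by apply: eq_count => j; case: (s j).
  have -> : count (fun i => s i != true) ns = count (predC s) ns.
    by apply: eq_count => j /=; case: (s j).
  rewrite /state_loops; have := count_predC s ns.
  move: hi; rewrite negb_and -!ltnNge; clearbody lA lB.
  move: (count s _) (count (predC s) _) (size _) (logn 2 _) => a b c l; lia.
by move=> /bounds + /bounds; have := state_loops_dual sg g u_ns; rewrite -/lA -/lB; lia.
Qed.

Lemma bracket_span G k k' : gauss_code G -> (bracket G)`_k != 0 -> (bracket G)`_k' != 0 ->
  (k' <= k + 2 * crossings G)%N.
Proof.
by move=> gG; rewrite (crossings_undup gG); apply: code_bracket_span; apply: undup_uniq.
Qed.

Lemma laurent_assoc_coef p q k d : laurent_assoc p q -> p`_k != 0 -> p`_(k + d) != 0 ->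
  exists m, q`_m != 0 /\ q`_(m + d) != 0.
Proof.
case=> i [j [b E]] pk pkd.
have transfer_coef n : p`_n != 0 -> (j <= i + n)%N && (q`_(i + n - j) != 0).
  have := congr1 (fun r : {poly int} => r`_(i + n)) E.
  rewrite coefXnM ltnNge leq_addr /= addKn => ->.
  rewrite -mulrA mulr_sign; case: b {E} => /=; rewrite ?coefN coefXnM; case: ltnP => //= _;
    by rewrite ?oppr0 ?oppr_eq0 ?eqxx.
have /andP[jk qk] := transfer_coef _ pk; have /andP[_ qkd] := transfer_coef _ pkd.
by exists (i + k - j)%N; split=> //; move: qkd; congr (q`_ _ != 0); lia.
Qed.

End Window.

Lemma crossings_ge_span G H k c : same_knot G H -> diagram G ->
  ((bracket G)`_k != 0)%R -> ((bracket G)`_(k + 2 * c) != 0)%R -> c <= crossings H.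
Proof.
move=> GH dG Gk Gkc; have /andP[gH _] : diagram H by rewrite -(same_knot_diagram GH).
have [m [Hm Hmc]] := laurent_assoc_coef (bracket_same_knot GH) Gk Gkc.
by have := bracket_span gH Hm Hmc; lia.
Qed.

(** * Plats on three strands *)

(* The knot is followed from the lower left end along the first leg to the
   right, along the second leg back to the left and along the last one to the
   right again.  A state lists the legs from bottom to top; the item (i, (h, s)) is
   a crossing named i of the two lower (h = false) or the two upper strands
   whose ascending strand is on top iff s. *)
Definition leg : Type := option bool.
Notation first_leg := (None : leg).
Notation back_leg := (Some false : leg).
Notation last_leg := (Some true : leg).
Definition state : Type := (leg * leg * leg)%type.
Definition item : Type := (nat * (bool * bool))%type.

Definition rising (h : bool) (p : state) : leg := if h then p.1.2 else p.1.1.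
Definition falling (h : bool) (p : state) : leg := if h then p.2 else p.1.2.
Definition swap_legs (h : bool) (p : state) : state :=
  if h then (p.1.1, p.2, p.1.2) else (p.1.2, p.1.1, p.2).
Definition distinct_legs (p : state) : bool := uniq [:: p.1.1; p.1.2; p.2].

Definition item_sign (h s : bool) (p : state) : bool :=
  s == ((rising h p == back_leg) (+) (falling h p == back_leg)).

Definition item_letters (r : leg) (p : state) (t : item) : seq letter :=
  let: (i, (h, s)) := t in
  if r == rising h p then [:: (i, s, item_sign h s p)]
  else if r == falling h p then [:: (i, ~~ s, item_sign h s p)] else [::].

Fixpoint strand (r : leg) (p : state) (T : seq item) : seq letter :=
  if T is t :: T' then item_letters r p t ++ strand r (swap_legs t.2.1 p) T' else [::].

Definition plat_code (p : state) (T : seq item) : seq letter :=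
  strand first_leg p T ++ rev (strand back_leg p T) ++ strand last_leg p T.

Definition final_state (p : state) (T : seq item) : state :=
  foldl (fun q t => swap_legs t.2.1 q) p T.

Definition item_names (T : seq item) : seq nat := map fst T.

Definition start (b : bool) : state :=
  if b then (first_leg, back_leg, last_leg) else (first_leg, last_leg, back_leg).

Lemma distinct_legs_swap h p : distinct_legs (swap_legs h p) = distinct_legs p.
Proof. by case: p => [[a b] c]; case: h a b c => [] [[]|] [[]|] [[]|]. Qed.

Lemma distinct_legs_final p T : distinct_legs (final_state p T) = distinct_legs p.
Proof. by elim: T p => //= t T IH p; rewrite IH distinct_legs_swap. Qed.

Lemma distinct_legs_start b : distinct_legs (start b).
Proof. by case: b. Qed.

Lemma strand_cat r p T1 T2 :
  strand r p (T1 ++ T2) = strand r p T1 ++ strand r (final_state p T1) T2.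
Proof. by elim: T1 p => //= t T1 IH p; rewrite IH catA. Qed.

Definition item_pair (p : state) (t : item) : seq letter :=
  let: (i, (h, s)) := t in [:: (i, s, item_sign h s p); (i, ~~ s, item_sign h s p)].

Fixpoint item_pairs (p : state) (T : seq item) : seq letter :=
  if T is t :: T' then item_pair p t ++ item_pairs (swap_legs t.2.1 p) T' else [::].

Lemma perm_plat_code p T : distinct_legs p -> perm_eq (plat_code p T) (item_pairs p T).
Proof.
elim: T p => //= [[i [h s]]] T IH p dp.
have dp' : distinct_legs (swap_legs h p) by rewrite distinct_legs_swap.
apply/permP => P; have := permP (IH _ dp') P.
rewrite /plat_code !rev_cat !count_cat !count_rev /=.
move: (count P (strand _ _ _)) (count P (strand _ _ _)) (count P (strand _ _ _)) => n1 n2 n3 <-.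
by case: h p dp {IH dp'} => [] [[[[]|] [[]|]] [[]|]] //= _; lia.
Qed.

Lemma mem_names_item_pairs p T : names (item_pairs p T) =i item_names T.
Proof. by elim: T p => //= [[i [h s]]] T IH p k; rewrite /= !inE IH orbA orbb. Qed.

Lemma size_item_pairs p T : size (item_pairs p T) = (size T).*2.
Proof. by elim: T p => //= [[i [h s]]] T IH p; rewrite /= IH. Qed.

Lemma gauss_code_item_pairs p T : uniq (item_names T) -> gauss_code (item_pairs p T).
Proof.
elim: T p => //= [[i [h s]]] T IH p /andP[iT uT].
have /andP[u m] := IH (swap_legs h p) uT.
have notin o : (i, o) \notin [seq (name a, over a) | a <- item_pairs (swap_legs h p) T].
  apply: contra iT => /mapP[a aT [Ei _]]; rewrite -(mem_names_item_pairs (swap_legs h p)).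
  by rewrite /= Ei map_f.
apply/andP; split.
  by rewrite /= inE negb_or !notin u !andbT; apply/eqP => -[]; case: (s).
rewrite /= !inE; apply/and3P; split.
- by rewrite eqxx orbT.
- by rewrite /mate /= negbK eqxx.
- by apply: sub_all m => a; rewrite !inE => ->; rewrite !orbT.
Qed.

Lemma gauss_code_plat p T : distinct_legs p -> uniq (item_names T) ->
  gauss_code (plat_code p T).
Proof.
by move=> dp uT; rewrite (perm_gauss_code (perm_plat_code T dp)); apply: gauss_code_item_pairs.
Qed.

Lemma mem_names_plat_code p T : distinct_legs p -> names (plat_code p T) =i item_names T.
Proof.
move=> dp k; rewrite -(mem_names_item_pairs p).
exact: perm_mem (perm_map name (perm_plat_code T dp)) k.
Qed.

Lemma crossings_plat_code p T : distinct_legs p -> crossings (plat_code p T) = size T.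
Proof.
by move=> dp; rewrite /crossings (perm_size (perm_plat_code T dp)) size_item_pairs doubleK.
Qed.

Fixpoint signs_agree (sg : nat -> bool) p (T : seq item) : bool :=
  if T is (i, (h, s)) :: T' then (sg i == item_sign h s p) && signs_agree sg (swap_legs h p) T'
  else true.

Lemma signs_agree_plat_code p T : distinct_legs p -> uniq (item_names T) ->
  signs_agree (crossing_sign (plat_code p T)) p T.
Proof.
move=> dp uT; have gT := gauss_code_plat dp uT.
have {gT}: forall a, a \in item_pairs p T -> crossing_sign (plat_code p T) (name a) = positive a.
  by move=> a; rewrite -(perm_mem (perm_plat_code T dp)); apply: crossing_signE.
move: (crossing_sign _) => sg; elim: T p {dp uT} => //= [[i [h s]]] T IH p H.
rewrite -[item_sign _ _ _]/(positive (i, s, item_sign h s p)) -H ?mem_head // eqxx /=.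
by apply: IH => a aT; apply: H; rewrite !inE aT !orbT.
Qed.

(** * Colourings of a plat, and its bracket *)

Definition colours : Type := (bool * bool * bool)%type.

Definition colour_of (r : leg) (p : state) (c : colours) : bool :=
  if r == p.1.1 then c.1.1 else if r == p.1.2 then c.1.2 else c.2.

Definition step_colours (h b : bool) (c : colours) : colours :=
  if h then (c.1.1, c.2 (+) b, c.1.2 (+) b) else (c.1.2 (+) b, c.1.1 (+) b, c.2).

Fixpoint final_colours (T : seq item) (x : nat -> bool) (c : colours) : colours :=
  if T is (i, (h, _)) :: T' then final_colours T' x (step_colours h (x i) c) else c.

Definition meets (r : leg) h p : bool := (r == rising h p) || (r == falling h p).

Definition strand_names r p T : seq nat := names (strand r p T).

Lemma colour_of_step r p h b c : distinct_legs p ->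
  colour_of r (swap_legs h p) (step_colours h b c) = colour_of r p c (+) (meets r h p && b).
Proof.
case: p c => [[u v] w] [[c0 c1] c2].
by case: r => [[]|]; case: h u v w => [] [[]|] [[]|] [[]|] //= _;
   rewrite /colour_of /meets /rising /falling /= ?addbF.
Qed.

Lemma strand_names_cons r p i h s T : strand_names r p ((i, (h, s)) :: T) =
  nseq (meets r h p) i ++ strand_names r (swap_legs h p) T.
Proof.
rewrite /strand_names /names /= map_cat; congr (_ ++ _).
by rewrite /meets; do 2?case: ifP.
Qed.

Lemma colour_of_final r T x p c : distinct_legs p ->
  colour_of r (final_state p T) (final_colours T x c)
  = colour_of r p c (+) parity x (strand_names r p T).
Proof.
elim: T p c => [|[i [h s]] T IH] p c dp; first by rewrite /= addbF.
rewrite /= IH ?distinct_legs_swap // colour_of_step // strand_names_cons parity_cat.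
by case: (meets r h p); rewrite /= ?parity_cons /= ?addbF ?addbA.
Qed.

(* The strands change colour together at a crossing.  The smoothing that keeps
   the strands horizontal forces the colour change; the other one forces equal
   colours on the left and leaves the new colour free. *)
Definition smoothing_ok (h s st b : bool) (c : colours) : bool :=
  let u := if h then c.1.2 else c.1.1 in
  let v := if h then c.2 else c.1.2 in
  if st == s then u == v else b == u (+) v.

Definition closing_ok (p : state) (c : colours) : bool :=
  colour_of first_leg p c == colour_of back_leg p c.

Fixpoint plat_colouring (T : seq item) (st x : nat -> bool) (p : state) (c : colours) : bool :=
  if T is (i, (h, s)) :: T' then
    smoothing_ok h s (st i) (x i) c
    && plat_colouring T' st x (swap_legs h p) (step_colours h (x i) c)
  else closing_ok p c.

Definition plat_entry_parity x k p c T : bool :=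
  entry_parity x k (colour_of first_leg p c) (strand_names first_leg p T)
  (+) entry_parity x k (colour_of back_leg p c) (strand_names back_leg p T)
  (+) entry_parity x k (colour_of last_leg p c) (strand_names last_leg p T)
  (+) (odd (count_mem k (strand_names back_leg p T)) && x k).

Lemma plat_entry_parity_cons x k p c i h s T : distinct_legs p ->
  plat_entry_parity x k p c ((i, (h, s)) :: T) =
  ((i == k) && (colour_of (rising h p) p c (+) colour_of (falling h p) p c
                (+) (meets back_leg h p && x k)))
  (+) plat_entry_parity x k (swap_legs h p) (step_colours h (x i) c) T.
Proof.
move=> dp; rewrite /plat_entry_parity !strand_names_cons !colour_of_step //.
have entryE r c' D : entry_parity x k c' (nseq (meets r h p) i ++ D) =
    [&& meets r h p, i == k & c'] (+) entry_parity x k (c' (+) (meets r h p && x i)) D.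
  by case: (meets r h p); rewrite /= ?addbF.
rewrite !entryE count_cat oddD.
have -> : odd (count_mem k (nseq (meets back_leg h p) i)) = meets back_leg h p && (i == k).
  by case: (meets back_leg h p) => //=; rewrite addn0 oddb.
move: (entry_parity _ _ _ _) (entry_parity _ _ _ _) (entry_parity _ _ _ _) (odd _)
  => e1 e2 e3 e4.
have -> : colour_of (rising h p) p c (+) colour_of (falling h p) p c =
    (meets first_leg h p && colour_of first_leg p c)
    (+) (meets back_leg h p && colour_of back_leg p c)
    (+) (meets last_leg h p && colour_of last_leg p c).
  case: p c dp {entryE} => [[u v] w] [[c0 c1] c2].
  by case: h u v w => [] [[]|] [[]|] [[]|] //= _;
    rewrite /colour_of /meets /rising /falling /=; case: c0 c1 c2 => [] [] [].
case: (i == k) => /=; last by rewrite !andbF.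
by rewrite andbT andb_addl; do 5![case: (_ && _)]; case: e1 e2 e3 => [] [] [].
Qed.

Lemma plat_entry_parity_notin x k p c T : distinct_legs p -> k \notin item_names T ->
  plat_entry_parity x k p c T = false.
Proof.
elim: T p c => [|[i [h s]] T IH] p c dp; first by rewrite /plat_entry_parity.
rewrite /= inE negb_or eq_sym => /andP[/negbTE ik kT].
by rewrite plat_entry_parity_cons // ik IH ?distinct_legs_swap.
Qed.

Lemma plat_colouringE sg st x p c T : distinct_legs p -> uniq (item_names T) ->
    signs_agree sg p T ->
  plat_colouring T st x p c =
  all (fun k => plat_entry_parity x k p c T == ((st k == sg k) && x k)) (item_names T)
    && closing_ok (final_state p T) (final_colours T x c).
Proof.
elim: T p c => [|[i [h s]] T IH] p c dp //= /andP[iT uT] /andP[/eqP sgi sgT].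
have dp' : distinct_legs (swap_legs h p) by rewrite distinct_legs_swap.
rewrite IH // plat_entry_parity_cons // eqxx plat_entry_parity_notin // addbF -andbA.
congr [&& _, _ & _].
  rewrite sgi /smoothing_ok /item_sign; move: (st i) (x i) => si xi.
  case: p c dp {IH sgT sgi dp'} => [[u v] w] [[c0 c1] c2].
  by case: h u v w => [] [[]|] [[]|] [[]|] //= _; rewrite /colour_of /meets /rising /falling /=;
    case: s si xi c0 c1 c2 => [] [] [] [] [] [].
apply: eq_in_all => k kT; rewrite plat_entry_parity_cons // (_ : (i == k) = false) //.
by apply: contraNF iT => /eqP ->.
Qed.

Lemma entry_parity_plat_code x k p c T : distinct_legs p ->
    colour_of back_leg p c = colour_of last_leg p c ->
    closing_ok (final_state p T) (final_colours T x c) ->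
  entry_parity x k (colour_of first_leg p c) (names (plat_code p T))
  = plat_entry_parity x k p c T.
Proof.
move=> dp cap; rewrite /closing_ok !colour_of_final // => /eqP close.
have -> : names (plat_code p T) = strand_names first_leg p T
    ++ rev (strand_names back_leg p T) ++ strand_names last_leg p T.
  by rewrite /names /plat_code !map_cat map_rev.
rewrite !entry_parity_cat entry_parity_rev parity_rev close !addbK /plat_entry_parity cap.
by rewrite -!addbA; do 2!congr addb; rewrite addbC.
Qed.

(* The colours of the strands next to a turn of the plat: the two upper strands
   are joined if cap = true, the two lower ones otherwise. *)
Definition cap_colours (cap g : bool) : colours := if cap then (false, g, g) else (g, g, false).

Lemma loop_colouring_plat_code sg st x b T (p := start b) :
    uniq (item_names T) -> signs_agree sg p T ->
  loop_colouring (item_names T) sg (names (plat_code p T)) st x =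
  plat_colouring T st x p (cap_colours true false)
  + plat_colouring T st x p (cap_colours true true) :> nat.
Proof.
move=> uT sgT; have dp : distinct_legs p := distinct_legs_start b.
pose joint := parity x (strand_names first_leg p T) (+) parity x (strand_names back_leg p T).
have colour_start g : colour_of first_leg p (cap_colours true g) = false
    /\ colour_of back_leg p (cap_colours true g) = g
    /\ colour_of last_leg p (cap_colours true g) = g by rewrite /p; case: (b).
have closeE g : closing_ok (final_state p T) (final_colours T x (cap_colours true g))
    = (g == joint).
  have [cf [cb _]] := colour_start g; rewrite /closing_ok !colour_of_final // cf cb /joint.
  by case: g {cf cb}; do 2!case: (parity x _).
have colouringE g : g = joint -> loop_colouring (item_names T) sg (names (plat_code p T)) st x
    = all (fun k => plat_entry_parity x k p (cap_colours true g) T == (st k == sg k) && x k)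
        (item_names T).
  move=> gE; apply: eq_all => k; have [cf [cb cl]] := colour_start g.
  rewrite -(entry_parity_plat_code k dp) ?cf ?cb ?cl //.
  by rewrite closeE gE.
rewrite !(plat_colouringE _ _ _ dp uT sgT) !closeE.
by case E : joint; rewrite /= !andbT !andbF ?addn0 (colouringE _ (esym E)).
Qed.

Lemma plat_colouring_update T st x p c i b : i \notin item_names T ->
  plat_colouring T st (update x i b) p c = plat_colouring T st x p c.
Proof.
elim: T p c => //= [[j [h s]]] T IH p c; rewrite inE negb_or => /andP[ij iT].
by rewrite update_off 1?eq_sym // IH.
Qed.

Definition plat_count T st p c : nat :=
  nsat (item_names T) (fun x => plat_colouring T st x p c).

Lemma plat_count_cons i h s T st p c : i \notin item_names T ->
  plat_count ((i, (h, s)) :: T) st p c =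
  smoothing_ok h s (st i) false c * plat_count T st (swap_legs h p) (step_colours h false c)
  + smoothing_ok h s (st i) true c * plat_count T st (swap_legs h p) (step_colours h true c).
Proof.
move=> iT; rewrite /plat_count [item_names _]/= nsat_cons; congr addn; rewrite !nsatE big_distrr;
  by apply: eq_bigr => x _ /=; rewrite update_at plat_colouring_update // mulnb.
Qed.

Definition cap_count cap T st p : nat :=
  plat_count T st p (cap_colours cap false) + plat_count T st p (cap_colours cap true).

Definition joins_upper p T : bool := (final_state p T).1.1 == last_leg.
Definition closable p T : bool := (final_state p T).1.2 != last_leg.

(* cap tells whether the smoothed prefix joins the two upper strands, and
   right_cap whether the right end of the plat does. *)
Fixpoint plat_loops (right_cap cap : bool) (T : seq item) (st : nat -> bool) : nat :=
  if T is (i, (h, s)) :: T' then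
    if st i == s then
      if h == cap then (plat_loops right_cap cap T' st).+1 else plat_loops right_cap h T' st
    else plat_loops right_cap cap T' st
  else cap == right_cap.

Lemma cap_countE cap T st p : distinct_legs p -> uniq (item_names T) -> closable p T ->
  cap_count cap T st p = 2 ^ plat_loops (joins_upper p T) cap T st.
Proof.
elim: T p cap => [|[i [h s]] T IH] p cap dp.
  rewrite /cap_count /plat_count /nsat /= /closing_ok /closable /joins_upper /= => _.
  by case: p dp => [[[[]|] [[]|]] [[]|]] //= _; case: cap.
move=> /= /andP[iT uT] vT; set right_cap := joins_upper _ _.
have {IH vT} IH cap' : cap_count cap' T st (swap_legs h p) = 2 ^ plat_loops right_cap cap' T st.
  by apply: IH; rewrite ?distinct_legs_swap.
rewrite /cap_count !plat_count_cons // /smoothing_ok.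
have [_|_] := eqVneq (st i) s; last first.
  rewrite -IH /cap_count; move: (plat_count T st (swap_legs h p)) => f.
  by case: h cap {right_cap IH} => [] [] /=; lia.
have [<-|] := eqVneq h cap.
  rewrite expnS -IH /cap_count; move: (plat_count T st (swap_legs h p)) => f.
  by case: h {right_cap IH} => /=; lia.
rewrite -IH /cap_count; move: (plat_count T st (swap_legs h p)) => f.
by case: h cap {right_cap IH} => [] [] //= _; lia.
Qed.

Lemma plat_loops_le right_cap cap T st : plat_loops right_cap cap T st <= (size T).+1.
Proof.
elim: T cap => [|[i [h s]] T IH] cap /=; first by case: eqP.
by do 2?case: ifP => _; rewrite ?ltnS //; apply: leq_trans (IH _) _.
Qed.

Lemma plat_loops_update right_cap cap T st i b : i \notin item_names T ->
  plat_loops right_cap cap T (update st i b) = plat_loops right_cap cap T st.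
Proof.
elim: T cap => [|[j [h s]] T IH] cap //=; rewrite inE negb_or => /andP[ij iT].
by rewrite update_off 1?eq_sym // !IH.
Qed.

Lemma count_update (T : eqType) (s : T -> bool) i b ns : i \notin ns ->
  count (update s i b) ns = count s ns.
Proof.
move=> i_ns; apply: eq_in_count => k kns; apply: update_off.
by apply: contraNneq i_ns => <-.
Qed.

Section Transfer.
Local Open Scope ring_scope.

Fixpoint transfer (right_cap cap : bool) (W : seq (bool * bool)) : {poly int} :=
  if W is (h, s) :: W' then
    'X^s * (if h == cap then loop_value * transfer right_cap cap W'
            else 'X * transfer right_cap h W')
    + 'X^(~~ s) * ('X * transfer right_cap cap W')
  else if cap == right_cap then loop_value else 'X.

Lemma transferE right_cap cap T : uniq (item_names T) ->
  \sum_(st <- assignments (item_names T)) 'X^(count st (item_names T)) *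
    ('X^((size T).+1 - plat_loops right_cap cap T st)
     * loop_value ^+ plat_loops right_cap cap T st)
  = transfer right_cap cap (map snd T).
Proof.
elim: T cap => [|[i [h s]] T IH] cap /=.
  by rewrite big_seq1 expr0 mul1r; case: eqP => _; rewrite /= ?subn1 ?expr0 ?mul1r ?mulr1.
case/andP=> iT uT; rewrite -!IH // sum_assignments_cons.
pose weight n l : {poly int} := 'X^(n - l) * loop_value ^+ l.
have weightS (c : bool) st : weight (size T).+2 (plat_loops right_cap c T st)
    = 'X * weight (size T).+1 (plat_loops right_cap c T st).
  by rewrite /weight subSn ?plat_loops_le // exprS mulrA.
have weightSS n l : weight n.+1 l.+1 = loop_value * weight n l.
  by rewrite /weight subSS exprS mulrCA.
have smoothingE b :
    \sum_(st <- assignments (item_names T)) 'X^(count (update st i b) (i :: item_names T)) *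
      weight (size T).+2 (plat_loops right_cap cap ((i, (h, s)) :: T) (update st i b))
    = 'X^b * (if b == s then
                if h == cap then loop_value * transfer right_cap cap (map snd T)
                else 'X * transfer right_cap h (map snd T)
              else 'X * transfer right_cap cap (map snd T)).
  rewrite -!IH // -!/(weight _ _) !mulr_sumr; case: ifP => Eb; [case: ifP => Eh |];
    rewrite ?mulr_sumr; apply: eq_bigr => st _;
    rewrite /= update_at Eb ?Eh !plat_loops_update // count_update // exprD -mulrA
      ?weightS ?weightSS;
    by congr (_ * _); rewrite mulrCA.
rewrite !smoothingE -!IH //; case: (s); rewrite /= expr0 expr1 !mul1r //.
by rewrite addrC.
Qed.

Lemma bracket_plat_code b T (p := start b) : uniq (item_names T) -> closable p T ->
  'X * bracket (plat_code p T) = transfer (joins_upper p T) true (map snd T).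
Proof.
move=> uT vT; have dp : distinct_legs p := distinct_legs_start b.
rewrite /bracket (@perm_code_bracket _ _ (item_names T)); last first.
  by apply: uniq_perm; rewrite ?undup_uniq // => k; rewrite mem_undup mem_names_plat_code.
rewrite -transferE // /code_bracket mulr_sumr; apply: eq_bigr => st _.
set N := nsat _ _; have N_le : (N <= 2 ^ size (item_names T))%N by apply: nsat_le.
have NE : N = (2 ^ plat_loops (joins_upper p T) true T st)%N.
  rewrite -cap_countE // /cap_count /plat_count /N !nsatE -big_split.
  apply: eq_bigr => x _; apply: loop_colouring_plat_code => //.
  exact: signs_agree_plat_code.
rewrite NE leq_exp2l // size_map in N_le *.
by rewrite /state_weight pfactorK // subSn // exprS mulrCA -!mulrA.
Qed.

End Transfer.

(** * The span of the bracket of an alternating plat *)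

Section AlternatingSpan.
Local Open Scope ring_scope.
Implicit Types P Q : {poly int}.

Definition coef_window P (lo hi : nat) : Prop := forall k, P`_k != 0 -> (lo <= k <= hi)%N.

Lemma coef_window0 P lo hi k : coef_window P lo hi -> ~~ (lo <= k <= hi)%N -> P`_k = 0.
Proof. by move=> w; case: (eqVneq P`_k 0) => // /w ->. Qed.

(* The transfer polynomials of an alternating plat for the two caps; the lowest
   coefficient of P and the highest one of Q survive each further crossing. *)
Definition spread P Q lo hi : Prop :=
  [/\ coef_window P lo hi, coef_window Q lo.+1 hi.+1, P`_lo != 0 & Q`_hi.+1 != 0].

Lemma coef_comb P Q k : ('X * P + 'X^2 * Q)`_k =
  (if (k < 1)%N then 0 else P`_(k - 1)) + (if (k < 2)%N then 0 else Q`_(k - 2)).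
Proof. by rewrite coefD -['X]expr1 !coefXnM. Qed.

Lemma spread_comb P Q lo hi : spread P Q lo hi ->
  [/\ coef_window ('X * P + 'X^2 * Q) lo.+1 hi.+3, ('X * P + 'X^2 * Q)`_lo.+1 != 0 &
      ('X * P + 'X^2 * Q)`_hi.+3 != 0].
Proof.
case=> wP wQ P0 Q0; split.
- move=> k; rewrite coef_comb; apply: contraR => hk.
  have -> : (if (k < 1)%N then 0 else P`_(k - 1)) = 0.
    by case: ltnP => // k1; apply: coef_window0 wP _; lia.
  have -> : (if (k < 2)%N then 0 else Q`_(k - 2)) = 0.
    by case: ltnP => // k1; apply: coef_window0 wQ _; lia.
  by rewrite addr0.
- rewrite coef_comb /= subn1 /= (coef_window0 (k := (lo.+1 - 2)%N) wQ) ?if_same ?addr0 //.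
  by lia.
- rewrite coef_comb /= (coef_window0 (k := (hi.+3 - 1)%N) wP) ?add0r; last by lia.
  by rewrite subSS subSS subn0.
Qed.

Lemma spread_low P Q lo hi : spread P Q lo hi ->
  spread ('X * P + 'X^2 * Q) (- 'X^3 * Q) lo.+1 hi.+3.
Proof.
move=> s; have [w l _] := spread_comb s; case: s => wP wQ P0 Q0; split=> //.
- by move=> k; rewrite mulNr coefN coefXnM oppr_eq0; case: ltnP => [|k3 /wQ];
    rewrite ?eqxx //; lia.
- by rewrite mulNr coefN coefXnM oppr_eq0 /= subSS subSS subSS subn0.
Qed.

Lemma spread_high P Q lo hi : spread P Q lo hi ->
  spread (- P) ('X * P + 'X^2 * Q) lo hi.+2.
Proof.
move=> s; have [w _ h] := spread_comb s; case: s => wP wQ P0 Q0; split=> //.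
- by move=> k; rewrite coefN oppr_eq0 => /wP; lia.
- by rewrite coefN oppr_eq0.
Qed.

Definition alternating_word (kap : bool) (hs : seq bool) : seq (bool * bool) :=
  [seq (h, h (+) kap) | h <- hs].

Lemma spread_transfer1 right_cap kap (W := alternating_word kap [:: ~~ right_cap]) :
  spread (transfer right_cap kap W) (transfer right_cap (~~ kap) W) 1 3.
Proof.
have -> : transfer right_cap kap W = - 'X^1.
  by rewrite {}/W; case: right_cap kap => [] []; rewrite /= /loop_value ?expr0 ?expr1; ring.
have -> : transfer right_cap (~~ kap) W = - 'X^4.
  by rewrite {}/W; case: right_cap kap => [] []; rewrite /= /loop_value ?expr0 ?expr1; ring.
have window_oppXn n : coef_window (- 'X^n) n n.
  move=> k; rewrite coefN coefXn oppr_eq0.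
  by have [->|_] := eqVneq k n; rewrite ?eqxx ?leqnn.
by split; rewrite ?coefN ?coefXn // => k /window_oppXn; lia.
Qed.

Lemma spread_transfer right_cap kap hs
    (W := alternating_word kap (rcons hs (~~ right_cap))) : exists lo,
  spread (transfer right_cap kap W) (transfer right_cap (~~ kap) W) lo (lo + 2 + 2 * size hs).
Proof.
rewrite {}/W; elim: hs => [|h hs [lo IH]]; first by exists 1; apply: spread_transfer1.
move: IH; rewrite /=; set P := transfer _ kap _; set Q := transfer _ (~~ kap) _ => IH.
have [Eh|Eh] := eqVneq h kap.
  exists lo; have -> : (lo + 2 + 2 * (size hs).+1)%N = (lo + 2 + 2 * size hs).+2 by lia.
  have := spread_high IH; congr (spread _ _ _ _).
    by rewrite Eh -/P addbb /= expr0 expr1 /loop_value; ring.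
  by rewrite Eh -/P -/Q addbb; case: (kap); rewrite /= expr0 expr1; ring.
have {}Eh : h = ~~ kap by case: h kap Eh {P Q IH} => [] [].
exists lo.+1; have -> : (lo.+1 + 2 + 2 * (size hs).+1)%N = (lo + 2 + 2 * size hs).+3 by lia.
have := spread_low IH; congr (spread _ _ _ _).
  by rewrite Eh -/P -/Q; case: (kap); rewrite /= expr0 expr1; ring.
by rewrite Eh -/P -/Q eqxx addNb addbb /= expr0 expr1 /loop_value; ring.
Qed.

Lemma bracket_alternating_plat b kap hs T (p := start b) :
    uniq (item_names T) -> closable p T ->
    map snd T = alternating_word kap (false :: rcons hs (~~ joins_upper p T)) ->
  exists k, ((bracket (plat_code p T))`_k != 0)
         /\ ((bracket (plat_code p T))`_(k + 2 * size T) != 0).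
Proof.
move=> uT vT ET; have := bracket_plat_code uT vT; rewrite -/p ET.
have sT : size T = (size hs).+2.
  by rewrite -(size_map snd) ET size_map /= size_rcons.
have [lo] := spread_transfer (joins_upper p T) kap hs.
set P := transfer _ kap _; set Q := transfer _ (~~ kap) _ => s.
set W := alternating_word _ _; have -> : transfer (joins_upper p T) true W = 'X * P + 'X^2 * Q.
  by rewrite /P /Q /W /=; case: (kap); rewrite /= expr0 expr1; ring.
have [_ l h] := spread_comb s => E; exists lo; rewrite sT.
have coefE k : (bracket (plat_code p T))`_k = ('X * P + 'X^2 * Q)`_k.+1 by rewrite -E coefXM.
by rewrite !coefE; split=> //; move: h; congr (_`_ _ != 0); lia.
Qed.

End AlternatingSpan.

(** * Plats are spherical *)

Lemma cycle_ordS (T : eqType) (e : rel T) (s : seq T) : cycle e s ->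
  forall j : 'I_(size s), e (tnth (in_tuple s) j) (tnth (in_tuple s) (ordS j)).
Proof.
case: s => [|a s] /= cyc j; first by case: j.
move/(pathP a): cyc => /(_ j); rewrite size_rcons => /(_ (ltn_ord j)).
rewrite !(tnth_nth a) /= -rcons_cons nth_rcons /= ltn_ord.
have [lt|ge] := ltnP j (size s).
  by rewrite nth_rcons lt modn_small // ltnS.
have -> : nat_of_ord j = size s by apply/eqP; rewrite eqn_leq ge -ltnS ltn_ord.
by rewrite nth_rcons ltnn eqxx modnn.
Qed.

Lemma ord_cyclic_ind n (P : 'I_n -> Prop) j0 :
  P j0 -> (forall j, P (ord_pred j) -> P j) -> forall j, P j.
Proof.
move=> P0 PS j.
have [k ->] : exists k, j = iter k (@ordS _) j0.
  exists (j + n - j0).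
  have val_iter k : val (iter k (@ordS _) j0) = (j0 + k) %% n.
    elim: k => [|k IH]; first by rewrite addn0 modn_small.
    by rewrite iterS /= IH -addn1 modnDml addn1 addnS.
  apply: val_inj; rewrite val_iter subnKC ?modnDr ?modn_small //.
  by rewrite (leq_trans (ltnW (ltn_ord j0))) // leq_addl.
by elim: k => //= k IH; apply: PS; rewrite ordSK.
Qed.

Definition left_turn (a : letter) : bool := over a == positive a.

Lemma left_turn_mate a : left_turn (mate a) = ~~ left_turn a.
Proof.
by case: a => [[i o] s]; rewrite /left_turn /mate /over /positive /=; case: o s => [] [].
Qed.

Section Faces.
Variable G : seq letter.
Hypothesis gG : gauss_code G.

Let letter_at := tnth (in_tuple G).

Lemma tnth_mate_pos (i : 'I_(size G)) : letter_at (mate_pos i) = mate (letter_at i).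
Proof.
rewrite /letter_at /mate_pos (tnth_nth (mate (letter_at i))) /insubd.
have mG : mate (letter_at i) \in G by apply: gauss_code_mate => //; apply: mem_tnth.
have lt : index (mate (letter_at i)) G < size G by rewrite index_mem.
by rewrite insubT /= nth_index.
Qed.

Lemma tnth_gauss_inj : injective letter_at.
Proof. by apply: (tuple_uniqP _ _); apply: map_uniq (gauss_code_uniq gG). Qed.

Lemma mate_posK : involutive (@mate_pos G).
Proof. by move=> i; apply: tnth_gauss_inj; rewrite !tnth_mate_pos mateK. Qed.

Lemma next_side_inj : injective (@next_side G).
Proof.
move=> [i d] [i' d']; rewrite /next_side /=; case=> /(can_inj mate_posK) E; rewrite E => Ed.
have dd' : d = d' by move: Ed; case: (_ == positive _); case: d d' {E} => [] [].
by subst d'; case: d E {Ed} => /= [/ordS_inj|/ord_pred_inj] ->.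
Qed.

Section Colouring.
Variable phi : 'I_(size G) * bool -> bool.
Hypothesis phi_next : forall x, phi (next_side x) = phi x.

Lemma colour_pred j : phi (ord_pred j, true) = phi (mate_pos j, left_turn (letter_at j)).
Proof. by rewrite -[LHS]phi_next /next_side /= ord_predK eqb_id. Qed.

Lemma colour_succ j : phi (ordS j, false) = phi (mate_pos j, ~~ left_turn (letter_at j)).
Proof. by rewrite -[LHS]phi_next /next_side /= ordSK eqbF_neg. Qed.

Definition edge_jump j : bool := phi (j, true) (+) phi (ordS j, false).
Definition corner_sum j : bool :=
  phi (j, true) (+) phi (j, false) (+) phi (mate_pos j, true) (+) phi (mate_pos j, false).

(* The jumps of a face colouring across the edges of a code are determined by
   one of them and one bit per crossing. *)
Lemma edge_jump_step j : edge_jump j = edge_jump (ord_pred j) (+) corner_sum j.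
Proof.
rewrite /edge_jump /corner_sum ord_predK colour_pred colour_succ.
by case: (left_turn _); case: (phi (j, true)) (phi (j, false)) (phi (mate_pos j, true))
  (phi (mate_pos j, false)) => [] [] [] [].
Qed.

Lemma face_colouring_rigid j0 : phi (j0, true) = false -> edge_jump j0 = false ->
  (forall j, over (letter_at j) -> corner_sum j = false) -> forall x, phi x = false.
Proof.
move=> phi0 jump0 corner_over.
have corner0 j : corner_sum j = false.
  case: (boolP (over (letter_at j))) => [/corner_over//|noj].
  rewrite -[RHS](corner_over (mate_pos j)); last by rewrite tnth_mate_pos.
  by rewrite /corner_sum mate_posK; move: (phi _) (phi _) (phi _) (phi _) => [] [] [] [].
have no_jump : forall j, edge_jump j = false.
  by apply: (ord_cyclic_ind (j0 := j0)) => // j IH; rewrite edge_jump_step IH corner0.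
have around j : [/\ phi (j, true) = phi (ord_pred j, true) & phi (j, false) = phi (j, true)].
  have := no_jump j; have := no_jump (ord_pred j).
  have := no_jump (mate_pos j); have := no_jump (ord_pred (mate_pos j)).
  rewrite /edge_jump !ord_predK !colour_pred !colour_succ.
  rewrite tnth_mate_pos left_turn_mate mate_posK.
  by case: (left_turn _); case: (phi (j, true)) (phi (j, false)) (phi (mate_pos j, true))
    (phi (mate_pos j, false)) => [] [] [] [].
have phi_true : forall j, phi (j, true) = false.
  by apply: (ord_cyclic_ind (j0 := j0)) => // j IH; have [-> _] := around j.
by case=> j [] //; have [_ ->] := around j.
Qed.

End Colouring.

Definition face_colouring (A : {set 'I_(size G) * bool}) x : bool :=
  froot (@next_side G) x \in A.

Lemma face_colouring_next A x : face_colouring A (next_side x) = face_colouring A x.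
Proof.
have fsym := fconnect_sym next_side_inj.
by rewrite /face_colouring; congr (_ \in A); apply/eqP; rewrite root_connect // fsym fconnect1.
Qed.

Definition colouring_data j0 (A : {set 'I_(size G) * bool}) :=
  (face_colouring A (j0, true), edge_jump (face_colouring A) j0,
   [set j | over (letter_at j) & corner_sum (face_colouring A) j]).

Lemma colouring_data_inj j0 :
  {in powerset [set x | x \in froots (@next_side G)] &, injective (colouring_data j0)}.
Proof.
move=> A B; rewrite !inE => sA sB [e1 e2 e3].
pose diff x := face_colouring A x (+) face_colouring B x.
have diff0 : forall x, diff x = false.
  have diff_next x : diff (next_side x) = diff x by rewrite /diff !face_colouring_next.
  apply: (face_colouring_rigid diff_next (j0 := j0)).
  - by rewrite /diff e1 addbb.
  - by move: e2; rewrite /edge_jump /diff; do 4!case: (face_colouring _ _).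
  - move=> j oj; move/setP/(_ j): e3; rewrite !inE oj /= /corner_sum /diff.
    by do 8!case: (face_colouring _ _).
have mem_roots (C : {set _}) x : C \subset [set x | x \in froots (@next_side G)] ->
    (x \in C) = (x \in froots (@next_side G)) && face_colouring C x.
  move=> /subsetP sC; rewrite /face_colouring; apply/idP/andP => [xC|[]].
    have := sC _ xC; rewrite inE => xR; split=> //.
    by move: xR; rewrite inE => /eqP ->.
  by rewrite inE => /eqP ->.
apply/setP => x; rewrite (mem_roots A) // (mem_roots B) //; congr (_ && _).
by have := diff0 x; rewrite /diff; do 2!case: (face_colouring _ _).
Qed.

(* Euler's inequality: the 2-colourings of the faces are determined by two bits
   and one bit per crossing. *)
Lemma faces_le : 0 < size G -> faces G <= crossings G + 2.
Proof.
move=> G0; pose j0 := Ordinal G0; pose O := [set j | over (letter_at j)].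
have sub : colouring_data j0 @: powerset [set x | x \in froots (@next_side G)]
    \subset setX setT (powerset O).
  apply/subsetP => _ /imsetP[A _ ->]; rewrite !inE /=; apply/subsetP => j.
  by rewrite !inE => /andP[].
have := subset_leq_card sub; rewrite card_in_imset; last exact: colouring_data_inj.
rewrite cardsX !card_powerset cardsT.
have -> : #|[set x | x \in froots (@next_side G)]| = faces G.
  by rewrite /faces cardsE; apply: eq_card => x; rewrite !inE andbT.
have -> : #|O| = crossings G.
  have GE : [seq letter_at j | j <- enum 'I_(size G)] = G := map_tnth_enum (in_tuple G).
  rewrite (crossings_over gG) -[X in count _ X]GE count_map.
  by rewrite cardsE cardE -size_filter enumT.
by rewrite card_prod card_bool -(expnD 2 2) leq_exp2l // addnC.
Qed.

End Faces.

Section Labels.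
Variable lab : letter -> bool -> nat.

Definition label_edge (a b : letter) : bool :=
  (lab a true == lab (mate b) (left_turn b)) && (lab b false == lab (mate a) (~~ left_turn a)).

Lemma faces_ge G vals : gauss_code G -> cycle label_edge G -> uniq vals ->
    {in vals, forall v, exists a d, a \in G /\ lab a d = v} ->
  size vals <= faces G.
Proof.
move=> gG /cycle_ordS edge uv hit; pose letter_at := tnth (in_tuple G).
pose lam (x : 'I_(size G) * bool) := lab (letter_at x.1) x.2.
have lam_next x : lam (next_side x) = lam x.
  case: x => j []; rewrite /lam /next_side /= /letter_at tnth_mate_pos // -/letter_at.
    by case/andP: (edge j) => /eqP -> _; rewrite /left_turn eqb_id.
  by have /andP[_ /eqP] := edge (ord_pred j); rewrite ord_predK => ->; rewrite eqbF_neg.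
have lam_connect : forall x y, fconnect (@next_side G) x y -> lam x = lam y.
  by apply: fconnect_invariant => x; rewrite /= lam_next eqxx.
have -> : faces G = #|froots (@next_side G)|.
  by rewrite /faces; apply: eq_card => x; rewrite !inE andbT.
rewrite -(size_image lam); apply: uniq_leq_size => // v /hit[a [d [aG <-]]].
have [j ->] : exists j, a = letter_at j by case/(tnthP (in_tuple G)): aG => j ->; exists j.
have fsym := fconnect_sym (next_side_inj gG).
apply/imageP; exists (froot (@next_side G) (j, d)); first exact: roots_root.
by rewrite -(lam_connect (j, d)) ?connect_root.
Qed.

(* l and l' are the labels on the left and on the right before and after the
   code G. *)
Fixpoint label_chain (l : nat * nat) (G : seq letter) (l' : nat * nat) : bool :=
  if G is b :: G' then
    [&& lab (mate b) (left_turn b) == l.1, lab b false == l.2 &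
      label_chain (lab b true, lab (mate b) (~~ left_turn b)) G' l']
  else l == l'.

Lemma label_chain_cat l1 l2 l3 G1 G2 :
  label_chain l1 G1 l2 -> label_chain l2 G2 l3 -> label_chain l1 (G1 ++ G2) l3.
Proof.
elim: G1 l1 => [|b G1 IH] l1 /=; first by move/eqP->.
by case/and3P=> -> -> /IH{}IH /IH ->.
Qed.

Lemma label_chain_cycle l G : label_chain l G l -> cycle label_edge G.
Proof.
case: G => // a G /= /and3P[/eqP a1 /eqP a2].
have path_from b : label_chain (lab b true, lab (mate b) (~~ left_turn b)) G l ->
    path label_edge b (rcons G a).
  elim: G b => [|b' G IH] b /=.
    by move/eqP=> lE; rewrite /label_edge a1 a2 -lE !eqxx.
  by case/and3P=> /eqP e1 /eqP e2 /IH ->; rewrite /label_edge e1 e2 !eqxx.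
exact: path_from.
Qed.

End Labels.

Definition regions : Type := (nat * nat * nat * nat)%type.
Definition region (r : regions) (k : nat) : nat :=
  match k with 0 => r.1.1.1 | 1 => r.1.1.2 | 2 => r.1.2 | _ => r.2 end.
Definition new_region (h : bool) (i : nat) (r : regions) : regions :=
  if h then (r.1.1, i.+3, r.2) else (r.1.1.1, i.+3, r.1.2, r.2).

(* The region on the left of the half-edge that leaves the crossing i on the
   passage o in direction d: right-up sees the region above the crossing,
   left-down the one below, right-down the new one, named i + 3, to its right,
   and left-up the one to its left.  Regions 0, 1, 2 are there at the start. *)
Definition quadrant (h s : bool) (p : state) (r : regions) (i : nat) (o d : bool) : nat :=
  let is_rising := o == s in
  let right := ((if is_rising then rising h p else falling h p) != back_leg) == d in
  if is_rising then (if right then region r h.+2 else region r h)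
  else (if right then i.+3 else region r h.+1).

Definition final_regions (T : seq item) (r : regions) : regions :=
  foldl (fun r t => new_region t.2.1 t.1 r) r T.

Section PlatLabels.
Variable relabel : nat -> nat.

Fixpoint labels_ok (lab : letter -> bool -> nat) (T : seq item) p r : Prop :=
  if T is (i, (h, s)) :: T' then
    (forall o d, lab (i, o, item_sign h s p) d = relabel (quadrant h s p r i o d)) /\
    labels_ok lab T' (swap_legs h p) (new_region h i r)
  else True.

Fixpoint plat_label (T : seq item) p r (a : letter) (d : bool) : nat :=
  if T is (i, (h, s)) :: T' then
    if name a == i then relabel (quadrant h s p r i (over a) d)
    else plat_label T' (swap_legs h p) (new_region h i r) a d
  else 0.

Lemma eq_labels_ok lab lab' T p r :
    (forall a d, name a \in item_names T -> lab a d = lab' a d) ->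
  labels_ok lab' T p r -> labels_ok lab T p r.
Proof.
elim: T p r => //= [[i [h s]]] T IH p r eq_lab [ok_i ok_T]; split.
  by move=> o d; rewrite eq_lab ?mem_head.
by apply: IH ok_T => a d aT; apply: eq_lab; rewrite inE aT orbT.
Qed.

Lemma labels_ok_plat_label T p r : uniq (item_names T) -> labels_ok (plat_label T p r) T p r.
Proof.
elim: T p r => //= [[i [h s]]] T IH p r /andP[iT uT]; split.
  by move=> o d; rewrite /name /= eqxx.
apply: eq_labels_ok (IH _ _ uT) => a d aT.
by rewrite /=; case: eqP => // ai; rewrite -ai aT in iT.
Qed.

Definition position (x : leg) (p : state) : nat :=
  if x == p.1.1 then 0 else if x == p.1.2 then 1 else 2.
Definition above x p r : nat := relabel (region r (position x p).+1).
Definition below x p r : nat := relabel (region r (position x p)).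

Lemma label_chain_item lab x i h s p r (p' := swap_legs h p) (r' := new_region h i r) :
    distinct_legs p -> labels_ok lab [:: (i, (h, s))] p r ->
  if x == back_leg then
    label_chain lab (below x p' r', above x p' r') (rev (item_letters x p (i, (h, s))))
      (below x p r, above x p r)
  else
    label_chain lab (above x p r, below x p r) (item_letters x p (i, (h, s)))
      (above x p' r', below x p' r').
Proof.
move=> dp [lab_i _]; rewrite {}/p' {}/r' /item_letters /above /below.
case: p r dp lab_i => [[u v] w] [[[r0 r1] r2] r3].
case: x => [[]|]; case: h u v w => [] [[]|] [[]|] [[]|] //= _ lab_i; rewrite ?eqxx //;
  rewrite /mate /name /over /positive /left_turn /= !lab_i /item_sign /quadrant /over /positive /=;
  by case: (s); rewrite /= !eqxx.
Qed.

Lemma label_chain_strand lab x T p r (p' := final_state p T) (r' := final_regions T r) :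
    distinct_legs p -> labels_ok lab T p r ->
  if x == back_leg then
    label_chain lab (below x p' r', above x p' r') (rev (strand x p T)) (below x p r, above x p r)
  else
    label_chain lab (above x p r, below x p r) (strand x p T) (above x p' r', below x p' r').
Proof.
rewrite {}/p' {}/r'; elim: T p r => [|[i [h s]] T IH] p r dp; first by case: ifP => _ /=.
move=> [ok_i ok_T].
have := IH _ _ (etrans (distinct_legs_swap h p) dp) ok_T.
have := label_chain_item x dp (conj ok_i I : labels_ok lab [:: (i, (h, s))] p r).
rewrite -[strand x p _]/(_ ++ _) -[final_state p (_ :: _)]/(final_state (swap_legs h p) T).
rewrite -[final_regions (_ :: _) r]/(final_regions T (new_region h i r)).
case: ifP => _ chain_i chain_T; last exact: label_chain_cat chain_i chain_T.
by rewrite rev_cat; apply: label_chain_cat chain_T chain_i.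
Qed.

Lemma quadrant_label lab i h s T p r v : labels_ok lab ((i, (h, s)) :: T) p r ->
    v \in [:: region r h; region r h.+1; region r h.+2; i.+3] ->
  exists a d, a \in item_pairs p ((i, (h, s)) :: T) /\ lab a d = relabel v.
Proof.
move=> [lab_i _]; rewrite !inE => v4.
have nss : (~~ s == s) = false by case: (s).
pose right_rising := rising h p != back_leg; pose right_falling := falling h p != back_leg.
case/or4P: v4 => /eqP ->.
- exists (i, s, item_sign h s p), (~~ right_rising).
  by rewrite mem_head lab_i /quadrant eqxx -/right_rising; case: right_rising.
- exists (i, ~~ s, item_sign h s p), (~~ right_falling).
  by rewrite !inE eqxx orbT lab_i /quadrant nss -/right_falling; case: right_falling.
- exists (i, s, item_sign h s p), right_rising.
  by rewrite mem_head lab_i /quadrant eqxx -/right_rising; case: right_rising.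
- exists (i, ~~ s, item_sign h s p), right_falling.
  by rewrite !inE eqxx orbT lab_i /quadrant nss -/right_falling; case: right_falling.
Qed.

Lemma new_region_label lab T p r i : labels_ok lab T p r -> i \in item_names T ->
  exists a d, a \in item_pairs p T /\ lab a d = relabel i.+3.
Proof.
elim: T p r => //= [[j [h s]]] T IH p r ok; rewrite inE => /predU1P[->|iT].
  by apply: quadrant_label ok _; rewrite !inE eqxx !orbT.
have [a [d [aT E]]] := IH _ _ ok.2 iT.
by exists a, d; rewrite !inE aT !orbT.
Qed.

Lemma bottom_region_label lab T p r : labels_ok lab T p r -> has (fun t => ~~ t.2.1) T ->
  exists a d, a \in item_pairs p T /\ lab a d = relabel (region r 0).
Proof.
elim: T p r => //= [[j [h s]]] T IH p r ok /=; case: h ok => [] ok /=.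
  move/(IH _ _ ok.2) => [a [d [aT E]]].
  by exists a, d; rewrite !inE aT !orbT.
by move=> _; apply: quadrant_label ok _; rewrite !inE eqxx.
Qed.

End PlatLabels.

Lemma final_regions_outer T r :
  region (final_regions T r) 0 = region r 0 /\ region (final_regions T r) 3 = region r 3.
Proof.
elim: T r => //= [[i [h s]]] T IH r; have [-> ->] := IH (new_region h i r).
by case: r => [[[? ?] ?] ?]; case: h.
Qed.

Lemma mem_final_regions T r k : region (final_regions T r) k \in
  [:: region r 0; region r 1; region r 2; region r 3] ++ [seq i.+3 | i <- item_names T].
Proof.
elim: T r => [|[i [h s]] T IH] r.
  by rewrite cats0 !inE; case: k => [|[|[|k]]]; rewrite eqxx ?orbT.
have := IH (new_region h i r); rewrite !mem_cat !inE.
by case: r => [[[a b] c] d]; case: (h) => /=; case/orP=> [/or4P[]|] ->; rewrite ?orbT.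
Qed.

Lemma all_upper_final T p r : T != [::] -> ~~ has (fun t => ~~ t.2.1) T ->
  (final_state p T).1.1 = p.1.1
  /\ exists2 i, i \in item_names T & region (final_regions T r) 2 = i.+3.
Proof.
elim/last_ind: T => // T [i [h s]] IH _; rewrite has_rcons negb_or negbK /= => /andP[hT nT].
rewrite /final_state /final_regions !foldl_rcons /= hT; split.
  by case: (T =P [::]) => [->//|/eqP/IH/(_ nT)[]].
by exists i => //; rewrite /item_names map_rcons mem_rcons mem_head.
Qed.

(* The last region between the last leg and its neighbour is the outer one. *)
Definition merge_outer (upper : bool) (last_region k : nat) : nat :=
  if k == last_region then (if upper then 1 else 0) else k.

Lemma merge_outer_last upper k :
  merge_outer upper k k = merge_outer upper k (if upper then 1 else 0).
Proof. by rewrite /merge_outer eqxx if_same. Qed.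

Lemma right_junction (q : state) (r : regions) : distinct_legs q -> q.1.2 != last_leg ->
    region r 0 = 0 -> region r 3 = 1 ->
  let upper := q.1.1 == last_leg in
  let mu := merge_outer upper (region r (if upper then 1 else 2)) in
  [/\ above mu first_leg q r = below mu back_leg q r,
      below mu first_leg q r = above mu back_leg q r,
      above mu last_leg q r = mu 1 & below mu last_leg q r = mu 0].
Proof.
case: q r => [[u v] w] [[[r0 r1] r2] r3] dq vq /= -> ->.
move: dq vq; rewrite /above /below; case: u v w => [[]|] [[]|] [[]|] //= _ _;
  have m1 := merge_outer_last true r1; have m2 := merge_outer_last false r2;
  by rewrite /= in m1 m2; rewrite ?m1 ?m2.
Qed.

Section PlatSphere.
Variables (b : bool) (T : seq item).
Hypotheses (uT : uniq (item_names T)) (vT : closable (start b) T).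

Let p := start b.
Let upper := joins_upper p T.

Definition start_regions : regions := (0, 1, 2, 1).
Definition last_region : nat :=
  region (final_regions T start_regions) (if upper then 1 else 2).
Definition sphere_label : letter -> bool -> nat :=
  plat_label (merge_outer upper last_region) T p start_regions.
Definition plat_regions : seq nat := [:: 0; 1; 2] ++ [seq i.+3 | i <- item_names T].

Let distinct_p : distinct_legs p := distinct_legs_start b.
Let labels_plat : labels_ok (merge_outer upper last_region) sphere_label T p start_regions :=
  labels_ok_plat_label _ _ _ uT.

Lemma cycle_sphere_label : cycle (label_edge sphere_label) (plat_code p T).
Proof.
pose mu := merge_outer upper last_region.
apply: (@label_chain_cycle _ (mu 1, mu 0)).
have chain_first := label_chain_strand first_leg distinct_p labels_plat.
have chain_back := label_chain_strand back_leg distinct_p labels_plat.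
have chain_last := label_chain_strand last_leg distinct_p labels_plat.
rewrite /= in chain_first chain_back chain_last.
have dq : distinct_legs (final_state p T) by rewrite distinct_legs_final.
have [outer0 outer3] := final_regions_outer T start_regions.
have [j1 j2 j3 j4] := right_junction dq vT outer0 outer3.
rewrite -/(joins_upper p T) -/upper -/last_region -/mu in j1 j2 j3 j4.
rewrite j1 j2 in chain_first; rewrite j3 j4 in chain_last.
have start_first : (above mu first_leg p start_regions, below mu first_leg p start_regions)
    = (mu 1, mu 0) by rewrite /p; case: (b).
have start_last : (above mu last_leg p start_regions, below mu last_leg p start_regions)
    = (below mu back_leg p start_regions, above mu back_leg p start_regions).
  by rewrite /p; case: (b).
rewrite start_first in chain_first; rewrite start_last in chain_last.
by apply: label_chain_cat chain_first _; apply: label_chain_cat chain_back chain_last.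
Qed.

Lemma uniq_plat_regions : uniq plat_regions.
Proof.
rewrite /plat_regions cat_uniq map_inj_uniq ?uT; last by move=> i j [].
by rewrite andbT /=; apply/hasPn => _ /mapP[i _ ->]; rewrite !inE.
Qed.

Lemma last_region_in : last_region \in plat_regions.
Proof.
have := mem_final_regions T start_regions (if upper then 1 else 2).
by rewrite -/last_region !mem_cat !inE /=; case/orP=> [/or4P[]|] ->; rewrite ?orbT.
Qed.

Lemma sphere_label_onto : T != [::] -> {in rem last_region plat_regions, forall v,
  exists a d, a \in plat_code p T /\ sphere_label a d = v}.
Proof.
move=> T0 v; rewrite mem_rem_uniq ?uniq_plat_regions // inE => /andP[v_last v_in].
pose mu := merge_outer upper last_region.
have mu_v : mu v = v by rewrite /mu /merge_outer (negbTE v_last).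
suff [a [d [aT E]]] : exists a d, a \in item_pairs p T /\ sphere_label a d = mu v.
  by exists a, d; rewrite (perm_mem (perm_plat_code T distinct_p)) aT E mu_v.
move: v_in; rewrite mem_cat => /orP[v3|/mapP[i iT ->]]; last exact: new_region_label labels_plat iT.
have [v0|v0] := eqVneq v 0; last first.
  move: labels_plat; case: (T) T0 => // -[i [h s]] T' _ labels_T; apply: quadrant_label labels_T _.
  by move: v3 v0; rewrite !inE; case: (h) => /or3P[] /eqP ->.
rewrite v0; case: (boolP (has (fun t => ~~ t.2.1) T)) => hT.
  exact: bottom_region_label labels_plat hT.
have [final_p [i iT region_i]] := all_upper_final p start_regions T0 hT.
have not_upper : upper = false by rewrite /upper /joins_upper final_p /p; case: (b).
have [a [d [aT E]]] := new_region_label labels_plat iT; exists a, d; split=> //.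
by rewrite E /mu /merge_outer /last_region not_upper region_i eqxx.
Qed.

Lemma diagram_plat_code_rot m : diagram (rot m (plat_code p T)).
Proof.
set G := rot m _; have gG : gauss_code G.
  by rewrite (perm_gauss_code (permEl (perm_rot _ _))); apply: gauss_code_plat.
rewrite /diagram gG /=; case: (eqVneq T [::]) => [T0|T0]; first by rewrite /G T0.
have sizeG : size G = (size T).*2.
  by rewrite size_rot (perm_size (perm_plat_code T distinct_p)) size_item_pairs.
have crossingsG : crossings G = size T by rewrite /crossings sizeG doubleK.
have upper_bound : faces G <= size T + 2.
  by rewrite -crossingsG faces_le // sizeG double_gt0 lt0n size_eq0.
have lower_bound : size T + 2 <= faces G.
  have -> : size T + 2 = size (rem last_region plat_regions).
    by rewrite size_rem ?last_region_in // /plat_regions size_cat !size_map addnC.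
  apply: (faces_ge (lab := sphere_label)) => //.
  - by rewrite rot_cycle cycle_sphere_label.
  - by rewrite rem_uniq // uniq_plat_regions.
  - by move=> v /(sphere_label_onto T0)[a [d [aG <-]]]; exists a, d; rewrite mem_rot.
rewrite /spherical; apply/orP; right.
by rewrite crossingsG sizeG -addnn -addnA eqn_add2l eqn_leq upper_bound.
Qed.

Lemma diagram_plat_code : diagram (plat_code p T).
Proof. by rewrite -(rot0 (plat_code p T)); apply: diagram_plat_code_rot. Qed.

End PlatSphere.

(** * Reidemeister moves of plats *)

Lemma same_knot_refl G : same_knot G G.
Proof. exact: rst_refl. Qed.

Lemma same_knot_sym G H : same_knot G H -> same_knot H G.
Proof. exact: rst_sym. Qed.

Lemma same_knot_trans H G K : same_knot G H -> same_knot H K -> same_knot G K.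
Proof. exact: rst_trans. Qed.

Definition cyclic_move (G H : seq letter) : Prop := exists G1 G2 H1 H2,
  [/\ G = G1 ++ G2, H = H1 ++ H2 & move (G2 ++ G1) (H2 ++ H1)].

Lemma same_knot_rot b T G1 G2 : uniq (item_names T) -> closable (start b) T ->
  plat_code (start b) T = G1 ++ G2 ->
  diagram (G2 ++ G1) /\ same_knot (plat_code (start b) T) (G2 ++ G1).
Proof.
move=> uT vT E; have dG : diagram (G2 ++ G1).
  by have := diagram_plat_code_rot uT vT (size G1); rewrite E rot_size_cat.
split=> //; apply: rst_step; split=> //; first exact: diagram_plat_code.
by rewrite E -(rot_size_cat G1 G2); apply: MoveBasePoint.
Qed.

Lemma same_knot_cyclic_move b b' T T' : uniq (item_names T) -> closable (start b) T ->
    uniq (item_names T') -> closable (start b') T' ->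
    cyclic_move (plat_code (start b) T) (plat_code (start b') T') ->
  same_knot (plat_code (start b) T) (plat_code (start b') T').
Proof.
move=> uT vT uT' vT' [G1 [G2 [H1 [H2 [EG EH mv]]]]].
have [dG kG] := same_knot_rot uT vT EG; have [dH kH] := same_knot_rot uT' vT' EH.
apply: same_knot_trans kG _; apply: same_knot_trans (same_knot_sym kH).
exact: rst_step.
Qed.

Lemma cyclic_move_R1 i o s P A :
  cyclic_move (P ++ [:: (i, o, s); (i, ~~ o, s)] ++ A) (P ++ A).
Proof.
exists P, ([:: (i, o, s); (i, ~~ o, s)] ++ A), P, A; split=> //; rewrite -catA.
exact: MoveR1.
Qed.

Definition slot_move (X Y Z X' Y' Z' : seq letter) : Prop := forall A B C : seq letter,
  move (X ++ A ++ Y ++ B ++ Z ++ C) (X' ++ A ++ Y' ++ B ++ Z' ++ C).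

Lemma cyclic_move_slots X Y Z X' Y' Z' P A B C :
    [\/ slot_move X Y Z X' Y' Z', slot_move Y Z X Y' Z' X' | slot_move Z X Y Z' X' Y'] ->
  cyclic_move (P ++ X ++ A ++ Y ++ B ++ Z ++ C) (P ++ X' ++ A ++ Y' ++ B ++ Z' ++ C).
Proof.
case=> mv.
- exists P; eexists; exists P; eexists; split; [reflexivity | reflexivity |].
  by rewrite -!catA; apply: mv.
- exists (P ++ X ++ A), (Y ++ B ++ Z ++ C), (P ++ X' ++ A), (Y' ++ B ++ Z' ++ C).
  by rewrite -!catA; split=> //; have := mv B (C ++ P) A; rewrite -!catA.
- exists (P ++ X ++ A ++ Y ++ B), (Z ++ C), (P ++ X' ++ A ++ Y' ++ B), (Z' ++ C).
  by rewrite -!catA; split=> //; have := mv (C ++ P) A B; rewrite -!catA.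
Qed.

Lemma slot_move_R2 i j s d : let O := [:: (i, true, s); (j, true, ~~ s)] in
  let N := ordered_pair d (i, false, s) (j, false, ~~ s) in
  slot_move O N [::] [::] [::] [::] /\ slot_move O [::] N [::] [::] [::].
Proof.
split=> A B C; first exact: (MoveR2 i j s d A (B ++ C)).
by have := MoveR2 i j s d (A ++ B) C; rewrite -!catA.
Qed.

Lemma plat_code_slots b P M T (p := final_state (start b) P) (q := final_state p M) :
  plat_code (start b) (P ++ M ++ T) =
  strand first_leg (start b) P ++ strand first_leg p M ++
  (strand first_leg q T ++ rev (strand back_leg q T)) ++ rev (strand back_leg p M) ++
  (rev (strand back_leg (start b) P) ++ strand last_leg (start b) P) ++
  strand last_leg p M ++ strand last_leg q T.
Proof. by rewrite /plat_code !strand_cat !rev_cat !catA. Qed.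

Lemma distinct_legs_reached b P : distinct_legs (final_state (start b) P).
Proof. by rewrite distinct_legs_final distinct_legs_start. Qed.

Ltac in_some_rotation tac :=
  first [constructor 1; tac | constructor 2; tac | constructor 3; tac].

Lemma cyclic_move_plat_R3 b P T n1 n2 n3 s :
  cyclic_move
    (plat_code (start b) (P ++ [:: (n1, (false, s)); (n2, (true, s)); (n3, (false, s))] ++ T))
    (plat_code (start b) (P ++ [:: (n3, (true, s)); (n2, (false, s)); (n1, (true, s))] ++ T)).
Proof.
rewrite !plat_code_slots; have := distinct_legs_reached b P; set p := final_state _ P => dp.
rewrite -[final_state p [:: (n3, _); _; _]]/(final_state p
  [:: (n1, (false, s)); (n2, (true, s)); (n3, (false, s))]).
apply: cyclic_move_slots; move: dp; case: p => [[u v] w] dp.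
pose forward x := x != back_leg.
pose sign_ok := item_sign false true (u, v, w) == forward w.
pose rev_sign_ok := item_sign true false (u, v, w) == ~~ forward u.
have R3 := fun A B C => @MoveR3 n1 n2 n3 (forward u) (forward v) (forward w) sign_ok A B C.
have R3' := fun A B C => @MoveR3' n1 n2 n3 (forward u) (forward v) (forward w) sign_ok A B C.
have rev_R3 := fun A B C =>
  @MoveR3 n3 n2 n1 (~~ forward w) (~~ forward v) (~~ forward u) rev_sign_ok A B C.
have rev_R3' := fun A B C =>
  @MoveR3' n3 n2 n1 (~~ forward w) (~~ forward v) (~~ forward u) rev_sign_ok A B C.
move: dp R3 R3' rev_R3 rev_R3'.
case: u v w @sign_ok @rev_sign_ok => [[]|] [[]|] [[]|] // sign_ok rev_sign_ok _;
  case: s => R3 R3' rev_R3 rev_R3'; rewrite /slot_move /=;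
  in_some_rotation ltac:(first [exact: R3 | exact: R3' | exact: rev_R3 | exact: rev_R3']).
Qed.

Lemma cyclic_move_plat_R2 b P T n1 n2 h s :
  cyclic_move (plat_code (start b) (P ++ [:: (n1, (h, s)); (n2, (h, ~~ s))] ++ T))
              (plat_code (start b) (P ++ T)).
Proof.
rewrite -[P ++ T]/(P ++ [::] ++ T) !plat_code_slots.
have := distinct_legs_reached b P; set p := final_state _ P => dp.
have -> : final_state p [:: (n1, (h, s)); (n2, (h, ~~ s))] = p.
  by case: (p) => [[? ?] ?]; case: (h).
apply: cyclic_move_slots; rewrite /final_state /=.
pose over_back := (if s then rising h p else falling h p) == back_leg.
pose under_back := (if s then falling h p else rising h p) == back_leg.
have [R2 R2'] := slot_move_R2 (if over_back then n2 else n1) (if over_back then n1 else n2)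
  (over_back (+) item_sign h s p) (over_back == under_back).
move: R2 R2'; rewrite {}/over_back {}/under_back; move: dp; case: (p) => [[u v] w].
by case: h; case: s; case: u v w => [[]|] [[]|] [[]|] //= _ R2 R2';
  in_some_rotation ltac:(first [exact: R2 | exact: R2']).
Qed.

Definition outer_leg (upper : bool) (p : state) : leg := if upper then p.2 else p.1.1.

Lemma cyclic_move_right_R1 b P i h s : outer_leg (~~ h) (final_state (start b) P) = last_leg ->
  cyclic_move (plat_code (start b) (P ++ [:: (i, (h, s))])) (plat_code (start b) P).
Proof.
have := distinct_legs_reached b P; set p := final_state _ P => dp last_p.
have := @cyclic_move_R1 i (if rising h p == first_leg then s else ~~ s) (item_sign h s p)
  (strand first_leg (start b) P) (rev (strand back_leg (start b) P) ++ strand last_leg (start b) P).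
rewrite /plat_code !strand_cat rev_cat -/p; congr (cyclic_move _ _); rewrite -!catA; congr cat.
move: dp last_p; case: (p) => [[u v] w].
by case: h; case: u v w => [[]|] [[]|] [[]|] //= _ _; rewrite ?negbK ?cats0.
Qed.

Lemma cyclic_move_left_R1 b T i s :
  cyclic_move (plat_code (start b) ((i, (true, s)) :: T)) (plat_code (start (~~ b)) T).
Proof.
rewrite /plat_code; set q := start (~~ b).
have swap_start : swap_legs true (start b) = q by rewrite /q; case: (b).
have := @cyclic_move_R1 i (if b then s else ~~ s) (item_sign true s (start b))
   (strand first_leg q T ++ rev (strand back_leg q T)) (strand last_leg q T).
congr (cyclic_move _ _); last by rewrite -catA.
rewrite -[(i, (true, s)) :: T]cat1s !strand_cat rev_cat.
rewrite -[final_state (start b) _]/(swap_legs true (start b)) swap_start -!catA.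
by case: (b); rewrite /= ?negbK.
Qed.

Lemma cyclic_move_right_R2 b P i j h s : outer_leg h (final_state (start b) P) = last_leg ->
  cyclic_move (plat_code (start b) (P ++ [:: (i, (h, s)); (j, (~~ h, s))])) (plat_code (start b) P).
Proof.
have := distinct_legs_reached b P; set p := final_state _ P => dp last_p.
pose M := [:: (i, (h, s)); (j, (~~ h, s))].
have -> : plat_code (start b) P = strand first_leg (start b) P ++ [::] ++ [::] ++ [::] ++
    (rev (strand back_leg (start b) P) ++ strand last_leg (start b) P) ++ [::] ++ [::].
  by rewrite /plat_code !cats0.
have -> : plat_code (start b) (P ++ M) = strand first_leg (start b) P ++
    (strand first_leg p M ++ rev (strand back_leg p M)) ++ [::] ++ [::] ++
    (rev (strand back_leg (start b) P) ++ strand last_leg (start b) P)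
      ++ strand last_leg p M ++ [::].
  by rewrite /plat_code !strand_cat rev_cat !cats0 -!catA.
apply: cyclic_move_slots; pose last_under := s == h; pose first_middle := p.1.2 == first_leg.
pose swap := last_under && ~~ first_middle.
have [R2 R2'] := slot_move_R2 (if swap then j else i) (if swap then i else j)
  (swap (+) item_sign h s p) first_middle.
move: R2 R2'; rewrite {}/swap {}/last_under {}/first_middle {}/M.
move: dp last_p; case: (p) => [[u v] w].
by case: h; case: s; case: u v w => [[]|] [[]|] [[]|] //= _ _ R2 R2';
  in_some_rotation ltac:(first [exact: R2 | exact: R2']).
Qed.

Definition word : Type := seq (bool * bool).
Definition legs_after (p : state) (W : word) : state := foldl (fun q t => swap_legs t.1 q) p W.
Definition word_closable b W : bool := (legs_after (start b) W).1.2 != last_leg.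
Definition numbered k (W : word) : seq item := zip (iota k (size W)) W.
Definition plat b W : seq letter := plat_code (start b) (numbered 0 W).

Lemma final_legs_after p T : final_state p T = legs_after p (map snd T).
Proof. by elim: T p => //= t T IH p; rewrite IH. Qed.

Lemma legs_after_cat p W1 W2 : legs_after p (W1 ++ W2) = legs_after (legs_after p W1) W2.
Proof. by rewrite /legs_after foldl_cat. Qed.

Lemma closable_word b T : closable (start b) T = word_closable b (map snd T).
Proof. by rewrite /closable final_legs_after. Qed.

Lemma map_snd_numbered k W : map snd (numbered k W) = W.
Proof. by rewrite /numbered -/unzip2 unzip2_zip // size_iota. Qed.

Lemma item_names_numbered k W : item_names (numbered k W) = iota k (size W).
Proof. by rewrite /item_names /numbered -/unzip1 unzip1_zip // size_iota. Qed.

Lemma distinct_legs_after b W : distinct_legs (legs_after (start b) W).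
Proof. by rewrite -(map_snd_numbered 0 W) -final_legs_after distinct_legs_reached. Qed.

Lemma strand_rename f r p T :
  strand r p [seq (f t.1, t.2) | t <- T] = map (rename f) (strand r p T).
Proof.
elim: T p => //= [[i [h s]]] T IH p; rewrite /= IH map_cat; congr (_ ++ _).
by do 2?case: ifP.
Qed.

Lemma plat_code_rename f p T :
  plat_code p [seq (f t.1, t.2) | t <- T] = map (rename f) (plat_code p T).
Proof. by rewrite /plat_code !strand_rename !map_cat map_rev. Qed.

Lemma same_knot_plat b T : uniq (item_names T) -> closable (start b) T ->
  same_knot (plat_code (start b) T) (plat b (map snd T)).
Proof.
move=> uT vT; set W := map snd T.
have uW : uniq (item_names (numbered 0 W)) by rewrite item_names_numbered iota_uniq.
have sz : size (item_names T) = size (item_names (numbered 0 W)).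
  by rewrite item_names_numbered size_iota !size_map.
have [f injf Ef] := injective_extension uT uW sz.
have E : plat b W = map (rename f) (plat_code (start b) T).
  rewrite -plat_code_rename /plat; congr plat_code; rewrite /numbered size_map.
  have: map f (item_names T) = iota 0 (size T) by rewrite Ef item_names_numbered size_map.
  by rewrite /W; move: (iota _ _) => l; elim: (T) l => [|[i hs] T' IH] [|x l] //= [-> /IH ->].
rewrite E; apply: rst_step; split; [exact: diagram_plat_code | | exact: MoveRename].
by rewrite -E; apply: diagram_plat_code; rewrite // closable_word map_snd_numbered -closable_word.
Qed.

Lemma plat_cyclic_move b b' P M M' T :
    uniq (item_names M) && all (ltn^~ 3) (item_names M) ->
    uniq (item_names M') && all (ltn^~ 3) (item_names M') ->
    word_closable b (P ++ map snd M ++ T) -> word_closable b' (P ++ map snd M' ++ T) ->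
    (forall P' T', map snd P' = P -> map snd T' = T ->
       cyclic_move (plat_code (start b) (P' ++ M ++ T')) (plat_code (start b') (P' ++ M' ++ T'))) ->
  same_knot (plat b (P ++ map snd M ++ T)) (plat b' (P ++ map snd M' ++ T)).
Proof.
move=> uM uM' vM vM' mv; pose extend K := numbered 3 P ++ K ++ numbered (3 + size P) T.
have map_extend K : map snd (extend K) = P ++ map snd K ++ T.
  by rewrite !map_cat !map_snd_numbered.
have uniq_extend K : uniq (item_names K) && all (ltn^~ 3) (item_names K) ->
    uniq (item_names (extend K)).
  case/andP=> uK /allP K3; rewrite /item_names !map_cat -!/(item_names _) !item_names_numbered.
  rewrite uniq_catCA -iotaD cat_uniq uK iota_uniq andbT; apply/hasPn => k.
  by rewrite mem_iota => /andP[k3 _]; apply: contraL k3 => /K3 /=; rewrite -ltnNge.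
have closeE c K : closable (start c) (extend K) = word_closable c (P ++ map snd K ++ T).
  by rewrite closable_word map_extend.
rewrite -!map_extend.
apply: same_knot_trans (same_knot_sym (same_knot_plat _ _)) _;
  rewrite ?uniq_extend ?closeE //.
apply: same_knot_trans (same_knot_plat _ _); rewrite ?uniq_extend ?closeE //.
apply: same_knot_cyclic_move; rewrite ?uniq_extend ?closeE //.
by apply: mv; apply: map_snd_numbered.
Qed.

Lemma legs_after_R2 p h s s' : legs_after p [:: (h, s); (h, s')] = p.
Proof. by case: p => [[? ?] ?]; case: h. Qed.

Lemma plat_R2 b P T h s : word_closable b (P ++ T) ->
  same_knot (plat b (P ++ [:: (h, s); (h, ~~ s)] ++ T)) (plat b (P ++ T)).
Proof.
move=> vW; apply: (plat_cyclic_move (M := [:: (0, (h, s)); (1, (h, ~~ s))]) (M' := [::])) => //.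
  by move: vW; rewrite /word_closable !legs_after_cat legs_after_R2.
by move=> P' T' _ _; apply: cyclic_move_plat_R2.
Qed.

(* The half twist of the three strands: the two ways of drawing it are related by a
   third Reidemeister move. *)
Definition half_twist (h s : bool) : word := [:: (h, s); (~~ h, s); (h, s)].

Definition reverse_legs (p : state) : state := (p.2, p.1.2, p.1.1).

Lemma legs_after_half_twist p h s : legs_after p (half_twist h s) = reverse_legs p.
Proof. by case: p => [[? ?] ?]; case: h. Qed.

Lemma plat_half_twist b P T h h' s : word_closable b (P ++ half_twist h s ++ T) ->
  same_knot (plat b (P ++ half_twist h s ++ T)) (plat b (P ++ half_twist h' s ++ T)).
Proof.
have [<- _|] := eqVneq h h'; first exact: same_knot_refl.
have twisted k : word_closable b (P ++ half_twist k s ++ T)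
    = ((legs_after (reverse_legs (legs_after (start b) P)) T).1.2 != last_leg).
  by rewrite /word_closable !legs_after_cat legs_after_half_twist.
have lower_upper : word_closable b (P ++ half_twist false s ++ T) ->
    same_knot (plat b (P ++ half_twist false s ++ T)) (plat b (P ++ half_twist true s ++ T)).
  move=> vW; apply: (plat_cyclic_move
    (M := [:: (0, (false, s)); (1, (true, s)); (2, (false, s))])
    (M' := [:: (2, (true, s)); (1, (false, s)); (0, (true, s))])) => //.
    by rewrite -[map _ _]/(half_twist true s) twisted -(twisted false).
  by move=> P' T' _ _; apply: cyclic_move_plat_R3.
case: h h' => [] [] //= _ vW.
by apply: same_knot_sym; apply: lower_upper; rewrite twisted -(twisted true).
Qed.

Lemma plat_right_R1 b P h s : outer_leg (~~ h) (legs_after (start b) P) = last_leg ->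
  same_knot (plat b (P ++ [:: (h, s)])) (plat b P).
Proof.
move=> last_P; have := distinct_legs_after b P => dp.
have := @plat_cyclic_move b b P [:: (0, (h, s))] [::] [::]; rewrite !cats0; apply=> //.
- move: dp last_P; rewrite /word_closable legs_after_cat; case: (legs_after _ P) => [[u v] w].
  by case: (h); case: u v w => [[]|] [[]|] [[]|].
- by move: dp last_P; rewrite /word_closable; case: (legs_after _ P) => [[u v] w];
    case: (h); case: u v w => [[]|] [[]|] [[]|].
move=> P' T' P'E /(congr1 size)/eqP; rewrite size_map size_eq0 => /eqP ->; rewrite !cats0.
by apply: cyclic_move_right_R1; rewrite final_legs_after P'E.
Qed.

Lemma plat_right_R2 b P h s : outer_leg h (legs_after (start b) P) = last_leg ->
  same_knot (plat b (P ++ [:: (h, s); (~~ h, s)])) (plat b P).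
Proof.
move=> last_P; have := distinct_legs_after b P => dp.
have := @plat_cyclic_move b b P [:: (0, (h, s)); (1, (~~ h, s))] [::] [::].
rewrite !cats0; apply=> //.
- move: dp last_P; rewrite /word_closable legs_after_cat; case: (legs_after _ P) => [[u v] w].
  by case: (h); case: u v w => [[]|] [[]|] [[]|].
- by move: dp last_P; rewrite /word_closable; case: (legs_after _ P) => [[u v] w];
    case: (h); case: u v w => [[]|] [[]|] [[]|].
move=> P' T' P'E /(congr1 size)/eqP; rewrite size_map size_eq0 => /eqP ->; rewrite !cats0.
by apply: cyclic_move_right_R2; rewrite final_legs_after P'E.
Qed.

Lemma plat_left_R1 b T s : word_closable (~~ b) T ->
  same_knot (plat b ((true, s) :: T)) (plat (~~ b) T).
Proof.
move=> vT; apply: (plat_cyclic_move (P := [::]) (M := [:: (0, (true, s))]) (M' := [::])) => //.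
  by move: vT; rewrite /word_closable; case: (b).
move=> P' T' /(congr1 size)/eqP; rewrite size_map size_eq0 => /eqP -> _.
exact: cyclic_move_left_R1.
Qed.

(** * Absorbing half twists *)

Definition flip (W : word) : word := [seq (~~ t.1, t.2) | t <- W].

Lemma flipK : involutive flip.
Proof. by move=> W; rewrite /flip -map_comp map_id_in // => -[h s] _ /=; rewrite negbK. Qed.

Lemma legs_after_flip p W : legs_after (reverse_legs p) (flip W) = reverse_legs (legs_after p W).
Proof.
elim: W p => //= [[h s]] W IH p; rewrite -IH; congr legs_after.
by case: p h => [[? ?] ?] [].
Qed.

Lemma word_closable_half_twist b P h s T :
  word_closable b (P ++ half_twist h s ++ T) = word_closable b (P ++ flip T).
Proof.
rewrite /word_closable !legs_after_cat legs_after_half_twist; set q := legs_after _ P.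
by rewrite -[T in LHS]flipK legs_after_flip.
Qed.

Lemma plat_slide1 b P T h s x : word_closable b (P ++ half_twist h s ++ x :: T) ->
  same_knot (plat b (P ++ half_twist h s ++ x :: T))
            (plat b (P ++ (~~ x.1, x.2) :: half_twist h s ++ T)).
Proof.
case: x => k s' vW /=; have vW' j : word_closable b (P ++ (~~ k, s') :: half_twist j s ++ T).
  have := vW; rewrite word_closable_half_twist => vW1.
  by have := @word_closable_half_twist b (P ++ [:: (~~ k, s')]) j s T; rewrite -!catA => ->.
have slid_twist j : same_knot (plat b (P ++ (~~ k, s') :: half_twist j s ++ T))
    (plat b (P ++ (~~ k, s') :: half_twist h s ++ T)).
  by have := @plat_half_twist b (P ++ [:: (~~ k, s')]) T j h s; rewrite -!catA; apply; apply: vW'.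
have [ss|ss] := eqVneq s' s.
  apply: same_knot_trans (slid_twist k); rewrite ss in vW *.
  by have := plat_half_twist (~~ k) vW; rewrite {2}/half_twist negbK.
have {ss}sE : s' = ~~ s by case: s s' ss {vW vW' slid_twist} => [] [].
apply: same_knot_trans (slid_twist (~~ k)); rewrite {slid_twist} sE in vW vW' *.
apply: same_knot_trans (plat_half_twist k vW) _.
have v2 : word_closable b ((P ++ [:: (k, s); (~~ k, s)]) ++ T).
  have := vW' k; rewrite /word_closable -catA -[_ :: half_twist _ _ ++ T]cat1s !legs_after_cat.
  by case: (legs_after _ P) => [[? ?] ?]; case: (k).
apply: (@same_knot_trans (plat b (P ++ [:: (k, s); (~~ k, s)] ++ T))).
  by have := plat_R2 k s v2; rewrite -!catA.
apply: same_knot_sym; have := plat_R2 (P := P) (T := [:: (k, s); (~~ k, s)] ++ T) (~~ k) (~~ s).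
by rewrite /half_twist !negbK; apply; rewrite catA.
Qed.

Lemma plat_slide b P T h s : word_closable b (P ++ half_twist h s ++ T) ->
  same_knot (plat b (P ++ half_twist h s ++ T)) (plat b (P ++ flip T ++ half_twist h s)).
Proof.
elim: T P => [|x T IH] P vW; first by rewrite cats0; apply: same_knot_refl.
apply: same_knot_trans (plat_slide1 vW) _.
have := IH (P ++ [:: (~~ x.1, x.2)]); rewrite -!catA; apply.
by move: vW; rewrite word_closable_half_twist catA word_closable_half_twist -catA.
Qed.

Lemma plat_right b P h s s' : outer_leg (~~ h) (legs_after (start b) P) = last_leg ->
  same_knot (plat b (P ++ [:: (h, s'); (~~ h, s); (h, s)])) (plat b P).
Proof.
move=> last_P; apply: (@same_knot_trans (plat b (P ++ [:: (h, s')]))); last exact: plat_right_R1.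
have := @plat_right_R2 b (P ++ [:: (h, s')]) (~~ h) s; rewrite negbK -catA; apply.
by move: last_P; rewrite legs_after_cat; case: (legs_after _ P) => [[u v] w]; case: (h).
Qed.

Lemma plat_absorb b P h s : word_closable b P ->
  same_knot (plat b (P ++ half_twist h s)) (plat b P).
Proof.
move=> vP; have dp := distinct_legs_after b P.
have [k last_P] : exists k, outer_leg (~~ k) (legs_after (start b) P) = last_leg.
  move: vP dp; rewrite /word_closable; case: (legs_after _ P) => [[u v] w] /=.
  by case: u v w => [[]|] [[]|] [[]|] //= _ _; first [by exists true | by exists false].
apply: same_knot_trans (plat_right s s last_P).
have := @plat_half_twist b P [::] h k s; rewrite !cats0; apply.
by have := word_closable_half_twist b P h s [::]; rewrite !cats0 => ->.
Qed.

Lemma plat_cut_half_twist b P T h s : word_closable b (P ++ flip T) ->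
  same_knot (plat b (P ++ half_twist h s ++ T)) (plat b (P ++ flip T)).
Proof.
move=> vW; apply: same_knot_trans (plat_slide _) _; first by rewrite word_closable_half_twist.
by rewrite catA; apply: plat_absorb.
Qed.

Lemma legs_after_merge p h s T :
  legs_after p ((~~ h, ~~ s) :: flip T) = reverse_legs (legs_after p ([:: (h, s); (~~ h, s)] ++ T)).
Proof. by rewrite legs_after_cat -legs_after_flip; case: p => [[? ?] ?]; case: h. Qed.

Lemma word_closable_merge b P h s T :
  word_closable b (P ++ (~~ h, ~~ s) :: flip T)
  = word_closable b (P ++ [:: (h, s); (~~ h, s)] ++ T).
Proof. by rewrite /word_closable legs_after_cat legs_after_merge -legs_after_cat. Qed.

(* Two equal crossings at alternate heights are an opposite crossing followed by a
   half twist. *)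
Lemma plat_merge b P T h s : word_closable b (P ++ [:: (h, s); (~~ h, s)] ++ T) ->
  same_knot (plat b (P ++ [:: (h, s); (~~ h, s)] ++ T)) (plat b (P ++ (~~ h, ~~ s) :: flip T)).
Proof.
move=> vW; set P' := P ++ [:: (~~ h, ~~ s)].
have vW' : word_closable b (P' ++ flip T) by rewrite -catA cat1s word_closable_merge.
apply: (@same_knot_trans (plat b (P' ++ half_twist (~~ h) s ++ T))); last first.
  by have := plat_cut_half_twist (~~ h) s vW'; rewrite /P' -!catA.
apply: same_knot_sym.
have := @plat_R2 b P ([:: (h, s); (~~ h, s)] ++ T) (~~ h) (~~ s) vW.
by rewrite /P' /half_twist !negbK -!catA.
Qed.

Lemma plat_left b T s : word_closable b (flip T) ->
  same_knot (plat b ([:: (false, s); (true, s); (false, ~~ s)] ++ T)) (plat b (flip T)).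
Proof.
move=> vT; have closable_twist h : word_closable b (half_twist h s ++ T).
  by rewrite -[_ ++ T]cat0s word_closable_half_twist.
have closable_pair : word_closable (~~ b) ([:: (false, s); (true, s)] ++ T).
  by move: (closable_twist false); rewrite /word_closable !legs_after_cat; case: (b).
have closable_cancelling :
    word_closable b ([:: (true, ~~ s)] ++ half_twist true s ++ (false, ~~ s) :: T).
  by move: (closable_twist true); rewrite /word_closable !legs_after_cat; case: (b).
apply: (@same_knot_trans (plat b ([:: (true, ~~ s)] ++ [:: (false, s); (true, s)] ++ T))).
  apply: (@same_knot_trans (plat b ([:: (true, ~~ s)] ++ half_twist true s ++ (false, ~~ s) :: T))).
    apply: same_knot_sym.
    have := @plat_R2 b [::] ([:: (false, s); (true, s); (false, ~~ s)] ++ T) true (~~ s).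
    by rewrite negbK; apply; apply: (closable_twist true).
  apply: same_knot_trans (plat_half_twist false closable_cancelling) _.
  apply: (@plat_R2 b [:: (true, ~~ s); (false, s); (true, s)] T false s).
  by move: closable_cancelling; rewrite /word_closable !legs_after_cat; case: (b).
apply: same_knot_trans (plat_left_R1 _ closable_pair) _.
apply: (@same_knot_trans (plat b (half_twist true s ++ T))).
  by apply: same_knot_sym; apply: (@plat_left_R1 b _ s closable_pair).
exact: (@plat_cut_half_twist b [::]).
Qed.

(** * Words of crossings *)

(* The letter 0 (false) puts the ascending strand on top. *)
Fixpoint alternate (h : bool) (w : seq bool) : word :=
  if w is x :: w' then (h, ~~ x) :: alternate (~~ h) w' else [::].

Definition word_plat (w : seq bool) : seq letter := plat (size w %% 3 == 0) (alternate false w).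

Lemma size_alternate h w : size (alternate h w) = size w.
Proof. by elim: w h => //= x w IH h; rewrite IH. Qed.

Lemma alternate_cat h u v :
  alternate h (u ++ v) = alternate h u ++ alternate (h (+) odd (size u)) v.
Proof.
elim: u h => [|x u IH] h /=; first by rewrite addbF.
by rewrite IH addNb addbN.
Qed.

Lemma flip_alternate h w : flip (alternate h w) = alternate (~~ h) w.
Proof. by elim: w h => //= x w IH h; rewrite IH. Qed.

Lemma outer_leg_alternate w : size w %% 3 != 2 ->
  outer_leg (~~ odd (size w)) (legs_after (start (size w %% 3 == 0)) (alternate false w))
  = last_leg.
Proof.
have [n] := ubnP (size w); elim: n w => // n IH [|x [|y [|z w]]] // lt_n.
have size_mod3 : size [:: x, y, z & w] %% 3 = size w %% 3 by rewrite /= -addn3 modnDr.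
rewrite size_mod3 => ne; set b := (size w %% 3 == 0).
have -> : legs_after (start b) (alternate false [:: x, y, z & w])
    = reverse_legs (legs_after (start b) (alternate false w)).
  by rewrite -legs_after_flip flip_alternate; case: (b).
have lt_w : size w < n by move: lt_n => /=; lia.
by have := IH w lt_w ne; rewrite -/b /= !negbK; case: (odd (size w)).
Qed.

Lemma word_closable_alternate w : size w %% 3 != 2 ->
  word_closable (size w %% 3 == 0) (alternate false w).
Proof.
move=> /outer_leg_alternate; rewrite /word_closable.
have := distinct_legs_after (size w %% 3 == 0) (alternate false w).
by case: (odd _); case: (legs_after _ _) => [[u v] t] /=; case: u v t => [[]|] [[]|] [[]|].
Qed.

Lemma word_plat_triple u s v : size (u ++ v) %% 3 != 2 ->
  same_knot (word_plat (u ++ [:: s; s; s] ++ v)) (word_plat (u ++ v)).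
Proof.
move=> /word_closable_alternate; rewrite /word_plat.
have -> : size (u ++ [:: s; s; s] ++ v) %% 3 = size (u ++ v) %% 3.
  by rewrite !size_cat /= addnCA addnC modnDr.
move: (_ == 0) => b; rewrite !alternate_cat !addFb addbT; set h := odd (size u).
have -> : alternate h v = flip (alternate (~~ h) v) by rewrite flip_alternate negbK.
move=> vW; have := plat_cut_half_twist h (~~ s) vW.
by rewrite /half_twist /= !negbK.
Qed.

Lemma word_plat_left s x v : size v %% 3 != 2 ->
  same_knot (word_plat ([:: s; s; x] ++ v)) (word_plat v).
Proof.
move=> v2; have [->|xs] := eqVneq x s; first exact: (@word_plat_triple [::] s v).
have {xs}-> : x = ~~ s by case: x s xs => [] [].
have := word_closable_alternate v2; rewrite /word_plat.
have -> : size ([:: s; s; ~~ s] ++ v) %% 3 = size v %% 3 by rewrite size_cat addnC modnDr.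
move: (_ == 0) => b.
have -> : alternate false v = flip (alternate true v) by rewrite flip_alternate.
exact: plat_left.
Qed.

Lemma word_plat_right s x v : size v %% 3 != 2 ->
  same_knot (word_plat (v ++ [:: x; s; s])) (word_plat v).
Proof.
move=> v2; have := outer_leg_alternate v2; rewrite /word_plat.
have -> : size (v ++ [:: x; s; s]) %% 3 = size v %% 3 by rewrite size_cat modnDr.
move: (_ == 0) => b last_v; rewrite alternate_cat /= negbK; exact: plat_right.
Qed.

Definition push (st : seq bool) (x : bool) : seq bool :=
  if prefix [:: x; x] st then drop 2 st else x :: st.

Variant push_spec (st : seq bool) (x : bool) : seq bool -> Type :=
  | PushTriple st' of st = [:: x, x & st'] : push_spec st x st'
  | PushCons of ~~ prefix [:: x; x] st : push_spec st x (x :: st).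

Lemma pushP st x : push_spec st x (push st x).
Proof.
rewrite /push; case: ifP => [|/negbT]; last exact: PushCons.
case: st => [|y [|z st]] //=; first by rewrite andbF.
by case/and3P=> /eqP <- /eqP <- _; rewrite drop0; apply: PushTriple.
Qed.

(* The word is kept in reverse order. *)
Definition reduce (w : seq bool) : seq bool := foldl push [::] w.
Fixpoint trim (w : seq bool) : seq bool :=
  if w is x :: y :: z :: w' then if x == y then trim w' else w else w.
Definition core (w : seq bool) : seq bool := trim (rev (trim (reduce w))).

Lemma reduce_rcons w x : reduce (rcons w x) = push (reduce w) x.
Proof. by rewrite /reduce foldl_rcons. Qed.

Lemma word_plat_push st w : size (rev st ++ w) %% 3 != 2 ->
  same_knot (word_plat (rev st ++ w)) (word_plat (rev (foldl push st w)))
  /\ size (foldl push st w) = size (rev st ++ w) %[mod 3].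
Proof.
elim: w st => [|x w IH] st sz_mod3.
  by rewrite cats0 size_rev; split=> //; apply: same_knot_refl.
rewrite [foldl _ _ _]/=; case: pushP sz_mod3 => [{}st ->|_] sz_mod3; last first.
  by move: sz_mod3; rewrite -cat_rcons -rev_cons; apply: IH.
have size_mod3 : size (rev st ++ [:: x; x; x] ++ w) %% 3 = size (rev st ++ w) %% 3.
  by rewrite !size_cat /= addnCA addnC modnDr.
move: sz_mod3; rewrite !rev_cons -!cats1 -!catA size_mod3 => sz_mod3.
have [knot_st size_st] := IH st sz_mod3; split=> //.
by apply: same_knot_trans knot_st; apply: word_plat_triple.
Qed.

Lemma word_plat_reduce w : size w %% 3 != 2 ->
  same_knot (word_plat w) (word_plat (rev (reduce w))) /\ size (reduce w) = size w %[mod 3].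
Proof. exact: (@word_plat_push [::] w). Qed.

Lemma word_plat_trim w : size w %% 3 != 2 ->
  [/\ same_knot (word_plat w) (word_plat (trim w)),
      same_knot (word_plat (rev w)) (word_plat (rev (trim w))) &
      size (trim w) = size w %[mod 3]].
Proof.
have [n] := ubnP (size w); elim: n w => // n IH [|x [|y [|z w]]] lt_n sz_mod3;
  try by split; first [exact: same_knot_refl | by []].
rewrite [trim _]/=; case: eqP => [<-|_]; last by split; first [exact: same_knot_refl | by []].
have size_mod3 : size [:: x, x, z & w] %% 3 = size w %% 3 by rewrite /= -addn3 modnDr.
rewrite size_mod3 in sz_mod3 *; have lt_w : size w < n by move: lt_n => /=; lia.
have [knot_w knot_rev size_w] := IH w lt_w sz_mod3; split=> //.
  by apply: same_knot_trans knot_w; apply: (@word_plat_left x z w).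
apply: same_knot_trans knot_rev.
have := @word_plat_right x z (rev w); rewrite size_rev => /(_ sz_mod3).
by rewrite !rev_cons -!cats1 -!catA.
Qed.

Lemma word_plat_core w : size w %% 3 != 2 ->
  same_knot (word_plat w) (word_plat (core w)) /\ size (core w) = size w %[mod 3].
Proof.
move=> sz_mod3; have [knot_red size_red] := word_plat_reduce sz_mod3.
have [|_ knot_left size_left] := @word_plat_trim (reduce w); first by rewrite size_red.
have [|knot_right _ size_right] := @word_plat_trim (rev (trim (reduce w))).
  by rewrite size_rev size_left size_red.
split; last by rewrite /core size_right size_rev size_left.
by apply: same_knot_trans knot_red _; apply: same_knot_trans knot_left _.
Qed.

Definition no_triple (w : seq bool) : bool := [forall s, ~~ infix [:: s; s; s] w].
Definition single_head (w : seq bool) : bool := [forall s, ~~ prefix [:: s; s] w].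

Lemma no_triple_nil : no_triple [::]. Proof. exact/forallP. Qed.

Lemma no_triple_cons x w : no_triple (x :: w) = ~~ prefix [:: x; x] w && no_triple w.
Proof.
apply/forallP/andP => [nt|[nx /forallP nt] s].
  split; last by apply/forallP => s; have := nt s; rewrite infix_consl negb_or => /andP[].
  by have := nt x; rewrite infix_consl negb_or /= eqxx => /andP[].
by rewrite infix_consl negb_or nt andbT /=; case: eqP => // ->.
Qed.

Lemma single_head1 x : single_head [:: x].
Proof. by apply/forallP => s; rewrite /= andbF. Qed.

Lemma single_head_cons2 x y w : single_head [:: x, y & w] = (x != y).
Proof.
apply/forallP/idP => [/(_ x) /=|nxy s]; first by rewrite eqxx prefix0s andbT.
by rewrite /= prefix0s andbT; apply: contra nxy => /andP[/eqP <- /eqP <-].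
Qed.

Lemma no_triple_infix u w : infix u w -> no_triple w -> no_triple u.
Proof.
by move=> uw /forallP nt; apply/forallP => s; apply: contra (nt s) => /infix_trans; apply.
Qed.

Lemma no_triple_rev w : no_triple (rev w) = no_triple w.
Proof. by apply: eq_forallb => s; rewrite -infix_rev revK. Qed.

Lemma single_head_prefix u w : prefix u w -> single_head w -> single_head u.
Proof.
by move=> uw /forallP sh; apply/forallP => s; apply: contra (sh s) => /prefix_trans; apply.
Qed.

Lemma single_head_rev_cons x w : 1 < size w -> single_head (rev (x :: w)) = single_head (rev w).
Proof.
rewrite rev_cons -(size_rev w); case: (rev w) => [|a [|b u]] // _.
by rewrite rcons_cons rcons_cons !single_head_cons2.
Qed.

Lemma no_triple_push st x : no_triple st -> no_triple (push st x).
Proof.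
case: pushP => [st' ->|nx nt]; last by rewrite no_triple_cons nx.
by rewrite !no_triple_cons => /and3P[].
Qed.

Lemma push_no_triple st x : no_triple (x :: st) -> push st x = x :: st.
Proof. by rewrite no_triple_cons /push => /andP[/negbTE ->]. Qed.

Lemma no_triple_reduce w : no_triple (reduce w).
Proof.
elim/last_ind: w => [|w x IH]; first exact: no_triple_nil.
by rewrite reduce_rcons no_triple_push.
Qed.

Lemma suffix_trim w : suffix (trim w) w.
Proof.
have [n] := ubnP (size w); elim: n w => // n IH [|x [|y [|z w]]] lt_n; rewrite ?suffix_refl //=.
case: ifP => _; last exact: suffix_refl.
by apply: (@suffix_catr _ _ _ [:: x; y; z]); apply: IH; move: lt_n => /=; lia.
Qed.

Lemma single_head_trim w : 2 < size (trim w) -> single_head (trim w).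
Proof.
have [n] := ubnP (size w); elim: n w => // n IH [|x [|y [|z w]]] lt_n //=.
case: ifP => [_|nxy] sz; last by rewrite single_head_cons2 nxy.
by apply: IH sz; move: lt_n => /=; lia.
Qed.

Definition is_core (r : seq bool) : bool :=
  [&& 2 < size r, no_triple r, single_head r & single_head (rev r)].

Lemma is_core_core w : 2 < size (core w) -> is_core (core w).
Proof.
move=> sz; have suf := suffix_trim (rev (trim (reduce w))).
apply/and4P; split=> //; last 1 first.
- apply: (@single_head_prefix _ (trim (reduce w))); first by rewrite prefix_revLR.
  by apply: single_head_trim; rewrite -size_rev; apply: leq_trans sz (size_suffix suf).
- apply: no_triple_infix (suffixW suf) _; rewrite no_triple_rev.
  exact: no_triple_infix (suffixW (suffix_trim _)) (no_triple_reduce w).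
- exact: single_head_trim.
Qed.

(* ds tells which of the blocks of equal letters have length 2; a single last
   letter follows. *)
Fixpoint block_word (x : bool) (ds : seq bool) : seq bool :=
  if ds is d :: ds' then nseq d.+1 x ++ block_word (~~ x) ds' else [:: x].

Lemma block_word_head x ds : exists t, block_word x ds = x :: t.
Proof. by case: ds => [|[] ds]; eexists. Qed.

Lemma size_block_word x ds : size (block_word x ds) = (size ds).+1 + count id ds.
Proof. by elim: ds x => // d ds IH x; rewrite /= size_cat IH; case: d => /=; lia. Qed.

Lemma no_triple_block_word x ds : no_triple (block_word x ds).
Proof.
elim: ds x => [|d ds IH] x /=; first by rewrite no_triple_cons no_triple_nil.
have := IH (~~ x); have [t ->] := block_word_head (~~ x) ds => nt.
by move: nt; case: d => /=; rewrite !no_triple_cons => /andP[-> ->]; case: (x).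
Qed.

Lemma single_head_rev_block_word x ds : single_head (rev (block_word x ds)).
Proof.
elim: ds x => [|d ds IH] x /=; first exact: single_head1.
have := IH (~~ x); have [t ->] := block_word_head (~~ x) ds.
case: t => [|a t] sh; first by case: d; rewrite /rev /= single_head_cons2; case: (x).
by case: d; rewrite /= !(single_head_rev_cons x).
Qed.

Lemma block_word_surj x w : no_triple (x :: w) -> single_head (rev (x :: w)) ->
  exists ds, x :: w = block_word x ds.
Proof.
have [n] := ubnP (size w); elim: n x w => // n IH x [|y w] lt_n nt sh; first by exists [::].
have [xy|nxy] := eqVneq x y.
  subst y; case: w lt_n nt sh => [|z w] lt_n nt sh.
    by move: sh; rewrite single_head_cons2 eqxx.
  have zx : z = ~~ x.
    by move: nt; rewrite no_triple_cons /= eqxx prefix0s andbT; case: (x) (z) => [] [].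
  have [|||ds Eds] := IH z w; first by move: lt_n => /=; lia.
  - by move: nt; rewrite !no_triple_cons => /and3P[].
  - by case: (w) sh => [|a u]; [move=> _; apply: single_head1 | rewrite !(single_head_rev_cons x)].
  by exists (true :: ds); rewrite /= -zx -Eds.
have yx : y = ~~ x by move: nxy; case: (x) (y) => [] [].
have [|||ds Eds] := IH y w; first by move: lt_n => /=; lia.
- by move: nt; rewrite no_triple_cons => /andP[].
- by case: (w) sh => [|a u]; [move=> _; apply: single_head1 | rewrite (single_head_rev_cons x)].
by exists (false :: ds); rewrite /= -yx -Eds.
Qed.

Lemma block_word_inj x : injective (block_word x).
Proof.
move=> ds ds'; elim: ds ds' x => [|d ds IH] [|d' ds'] x //=.
- by have [t ->] := block_word_head (~~ x) ds'; case: d'.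
- by have [t ->] := block_word_head (~~ x) ds; case: d.
have [t Et] := block_word_head (~~ x) ds; have [t' Et'] := block_word_head (~~ x) ds'.
case: d d' => [] [] /=.
- by case=> /IH ->.
- by rewrite Et' => -[]; case: (x).
- by rewrite Et => -[]; case: (x).
- by case=> /IH ->.
Qed.

Definition core_word (x : bool) (ds : seq bool) : seq bool := block_word x (false :: ds).

Lemma is_coreP r :
  reflect (exists x ds, 0 < size ds /\ r = core_word x ds) (is_core r).
Proof.
apply: (iffP and4P) => [[sz nt sh shr]|[x [ds [ds0 ->]]]].
  case: r sz nt sh shr => [|x w] // sz nt sh shr.
  have [[|[] ds] E] := block_word_surj nt shr.
  - by rewrite E in sz.
  - by move: sh; rewrite E /= single_head_cons2 eqxx.
  exists x, ds; split=> //; case: ds E => // E.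
  by rewrite E in sz.
split; [| exact: no_triple_block_word | | exact: single_head_rev_block_word].
  by rewrite size_block_word /=; case: ds ds0 => //= d ds _; rewrite addnS.
by rewrite /core_word /=; have [t ->] := block_word_head (~~ x) ds;
  rewrite single_head_cons2; case: x.
Qed.

(** * The crossing number of a core *)

(* A block of two letters at heights h, ~~ h becomes a single crossing at height
   ~~ h, and the rest of the plat is turned over. *)
Fixpoint block_heights (h : bool) (ds : seq bool) : seq bool :=
  if ds is d :: ds' then h (+) d :: block_heights (~~ h) ds' else [:: h].

Lemma size_block_heights h ds : size (block_heights h ds) = (size ds).+1.
Proof. by elim: ds h => //= d ds IH h; rewrite IH. Qed.

Definition block_crossings (h x : bool) (ds : seq bool) : word :=
  alternating_word (h (+) ~~ x) (block_heights h ds).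

Lemma block_crossings_cons h x d ds : block_crossings h x (d :: ds) =
  (h (+) d, x (+) ~~ d) :: block_crossings (~~ h) (~~ x) ds.
Proof.
rewrite /block_crossings /alternating_word /=; congr ((_, _) :: _).
  by case: h x d => [] [] [].
by apply: eq_map => k; case: h x => [] [].
Qed.

Lemma alternate_block_word h x d ds : alternate h (block_word x (d :: ds)) =
  if d then [:: (h, ~~ x); (~~ h, ~~ x)] ++ alternate h (block_word (~~ x) ds)
  else (h, ~~ x) :: alternate (~~ h) (block_word (~~ x) ds).
Proof. by case: d => //=; rewrite negbK. Qed.

Lemma legs_after_block_crossings h x ds p :
  let q := legs_after p (alternate h (block_word x ds)) in
  let q' := legs_after p (block_crossings h x ds) in
  q'.1.2 = q.1.2 /\
  outer_leg (last h (block_heights h ds)) q'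
  = outer_leg (h (+) ~~ odd (size (block_word x ds))) q.
Proof.
elim: ds h x p => [|d ds IH] h x p; first by rewrite /= addbF.
have lastE : last h (block_heights h (d :: ds)) = last (~~ h) (block_heights (~~ h) ds).
  by case: (ds).
have oddE : odd (size (block_word x (d :: ds))) = ~~ d (+) odd (size (block_word (~~ x) ds)).
  by case: (d) => /=; rewrite ?negbK.
rewrite alternate_block_word block_crossings_cons lastE oddE.
case: d {lastE oddE}; rewrite ?addbT ?addbF /=; last first.
  by have [-> ->] := IH (~~ h) (~~ x) (swap_legs h p); rewrite negbK addNb addbN negbK.
have [-> ->] := IH (~~ h) (~~ x) (swap_legs (~~ h) p).
have -> : legs_after (swap_legs (~~ h) p) (alternate (~~ h) (block_word (~~ x) ds)) =
    reverse_legs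
      (legs_after (swap_legs (~~ h) (swap_legs h p)) (alternate h (block_word (~~ x) ds))).
  rewrite -legs_after_flip flip_alternate; congr legs_after.
  by case: p h {IH} => [[? ?] ?] [].
by rewrite addNb; split=> //; case: (h (+) _).
Qed.

Lemma plat_block_crossings b P h x ds : word_closable b (P ++ alternate h (block_word x ds)) ->
  same_knot (plat b (P ++ alternate h (block_word x ds))) (plat b (P ++ block_crossings h x ds)).
Proof.
elim: ds P h x => [|d ds IH] P h x.
  by rewrite /block_crossings /= addKb => _; apply: same_knot_refl.
rewrite alternate_block_word block_crossings_cons; case: d => vW.
  have := IH (P ++ [:: (~~ h, x)]) (~~ h) (~~ x); rewrite -!catA !cat1s -flip_alternate => IH'.
  rewrite addbT addbF; apply: same_knot_trans (plat_merge vW) _; rewrite negbK; apply: IH'.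
  by have := word_closable_merge b P h (~~ x); rewrite negbK => ->.
have := IH (P ++ [:: (h, ~~ x)]) (~~ h) (~~ x); rewrite -!catA !cat1s addbF addbT.
exact.
Qed.

Lemma crossing_number_le G H : same_knot G H -> crossing_number G <= crossings H.
Proof.
move=> GH; rewrite /crossing_number; case: ex_minnP => m _; apply.
by apply/asboolP; exists H.
Qed.

Lemma crossing_number_eq G H c : same_knot G H -> crossings H = c ->
  (forall K, same_knot H K -> c <= crossings K) -> crossing_number G = c.
Proof.
move=> GH cH lb; apply/eqP; rewrite eqn_leq -{1}cH crossing_number_le //=.
rewrite /crossing_number; case: ex_minnP => m /asboolP[K GK <-] _; apply: lb.
exact: same_knot_trans (same_knot_sym GH) GK.
Qed.

Lemma size_numbered k W : size (numbered k W) = size W.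
Proof. by rewrite /numbered size_zip size_iota minnn. Qed.

Lemma crossings_plat b W : crossings (plat b W) = size W.
Proof. by rewrite crossings_plat_code ?distinct_legs_start // size_numbered. Qed.

Lemma joins_upper_numbered b W h : outer_leg h (legs_after (start b) W) = last_leg ->
  joins_upper (start b) (numbered 0 W) = ~~ h.
Proof.
rewrite /joins_upper final_legs_after map_snd_numbered; have := distinct_legs_after b W.
by case: (legs_after _ W) => [[u v] w]; case: h; case: u v w => [[]|] [[]|] [[]|].
Qed.

Lemma crossings_alternating_plat b kap hs (W := alternating_word kap (false :: hs)) K :
    hs != [::] -> word_closable b W ->
    outer_leg (last false hs) (legs_after (start b) W) = last_leg ->
  same_knot (plat b W) K -> size W <= crossings K.
Proof.
move=> hs0 vW last_W WK; pose T := numbered 0 W.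
have uT : uniq (item_names T) by rewrite item_names_numbered iota_uniq.
have vT : closable (start b) T by rewrite closable_word map_snd_numbered.
have TE : map snd T
    = alternating_word kap (false :: rcons (belast (head false hs) (behead hs))
                                           (~~ joins_upper (start b) T)).
  rewrite map_snd_numbered (joins_upper_numbered last_W) negbK.
  have lastE l : l != [::] -> l = rcons (belast (head false l) (behead l)) (last false l).
    by case: l => // h l _; rewrite /= -lastI.
  by rewrite -lastE.
have [k [low high]] := bracket_alternating_plat uT vT TE.
rewrite -(size_numbered 0 W); apply: (crossings_ge_span WK _ low high).
exact: diagram_plat_code.
Qed.

Lemma crossing_number_core_word G x ds (r := core_word x ds) :
  size r %% 3 != 2 -> same_knot G (word_plat r) -> crossing_number G = (size ds).+2.
Proof.
move=> sz_mod3 Gr; set b := size r %% 3 == 0; pose W := block_crossings false x (false :: ds).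
have vr : word_closable b ([::] ++ alternate false r) := word_closable_alternate sz_mod3.
have [mid_W outer_W] := legs_after_block_crossings false x (false :: ds) (start b).
have sizeW : size W = (size ds).+2 by rewrite /W size_map size_block_heights.
apply: (@crossing_number_eq _ (plat b W)).
- exact: same_knot_trans Gr (plat_block_crossings vr).
- by rewrite crossings_plat.
move=> K WK; rewrite -sizeW; apply: (crossings_alternating_plat _ _ _ WK).
- by case: (ds).
- by move: vr; rewrite /word_closable -[[::] ++ _]/(alternate false r) -mid_W.
- rewrite -[last _ _]/(last false (block_heights false (false :: ds))) outer_W.
  by rewrite outer_leg_alternate.
Qed.

Lemma crossing_number_word_plat G w c : size w %% 3 != 2 -> same_knot G (word_plat w) -> 2 < c ->
  crossing_number G = c <-> exists x ds, (size ds).+2 = c /\ core w = core_word x ds.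
Proof.
move=> sz_mod3 Gw c3; have [w_core size_core] := word_plat_core sz_mod3.
have G_core := same_knot_trans Gw w_core.
have sz_mod3' : size (core w) %% 3 != 2 by rewrite size_core.
split=> [Gc|[x [ds [<- coreE]]]]; last first.
  by rewrite coreE in G_core sz_mod3'; apply: crossing_number_core_word G_core.
have gt2 : 2 < size (core w).
  have := crossing_number_le G_core; rewrite Gc /word_plat crossings_plat size_alternate.
  exact: leq_trans.
have /is_coreP[x [ds [_ coreE]]] := is_core_core gt2; exists x, ds; split=> //.
by rewrite coreE in G_core sz_mod3'; rewrite -Gc (crossing_number_core_word sz_mod3' G_core).
Qed.

(** * Billiard diagrams *)

Lemma bounce_mod p t : bounce p (t %% (2 * p)) = bounce p t.
Proof. by rewrite /bounce modn_mod. Qed.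

Lemma bounce_dir_mod p t : bounce_dir p (t %% (2 * p)) = bounce_dir p t.
Proof. by rewrite /bounce_dir modn_mod. Qed.

Lemma bounceE p t x : 0 < p -> t <= 3 * p ->
  (bounce p t == x) = (x <= p) && (t \in [:: x; 2 * p - x; 2 * p + x]).
Proof.
move=> p0 t3; rewrite /bounce !inE.
have [lt|ge] := ltnP t (2 * p).
  by rewrite modn_small //; case: leqP => ?; lia.
have -> : t %% (2 * p) = t - 2 * p.
  by rewrite -{1}(subnK ge) modnDr modn_small //; lia.
by case: leqP => ?; lia.
Qed.

Fixpoint legs_before (b : bool) (m : nat) : state :=
  if m is m'.+1 then swap_legs (odd m') (legs_before b m') else start b.

Lemma legs_before_mod6 b m : legs_before b (m %% 6) = legs_before b m.
Proof.
have period k : legs_before b (k + 6) = legs_before b k.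
  rewrite !addnS addn0 /= !negbK; case: (legs_before b k) => [[? ?] ?].
  by case: (odd k).
rewrite [in RHS](divn_eq m 6); elim: (m %/ 6) => // q IH.
by rewrite mulSnr addnAC period.
Qed.

Lemma strand_alternate b r k w :
  strand r (legs_before b k) (zip (iota k.+1 (size w)) (alternate (odd k) w)) =
  flatten [seq item_letters r (legs_before b x.-1) (x, (odd x.-1, ~~ nth false w (x - k.+1)))
          | x <- iota k.+1 (size w)].
Proof.
elim: w k => //= x w IH k; rewrite subnn /=; congr (_ ++ _).
rewrite -[swap_legs (odd k) _]/(legs_before b k.+1) -[~~ odd k]/(odd k.+1) IH; congr flatten.
apply/eq_in_map => y; rewrite mem_iota => /andP[ky _].
by rewrite -(subnSK ky).
Qed.

Section BilliardCode.
Variables (n : nat) (w : n.-tuple bool).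
Hypothesis n_mod3 : n %% 3 != 2.

Lemma last_time : lcmn 3 n.+1 = 3 * n.+1.
Proof.
have cop : coprime 3 n.+1 by rewrite prime_coprime //; move: n_mod3; lia.
by have := muln_lcm_gcd 3 n.+1; rewrite (eqP cop) muln1.
Qed.

Definition leg_time (r : leg) (x : nat) : nat :=
  match r with None => x | Some false => 2 * n.+1 - x | Some true => 2 * n.+1 + x end.

Definition legs : seq leg := [:: first_leg; back_leg; last_leg].

Lemma bounce_leg_time r x : x <= n.+1 -> bounce n.+1 (leg_time r x) = x.
Proof.
move=> xn; apply/eqP; rewrite bounceE //; last by case: r => [[]|] /=; lia.
by rewrite xn !inE; case: r => [[]|]; rewrite eqxx ?orbT.
Qed.

Lemma bounce_dir_leg_time r x : 0 < x <= n ->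
  bounce_dir n.+1 (leg_time r x) = (if r == back_leg then -1 else 1)%R.
Proof.
move=> xn; rewrite /bounce_dir; case: r => [[]|] /=.
- by rewrite modnDl modn_small; [case: ltnP => //|]; lia.
- by rewrite modn_small; [case: ltnP => //|]; lia.
- by rewrite modn_small; [case: ltnP => //|]; lia.
Qed.

Lemma leg_time_inj x : 0 < x <= n -> injective (leg_time^~ x).
Proof. by move=> xn [[]|] [[]|] //=; lia. Qed.

Lemma column_times x : 0 < x <= n ->
  [seq t <- times n | bounce n.+1 t == x] = [seq leg_time r x | r <- legs].
Proof.
move=> xn; apply: (irr_sorted_eq ltn_trans ltnn).
- by apply: sorted_filter; [apply: ltn_trans | apply: iota_ltn_sorted].
- by rewrite /=; apply/and3P; split=> //; lia.
move=> t; rewrite mem_filter mem_iota /= add0n ltnS last_time.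
case: (leqP t (3 * n.+1)) => t3; last by rewrite andbF !inE; lia.
by rewrite andbT bounceE //; case/andP: xn => _ xn; rewrite (leqW xn).
Qed.

Local Arguments leg_time : simpl never.

Lemma other_times_leg r x : 0 < x <= n ->
  other_times n (leg_time r x) =
  [seq leg_time r' x | r' <- legs
                     & (r' != r) && (bounce 3 (leg_time r' x) == bounce 3 (leg_time r x))].
Proof.
move=> xn; have xn1 : x <= n.+1 by case/andP: xn => _ /leqW.
rewrite (eq_filter (a2 := preim (leg_time^~ x) (fun t' =>
  (t' != leg_time r x) && (bounce 3 t' == bounce 3 (leg_time r x))))); last first.
  by move=> r'; rewrite /= (inj_eq (leg_time_inj xn)).
rewrite -filter_map -(column_times xn) -filter_predI; apply: eq_filter => t /=.
by rewrite /ball xpair_eqE bounce_leg_time // -andbA [(bounce n.+1 t == _) && _]andbC.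
Qed.

(* c is the residue of 2 (n + 1) modulo 6, and u that of x. *)
Definition leg_residue (c u : nat) (r : leg) : nat :=
  match r with None => u | Some false => (c + (6 - u)) %% 6 | Some true => (c + u) %% 6 end.

Lemma leg_time_mod6 r x : x <= n ->
  leg_time r x %% 6 = leg_residue (if n %% 3 == 0 then 2 else 4) (x %% 6) r.
Proof.
move=> xn; have <- : (2 * n.+1) %% 6 = if n %% 3 == 0 then 2 else 4.
  by case: ifP n_mod3 => /eqP; lia.
by case: r => [[]|]; rewrite /leg_time /= ?modnDm //; lia.
Qed.

Lemma item_letters_passage r x : 0 < x <= n ->
  item_letters r (legs_before (n %% 3 == 0) x.-1) (x, (odd x.-1, ~~ nth false w x.-1)) =
  if other_times n (leg_time r x) != [::] then [:: passage w (leg_time r x)] else [::].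
Proof.
move=> xn; have xn1 : x <= n.+1 by case/andP: xn => _ /leqW.
have leg_mod6 r' := leg_time_mod6 r' (ltac:(by case/andP: xn) : x <= n).
have height r' := bounce_mod 3 (leg_time r' x); rewrite -[2 * 3]/6 in height.
have slope r' := bounce_dir_mod 3 (leg_time r' x); rewrite -[2 * 3]/6 in slope.
have pred_mod6 : x.-1 %% 6 = (x %% 6 + 5) %% 6 by lia.
have odd_pred : odd x.-1 = odd (x.-1 %% 6) by rewrite {1}(divn_eq x.-1 6) oddD oddM andbF.
rewrite -legs_before_mod6 odd_pred pred_mod6 /passage /on_top /ascending /velocity /ball.
rewrite other_times_leg // bounce_leg_time //.
set c := if n %% 3 == 0 then 2 else 4 in leg_mod6.
have -> : [seq r' <- legs | (r' != r) && (bounce 3 (leg_time r' x) == bounce 3 (leg_time r x))] =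
    [seq r' <- legs | (r' != r) && (bounce 3 (leg_residue c (x %% 6) r')
                                    == bounce 3 (leg_residue c (x %% 6) r))].
  by apply: eq_filter => r'; rewrite -!leg_mod6 !height.
move: leg_mod6 (ltn_pmod x (isT : 0 < 6)); rewrite {}/c.
move: (x %% 6) => u; case: (n %% 3 == 0);
  case: u => [|[|[|[|[|[|u]]]]]] // leg_mod6 _; case: r => [[]|];
  match goal with |- context [filter ?p legs] =>
    let l := eval vm_compute in (filter p legs) in change (filter p legs) with l end;
  rewrite /= ?(bounce_dir_leg_time _ xn) -?slope ?leg_mod6;
  by case: (nth false w x.-1); vm_compute.
Qed.

Lemma other_times_corner t : t \in [:: 0; n.+1; 2 * n.+1; 3 * n.+1] -> other_times n t = [::].
Proof.
move=> tc; rewrite /other_times (@eq_in_filter _ _ pred0) ?filter_pred0 // => t'.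
rewrite mem_iota add0n ltnS last_time /= => t'3; apply/negP => /andP[tt'].
rewrite /ball xpair_eqE => /andP[same_x same_y].
have N6 : n.+1 %% 6 \in [:: 1; 2; 4; 5] by rewrite !inE; move: n_mod3; lia.
have left_y : bounce 3 0 != bounce 3 (2 * n.+1).
  by rewrite -(bounce_mod 3 (2 * _)) -modnMmr; move: N6; rewrite !inE => /or4P[]/eqP ->.
have right_y : bounce 3 n.+1 != bounce 3 (3 * n.+1).
  rewrite -(bounce_mod 3 n.+1) -(bounce_mod 3 (3 * _)) -modnMmr.
  by move: N6; rewrite !inE => /or4P[]/eqP ->.
have [x [x_end t_x]] : exists x, x \in [:: 0; n.+1] /\ t \in [:: x; 2 * n.+1 + x].
  move: tc; rewrite !inE => /or4P[]/eqP ->; [exists 0 | exists n.+1 | exists 0 | exists n.+1];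
    by rewrite !inE !eqxx ?orbT; split=> //; lia.
have {same_x} t'_x : t' \in [:: x; 2 * n.+1 + x].
  have {same_x} : bounce n.+1 t' == x.
    rewrite (eqP same_x); move: t_x; rewrite !inE => /orP[]/eqP ->.
      by apply: (introT eqP); apply: (bounce_leg_time first_leg); move: x_end; rewrite !inE; lia.
    by apply: (introT eqP); apply: (bounce_leg_time last_leg); move: x_end; rewrite !inE; lia.
  by rewrite bounceE // !inE => /andP[_]; move: x_end; rewrite !inE; lia.
have end_y : bounce 3 x != bounce 3 (2 * n.+1 + x).
  move: x_end; rewrite !inE => /orP[]/eqP ->; first by rewrite addn0.
  by rewrite -mulSnr.
move: t_x t'_x tt' same_y; rewrite !inE => /orP[]/eqP -> /orP[]/eqP ->; rewrite ?eqxx //.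
  by rewrite [_ == bounce 3 x]eq_sym (negbTE end_y).
by rewrite (negbTE end_y).
Qed.

Lemma strand_passages r :
  strand r (start (n %% 3 == 0)) (zip (iota 1 n) (alternate false w)) =
  [seq passage w t | t <- [seq leg_time r x | x <- iota 1 n] & other_times n t != [::]].
Proof.
have := strand_alternate (n %% 3 == 0) r 0 w; rewrite size_tuple => ->.
have flattenE l :
    [seq passage w t | t <- [seq leg_time r x | x <- l] & other_times n t != [::]] =
    flatten [seq if other_times n (leg_time r x) != [::] then [:: passage w (leg_time r x)]
                 else [::] | x <- l].
  by elim: l => //= x l IH; case: ifP => _ /=; rewrite IH.
rewrite flattenE; congr flatten; apply/eq_in_map => x; rewrite mem_iota add1n ltnS => xn.
by rewrite subn1 item_letters_passage.
Qed.

Lemma times_legs : times n =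
  [:: 0] ++ [seq leg_time first_leg x | x <- iota 1 n] ++ [:: n.+1] ++
  rev [seq leg_time back_leg x | x <- iota 1 n] ++ [:: 2 * n.+1] ++
  [seq leg_time last_leg x | x <- iota 1 n] ++ [:: 3 * n.+1].
Proof.
have -> : [seq leg_time first_leg x | x <- iota 1 n] = iota 1 n by rewrite /leg_time map_id.
have -> : rev [seq leg_time back_leg x | x <- iota 1 n] = iota n.+2 n.
  apply: (@eq_from_nth _ 0); rewrite size_rev size_map !size_iota // => i lt_i.
  rewrite nth_rev size_map size_iota // (nth_map 0) ?size_iota; last by lia.
  by rewrite !nth_iota /leg_time; lia.
have -> : [seq leg_time last_leg x | x <- iota 1 n] = iota (2 * n.+1).+1 n.
  apply: (@eq_from_nth _ 0); rewrite size_map !size_iota // => i lt_i.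
  by rewrite (nth_map 0) ?size_iota // !nth_iota /leg_time //; lia.
rewrite /times last_time.
have -> : (3 * n.+1).+1 = 1 + (n + (1 + (n + (1 + (n + 1))))) by lia.
have iota1 k : iota k 1 = [:: k] by [].
rewrite !iotaD !iota1; congr (_ ++ (_ ++ (_ ++ (_ ++ (_ ++ (_ ++ _))))));
  first [by [] | congr [:: _]; lia | congr iota; lia].
Qed.

Lemma billiard_diagramE :
  billiard_diagram w = plat_code (start (n %% 3 == 0)) (zip (iota 1 n) (alternate false w)).
Proof.
rewrite /billiard_diagram times_legs /plat_code !strand_passages.
rewrite !filter_cat !map_cat !filter_rev !map_rev.
have corner t : t \in [:: 0; n.+1; 2 * n.+1; 3 * n.+1] ->
    [seq t' <- [:: t] | other_times n t' != [::]] = [::].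
  by move=> tc; rewrite /= other_times_corner.
by rewrite !corner ?inE ?eqxx ?orbT //= cats0.
Qed.

Lemma same_knot_billiard : same_knot (billiard_diagram w) (word_plat w).
Proof.
rewrite billiard_diagramE /word_plat size_tuple; set T := zip _ _.
have snd_T : map snd T = alternate false w.
  by rewrite /T -/unzip2 unzip2_zip // size_alternate size_tuple size_iota.
rewrite -[X in plat _ X]snd_T; apply: same_knot_plat.
  by rewrite /item_names -/unzip1 unzip1_zip ?iota_uniq // size_alternate size_tuple size_iota.
by have := @word_closable_alternate w; rewrite size_tuple closable_word snd_T; apply.
Qed.

End BilliardCode.

(** * Counting the words with a given core *)

Fixpoint bitseqs (n : nat) : seq (seq bool) :=
  if n is n'.+1 then [seq rcons w false | w <- bitseqs n'] ++ [seq rcons w true | w <- bitseqs n']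
  else [:: [::]].

Lemma mem_bitseqs n w : (w \in bitseqs n) = (size w == n).
Proof.
elim: n w => [|n IH] w /=; first by rewrite inE; case: w.
rewrite mem_cat; case/lastP: w => [|w x].
  by apply/negP => /orP[] /mapP[[|? ?]].
rewrite size_rcons eqSS -IH; apply/orP/idP => [[] /mapP[v vn /rcons_inj[-> _]] //|wn].
by case: x; [right | left]; apply: map_f.
Qed.

Lemma uniq_bitseqs n : uniq (bitseqs n).
Proof.
elim: n => //= n IH; rewrite cat_uniq !map_inj_uniq ?IH ?andbT //=;
  try by move=> v w /rcons_inj[].
by apply/hasPn => _ /mapP[v _ ->]; apply/negP => /mapP[u _ /rcons_inj[]].
Qed.

Lemma card_tuple_bitseqs n (P : pred (seq bool)) :
  #|[pred w : n.-tuple bool | P w]| = count P (bitseqs n).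
Proof.
have pe : perm_eq [seq val w | w <- enum {: n.-tuple bool}] (bitseqs n).
  apply: uniq_perm; [|exact: uniq_bitseqs|].
    by rewrite (map_inj_uniq val_inj) enum_uniq.
  move=> w; rewrite mem_bitseqs; apply/mapP/eqP => [[v _ ->]|sz]; first exact: size_tuple.
  by exists (tcast sz (in_tuple w)); rewrite ?mem_enum // /= val_tcast.
by rewrite -(permP pe) count_map cardE size_filter -enumT.
Qed.

Lemma count_bitseqsS n P :
  count P (bitseqs n.+1) = count (fun w => P (rcons w false)) (bitseqs n) +
                           count (fun w => P (rcons w true)) (bitseqs n).
Proof. by rewrite /= count_cat !count_map. Qed.

Definition reduce_count n g : nat := count (fun w => reduce w == g) (bitseqs n).

Lemma push_eq_cons st a g : no_triple st -> no_triple (a :: g) ->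
  (push st a == a :: g) = (st == g).
Proof.
move=> nst nag; apply/eqP/eqP => [|->]; last exact: push_no_triple.
case: pushP nst => [st' -> + E|_ _ [] //].
by rewrite E no_triple_cons /= !eqxx prefix0s.
Qed.

Lemma push_neg_eq_cons st a g : (push st (~~ a) == a :: g) = (st == [:: ~~ a, ~~ a, a & g]).
Proof.
apply/eqP/eqP => [|->]; last by rewrite /push /= eqxx.
by case: pushP => [st' -> ->|_ []] //; case: a.
Qed.

Lemma push_eq_nil st a : (push st a == [::]) = (st == [:: a; a]).
Proof. by apply/eqP/eqP => [|->]; [case: pushP => // st' -> -> | rewrite /push /= eqxx]. Qed.

Lemma reduce_count_nil n :
  reduce_count n.+1 [::] = reduce_count n [:: false; false] + reduce_count n [:: true; true].
Proof.
by rewrite /reduce_count count_bitseqsS; congr (_ + _); apply: eq_count => w;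
  rewrite reduce_rcons push_eq_nil.
Qed.

Lemma reduce_count_cons n a g : no_triple (a :: g) ->
  reduce_count n.+1 (a :: g) = reduce_count n g + reduce_count n [:: ~~ a, ~~ a, a & g].
Proof.
move=> nag; rewrite /reduce_count count_bitseqsS.
have same : count (fun w => reduce (rcons w a) == a :: g) (bitseqs n) = reduce_count n g.
  by apply: eq_count => w; rewrite reduce_rcons push_eq_cons ?no_triple_reduce.
have opposite : count (fun w => reduce (rcons w (~~ a)) == a :: g) (bitseqs n)
    = reduce_count n [:: ~~ a, ~~ a, a & g].
  by apply: eq_count => w; rewrite reduce_rcons push_neg_eq_cons.
by case: a {nag} same opposite => /= -> -> //; rewrite addnC.
Qed.

Section Ballot.
Local Open Scope ring_scope.

Definition binQ (n m : nat) : rat := 'C(n, m)%:R.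
Definition bin_ltQ (n m : nat) : rat := \sum_(i < m) binQ n i.
Definition ballot (n m : nat) : rat := binQ n m - bin_ltQ n m.

Lemma binQ0 n : binQ n 0 = 1.
Proof. by rewrite /binQ bin0. Qed.

Lemma binQS n m : binQ n.+1 m.+1 = binQ n m.+1 + binQ n m.
Proof. by rewrite /binQ binS natrD. Qed.

Lemma mul_binQ_left n m : (m.+1)%:R * binQ n m.+1 = (n%:R - m%:R) * binQ n m.
Proof.
have [le|lt] := leqP m n.
  by rewrite -natrB // /binQ -!natrM mul_bin_left.
by rewrite /binQ !bin_small ?mulr0 // ltnW.
Qed.

Lemma bin_ltQ0 n : bin_ltQ n 0 = 0.
Proof. by rewrite /bin_ltQ big_ord0. Qed.

Lemma bin_ltQS n m : bin_ltQ n m.+1 = bin_ltQ n m + binQ n m.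
Proof. by rewrite /bin_ltQ big_ord_recr. Qed.

Lemma bin_ltQSS n m : bin_ltQ n.+1 m.+1 = bin_ltQ n m.+1 + bin_ltQ n m.
Proof.
elim: m => [|m IH]; first by rewrite !bin_ltQS !bin_ltQ0 !binQ0 !add0r addr0.
by rewrite bin_ltQS IH binQS (bin_ltQS n m.+1) (bin_ltQS n m); ring.
Qed.

Lemma ballot0 n : ballot n 0 = 1.
Proof. by rewrite /ballot binQ0 bin_ltQ0 subr0. Qed.

Lemma ballotSS n m : ballot n.+1 m.+1 = ballot n m.+1 + ballot n m.
Proof. by rewrite /ballot binQS bin_ltQSS; ring. Qed.

(* The reflecting boundary of the ballot recursion. *)
Lemma ballot_boundary m : ballot (3 * m + 3) m.+1 = 2 * ballot (3 * m + 2) m.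
Proof.
rewrite addn3 -addn2 ballotSS; set n := (3 * m + 2)%N.
have binE : binQ n m.+1 = 2 * binQ n m.
  apply: (mulfI (x := (m.+1)%:R)); first by rewrite pnatr_eq0.
  by rewrite mul_binQ_left /n natrD natrM -natr1; ring.
by rewrite /ballot binE bin_ltQS; ring.
Qed.

Definition ballot_count (n l : nat) : rat :=
  if (l <= n)%N && (3 %| n - l)%N then ballot n ((n - l) %/ 3) else 0.

Lemma ballot_count_small n l : (n < l)%N -> ballot_count n l = 0.
Proof. by rewrite /ballot_count ltnNge => /negbTE ->. Qed.

Lemma ballot_countE m l : ballot_count (3 * m + l) l = ballot (3 * m + l) m.
Proof. by rewrite /ballot_count leq_addl addnK dvdn_mulr // mulKn. Qed.

Lemma ballot_count_neq_mod n l : (n != l %[mod 3])%N -> ballot_count n l = 0.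
Proof.
move=> nl; rewrite /ballot_count; case: ifP => // /andP[le /dvdnP[q E]].
by case/eqP: nl; lia.
Qed.

Lemma ballot_count_cases n l :
  [\/ (n < l)%N, exists m, n = (3 * m + l)%N | (n != l %[mod 3])%N].
Proof.
have [lt|le] := ltnP n l; first by constructor 1.
have [eq3|ne3] := eqVneq (n %% 3)%N (l %% 3)%N; last by constructor 3.
by constructor 2; exists ((n - l) %/ 3)%N; lia.
Qed.

Lemma ballot_countSS n l : ballot_count n.+1 l.+1 = ballot_count n l + ballot_count n l.+3.
Proof.
have [lt|[m ->]|ne3] := ballot_count_cases n l.
- by rewrite !ballot_count_small ?addr0 //; lia.
- rewrite ballot_countE -addnS ballot_countE; case: m => [|m].
    by rewrite !ballot0 ballot_count_small ?addr0 //; lia.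
  have -> : (3 * m.+1 + l.+1)%N = (3 * m + l.+3).+1 by lia.
  have -> : (3 * m.+1 + l)%N = (3 * m + l.+3)%N by lia.
  by rewrite ballot_countE ballotSS.
by rewrite !ballot_count_neq_mod ?addr0 //; move: ne3; lia.
Qed.

Lemma ballot_countS0 n : ballot_count n.+1 0 = 2 * ballot_count n 2.
Proof.
have [//|[[|m] E]|ne3] := ballot_count_cases n.+1 0; first by lia.
  have -> : n = (3 * m + 2)%N by lia.
  have -> : (3 * m + 2).+1 = (3 * m.+1 + 0)%N by lia.
  by rewrite !ballot_countE -ballot_boundary; congr ballot; lia.
by rewrite !ballot_count_neq_mod ?mulr0 //; move: ne3; lia.
Qed.

Lemma reduce_countE n g : no_triple g -> (reduce_count n g)%:R = ballot_count n (size g).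
Proof.
elim: n g => [|n IH] [|a g] nag //.
- by rewrite /reduce_count /= (ballot_countE 0 0) ballot0.
- have no_triple2 x : no_triple [:: x; x].
    by rewrite !no_triple_cons /= andbF no_triple_nil.
  by rewrite reduce_count_nil natrD !IH // ballot_countS0; ring.
have [ng nag'] : no_triple g /\ no_triple [:: ~~ a, ~~ a, a & g].
  by move: nag; rewrite !no_triple_cons => /andP[-> ->]; case: (a).
by rewrite reduce_count_cons // natrD !IH //= ballot_countSS.
Qed.

End Ballot.

(* The prefixes that [trim] removes from a word without three equal consecutive
   letters. *)
Definition trimmed_prefix (y : bool) (i : nat) : seq bool := flatten (nseq i [:: y; y; ~~ y]).

Definition trimmed_prefixes (n : nat) : seq (seq bool) :=
  [::] :: [seq trimmed_prefix false i | i <- iota 1 n]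
          ++ [seq trimmed_prefix true i | i <- iota 1 n].

Lemma size_trimmed_prefix y i : size (trimmed_prefix y i) = 3 * i.
Proof. by elim: i => //= i IH; rewrite -/(trimmed_prefix y i) /= IH; lia. Qed.

Lemma mem_trimmed_prefixes n e :
  reflect (exists y i, i <= n /\ e = trimmed_prefix y i) (e \in trimmed_prefixes n).
Proof.
rewrite inE mem_cat; apply: (iffP or3P) => [[/eqP ->|/mapP[i]|/mapP[i]]|[y [[|i] [le ->]]]].
- by exists false, 0.
- by rewrite mem_iota => i_in ->; exists false, i; split=> //; lia.
- by rewrite mem_iota => i_in ->; exists true, i; split=> //; lia.
- by constructor 1.
have i_in : i.+1 \in iota 1 n by rewrite mem_iota; lia.
by case: y; [constructor 3 | constructor 2]; apply: map_f.
Qed.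

Lemma uniq_trimmed_prefixes n : uniq (trimmed_prefixes n).
Proof.
have inj y : injective (trimmed_prefix y).
  by move=> i j /(congr1 size); rewrite !size_trimmed_prefix; lia.
have nil_notin y : [::] \notin [seq trimmed_prefix y i | i <- iota 1 n].
  by apply/mapP => -[[|i]]; rewrite mem_iota.
rewrite /= mem_cat negb_or !nil_notin cat_uniq !map_inj_uniq ?iota_uniq ?andbT //=.
apply/hasPn => _ /mapP[[|i] + ->]; rewrite mem_iota // => _.
by apply/mapP => -[[|j]]; rewrite mem_iota.
Qed.

Lemma trim_trimmed_prefix y i t : single_head t -> trim (trimmed_prefix y i ++ t) = t.
Proof.
move=> ht; elim: i => [|i IH]; last by rewrite /= eqxx.
case: t ht => [|a [|b [|z t]]] //; rewrite single_head_cons2 /= => /negbTE ab.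
by rewrite ab.
Qed.

Lemma no_triple_trimmed_prefix y i t :
  no_triple t -> single_head t -> no_triple (trimmed_prefix y i ++ t).
Proof.
move=> nt /forallP /(_ (~~ y)) /negbTE ht; elim: i => // i.
rewrite [_ ++ _]/= -/(trimmed_prefix y i) => IH; rewrite !no_triple_cons IH andbT.
case: i {IH} => [|i]; last by case: (y).
by move: ht => /=; case: (y) => ->.
Qed.

Lemma trim_inv u : no_triple u -> exists y i, u = trimmed_prefix y i ++ trim u.
Proof.
have [n] := ubnP (size u); elim: n u => // n IH [|x [|y [|z u]]] lt_n nt;
  try by exists false, 0.
rewrite [trim _]/=; case: eqP => [xy|_]; last by exists x, 0.
have lt_u : size u < n by move: lt_n => /=; lia.
move: nt; rewrite -{}xy !no_triple_cons => /and4P[nx _ nz nu].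
have zx : z = ~~ x by move: nx; rewrite /= eqxx prefix0s andbT; case: (x) (z) => [] [].
have [y' [[|i] Eu]] := IH u lt_u nu; first by exists x, 1; rewrite {1}Eu zx.
have y'x : y' = x by move: nz; rewrite Eu zx /=; case: (x) (y') => [] [].
by exists x, i.+2; rewrite zx {1}Eu y'x.
Qed.

Lemma size_trim w : size (trim w) <= size w.
Proof. exact: size_suffix (suffix_trim w). Qed.

Lemma trim_eq_sum n u t : no_triple u -> size u <= n -> single_head t ->
  (trim u == t : nat) = \sum_(e <- trimmed_prefixes n) (u == e ++ t).
Proof.
move=> nt sz ht; have [Et|ne] := eqVneq (trim u) t; last first.
  rewrite big_seq big1 // => e /mem_trimmed_prefixes[y [i [_ ->]]].
  by case: eqP => // Eu; move: ne; rewrite Eu trim_trimmed_prefix ?eqxx.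
have [y [i]] := trim_inv nt; rewrite Et => Eu.
have e_in : trimmed_prefix y i \in trimmed_prefixes n.
  apply/mem_trimmed_prefixes; exists y, i; split=> //.
  by move: sz; rewrite Eu size_cat size_trimmed_prefix; lia.
rewrite (bigD1_seq _ e_in) ?uniq_trimmed_prefixes //= -Eu eqxx big1 // => e ne.
case: eqP => //; rewrite Eu => E; case/eqP: ne.
have sz_e : size e = size (trimmed_prefix y i).
  by move/(congr1 size): E; rewrite !size_cat => /addIn.
by move/eqP: E; rewrite eqseq_cat // eq_sym => /andP[/eqP].
Qed.

Lemma size_push st x : size (push st x) <= (size st).+1.
Proof. by case: pushP => // st' -> /=; lia. Qed.

Lemma size_reduce w : size (reduce w) <= size w.
Proof.
elim/last_ind: w => // w x IH; rewrite reduce_rcons size_rcons.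
exact: leq_trans (size_push _ _) _.
Qed.

Lemma single_head_cat u v : 1 < size u -> single_head (u ++ v) = single_head u.
Proof. by case: u => [|a [|b u]] // _; rewrite !single_head_cons2. Qed.

Lemma single_head_rev_extension r y i :
  is_core r -> single_head (rev (trimmed_prefix y i ++ r)).
Proof. by case/and4P=> sz _ _ sh; rewrite rev_cat single_head_cat // size_rev ltnW. Qed.

Lemma no_triple_extension r y i : is_core r -> no_triple (trimmed_prefix y i ++ r).
Proof. by case/and4P=> _ nt sh _; apply: no_triple_trimmed_prefix. Qed.

Definition core_count n r : nat := count (fun w => core w == r) (bitseqs n).

Lemma core_countE n r : is_core r ->
  core_count n r = \sum_(e2 <- trimmed_prefixes n) \sum_(e1 <- trimmed_prefixes n)
    reduce_count n (e1 ++ rev (e2 ++ r)).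
Proof.
move=> core_r; have /and4P[_ _ sh _] := core_r.
have core_eq_sum w : w \in bitseqs n -> (core w == r : nat) =
    \sum_(e2 <- trimmed_prefixes n) \sum_(e1 <- trimmed_prefixes n)
      (reduce w == e1 ++ rev (e2 ++ r)).
  rewrite mem_bitseqs => /eqP sw; rewrite /core (@trim_eq_sum n) //; first last.
  - by rewrite size_rev (leq_trans (size_trim _)) // -sw size_reduce.
  - by rewrite no_triple_rev (no_triple_infix (suffixW (suffix_trim _))) ?no_triple_reduce.
  apply: eq_big_seq => _ /mem_trimmed_prefixes[y [i [_ ->]]].
  rewrite -(inj_eq (can_inj revK)) revK (@trim_eq_sum n) ?no_triple_reduce //.
    by rewrite -sw size_reduce.
  exact: single_head_rev_extension.
rewrite /core_count -sum1_count big_mkcond /=.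
under eq_big_seq => w w_in do rewrite -[if _ then _ else _]/(nat_of_bool _) core_eq_sum //.
rewrite exchange_big; apply: eq_bigr => e2 _; rewrite exchange_big; apply: eq_bigr => e1 _.
by rewrite /reduce_count -sum1_count [RHS]big_mkcond; apply: eq_bigr => w _; case: eqP.
Qed.

Section CoreValue.
Local Open Scope ring_scope.

Lemma sum_trimmed_prefixes n (f : nat -> rat) :
  \sum_(e <- trimmed_prefixes n) f (size e) = f 0%N + \sum_(1 <= i < n.+1) 2 * f (3 * i)%N.
Proof.
rewrite /trimmed_prefixes big_cons big_cat !big_map /=; congr (_ + _).
rewrite /index_iota subSS subn0 -big_split; apply: eq_bigr => i _ /=.
by rewrite !size_trimmed_prefix; ring.
Qed.

(* There is one trimmed prefix of length 0, and there are two of length 3 i for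
   every i > 0. *)
Definition doubled_sum (f : nat -> rat) (m : nat) : rat := f m + 2 * \sum_(i < m) f i.

Lemma doubled_sum0 f : doubled_sum f 0 = f 0%N.
Proof. by rewrite /doubled_sum big_ord0 mulr0 addr0. Qed.

Lemma doubled_sumS f m : doubled_sum f m.+1 = doubled_sum f m + f m.+1 + f m.
Proof. by rewrite /doubled_sum big_ord_recr /=; ring. Qed.

Lemma sum_trimmed_prefixes_doubled l m (f g : nat -> rat) :
    (forall k, (3 * m + l < k)%N -> g k = 0) ->
    (forall i, (i <= m)%N -> g (l + 3 * (m - i))%N = f i) ->
  \sum_(e <- trimmed_prefixes (3 * m + l)) g (l + size e)%N = doubled_sum f m.
Proof.
set n := (3 * m + l)%N => g_large g_f.
rewrite (sum_trimmed_prefixes n (fun k => g (l + k)%N)) addn0.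
congr (_ + _); first by rewrite -(g_f m) // subnn muln0 addn0.
have mn : (m.+1 <= n.+1)%N by rewrite /n; lia.
rewrite (@big_cat_nat _ _ _ m.+1 1) //= [X in _ + X]big_nat [X in _ + X]big1 ?addr0; last first.
  by move=> i /andP[mi _]; rewrite g_large ?mulr0 // /n; lia.
rewrite -mulr_sumr; congr (2 * _); rewrite big_nat_rev /= big_add1 /= big_mkord.
apply: eq_bigr => i _; rewrite -g_f; last exact: ltnW.
by congr g; have := ltn_ord i; lia.
Qed.

Definition core_value (n l : nat) : rat :=
  \sum_(e2 <- trimmed_prefixes n) \sum_(e1 <- trimmed_prefixes n)
    ballot_count n (l + size e2 + size e1).

Lemma core_count_value n r : is_core r -> (core_count n r)%:R = core_value n (size r).
Proof.
move=> core_r; rewrite core_countE // natr_sum.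
apply: eq_big_seq => _ /mem_trimmed_prefixes[y [i [_ ->]]].
rewrite natr_sum; apply: eq_big_seq => _ /mem_trimmed_prefixes[z [j [_ ->]]].
rewrite reduce_countE; last first.
  apply: no_triple_trimmed_prefix (single_head_rev_extension _ _ core_r).
  by rewrite no_triple_rev no_triple_extension.
by rewrite size_cat size_rev size_cat addnC (addnC (size _)).
Qed.

Lemma core_valueE m l :
  core_value (3 * m + l) l = doubled_sum (doubled_sum (ballot (3 * m + l))) m.
Proof.
set n := (3 * m + l)%N.
pose g k := \sum_(e1 <- trimmed_prefixes n) ballot_count n (k + size e1).
rewrite -[LHS]/(\sum_(e <- trimmed_prefixes n) g (l + size e)%N).
apply: sum_trimmed_prefixes_doubled => [k lt_k|i le_i].
  by rewrite /g big1 // => e _; rewrite ballot_count_small //; lia.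
have nE : n = (3 * i + (l + 3 * (m - i)))%N by rewrite /n; lia.
rewrite /g nE; apply: sum_trimmed_prefixes_doubled => [k lt_k|j le_j].
  exact: ballot_count_small.
set k := (l + 3 * (m - i))%N; have -> : (3 * i + k = 3 * j + (k + 3 * (i - j)))%N by lia.
exact: ballot_countE.
Qed.

Lemma core_value_small n l : (n < l)%N -> core_value n l = 0.
Proof.
move=> lt_l; rewrite /core_value big1 // => e2 _; rewrite big1 // => e1 _.
by rewrite ballot_count_small //; lia.
Qed.

Lemma core_value_neq_mod n l : (n != l %[mod 3])%N -> core_value n l = 0.
Proof.
move=> ne; rewrite /core_value big_seq big1 // => _ /mem_trimmed_prefixes[y [i [_ ->]]].
rewrite big_seq big1 // => _ /mem_trimmed_prefixes[z [j [_ ->]]].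
by rewrite !size_trimmed_prefix ballot_count_neq_mod //; move: ne; lia.
Qed.

(* The identity holds modulo the recursion [mul_binQ_left] of the binomial
   coefficients; likewise below. *)
Lemma doubled_ballot n m : doubled_sum (ballot n) m =
  (1 - m%:R) * binQ n m + (n%:R + 3 - 2 * m%:R) * bin_ltQ n m.
Proof.
elim: m => [|m IH]; first by rewrite doubled_sum0 ballot0 binQ0 bin_ltQ0; ring.
have := mul_binQ_left n m; rewrite doubled_sumS IH /ballot bin_ltQS -natr1 => /eqP.
rewrite -subr_eq0 => /eqP rec0; apply/eqP; rewrite -subr_eq0 -rec0.
by apply/eqP; ring.
Qed.

Lemma doubled_doubled_ballot n m : doubled_sum (doubled_sum (ballot n)) m =
  ((n%:R + 5) * m%:R - 2 * m%:R ^+ 2 + 2) / 2 * binQ n m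
  - (4 * m%:R ^+ 2 - 4 * n%:R * m%:R + n%:R ^+ 2 - 12 * m%:R + 7 * n%:R + 2) / 2 * bin_ltQ n m.
Proof.
elim: m => [|m IH]; first by rewrite doubled_sum0 doubled_ballot binQ0 bin_ltQ0; field.
have := mul_binQ_left n m; rewrite doubled_sumS IH !doubled_ballot bin_ltQS -natr1 => /eqP.
rewrite -subr_eq0 => /eqP /(congr1 (fun z => - (n%:R + 5 - 2 * m%:R) / 2 * z)).
rewrite mulr0 => rec0; apply/eqP; rewrite -subr_eq0 -rec0.
by apply/eqP; field.
Qed.

Lemma core_value_F m l : core_value (3 * m + l) l = F m%:Z l.
Proof.
rewrite core_valueE doubled_doubled_ballot /F.
have -> : absz (3 * m%:Z + l%:Z) = (3 * m + l)%N by lia.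
rewrite /binz /binz_lt -/(binQ (3 * m + l) m).
rewrite natr_sum -/(bin_ltQ (3 * m + l) m) -[m%:Z%:~R]/(m%:R) natrD natrM.
by field.
Qed.

Lemma core_value_div n l : core_value n l =
  if (l == n %[mod 3])%N then F ((n%:Z - l%:Z) %/ 3)%Z l else 0.
Proof.
case: ifP => [eq3|ne3]; last by rewrite core_value_neq_mod // eq_sym ne3.
have [lt|[m ->]|ne3] := ballot_count_cases n l.
- rewrite core_value_small // /F; have : ((n%:Z - l%:Z) %/ 3)%Z < 0 by lia.
  by case: (_ %/ _)%Z => // m _; rewrite /binz /binz_lt !mulr0 subr0.
- by rewrite core_value_F; congr F; lia.
- by rewrite eq_sym eq3 in ne3.
Qed.

Lemma sum_bitseqs m (f : nat -> rat) :
  \sum_(ds <- bitseqs m) f (count id ds) = \sum_(k < m.+1) 'C(m, k)%:R * f k.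
Proof.
elim: m f => [|m IH] f; first by rewrite big_seq1 big_ord1 bin0 mul1r.
rewrite [bitseqs _]/= big_cat !big_map /=.
under eq_bigr => ds _ do rewrite -cats1 count_cat /= addn0 addn0.
under [X in _ + X]eq_bigr => ds _ do rewrite -cats1 count_cat /= addn0 addn1.
rewrite IH (IH (fun k => f k.+1)).
rewrite [RHS]big_ord_recl [X in X + _ = _]big_ord_recl /= !bin0 -addrA; congr (_ + _).
under [RHS]eq_bigr => k _ do rewrite /bump /= add1n binS natrD mulrDl.
rewrite big_split /=; congr (_ + _); rewrite [RHS]big_ord_recr /= bin_small // mul0r addr0.
by apply: eq_bigr => k _.
Qed.

End CoreValue.

Definition cores (c : nat) : seq (seq bool) :=
  [seq core_word false ds | ds <- bitseqs (c - 2)]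
    ++ [seq core_word true ds | ds <- bitseqs (c - 2)].

Lemma mem_cores c r : 2 < c ->
  reflect (exists x ds, (size ds).+2 = c /\ r = core_word x ds) (r \in cores c).
Proof.
move=> c3; rewrite mem_cat; apply: (iffP orP) => [[] /mapP[ds + ->]|[x [ds [sz ->]]]].
- by rewrite mem_bitseqs => /eqP sz; exists false, ds; split=> //; rewrite sz; lia.
- by rewrite mem_bitseqs => /eqP sz; exists true, ds; split=> //; rewrite sz; lia.
have ds_in : ds \in bitseqs (c - 2) by rewrite mem_bitseqs -sz subn2.
by case: x; [right | left]; apply: map_f.
Qed.

Lemma is_core_cores c r : 2 < c -> r \in cores c -> is_core r.
Proof.
move=> c3 /(mem_cores _ c3)[x [ds [sz ->]]]; apply/is_coreP; exists x, ds; split=> //.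
by rewrite -2!ltnS sz.
Qed.

Lemma uniq_cores c : uniq (cores c).
Proof.
have inj x : injective (core_word x) by move=> ds ds' /block_word_inj[].
rewrite cat_uniq !map_inj_uniq ?uniq_bitseqs //= andbT.
by apply/hasPn => _ /mapP[ds _ ->]; apply/mapP => -[].
Qed.

Lemma count_mem_sum (T : Type) (U : eqType) (f : T -> U) (l : seq T) (s : seq U) : uniq s ->
  count (fun w => f w \in s) l = \sum_(r <- s) count (fun w => f w == r) l.
Proof.
move=> us; rewrite -sum1_count big_mkcond.
under [RHS]eq_bigr => r _ do rewrite -sum1_count big_mkcond.
rewrite exchange_big; apply: eq_bigr => w _ /=.
by rewrite -big_mkcond sum1_count (eq_count (a2 := pred1 (f w))) ?count_uniq_mem.
Qed.

Lemma crossing_number_billiard n (w : n.-tuple bool) c : n %% 3 != 2 -> 2 < c ->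
  crossing_number (billiard_diagram w) = c <-> core w \in cores c.
Proof.
move=> n_mod3 c3; have w_mod3 : size w %% 3 != 2 by rewrite size_tuple.
have cn := crossing_number_word_plat w_mod3 (same_knot_billiard w n_mod3) c3.
by split=> [/cn|] /(mem_cores _ c3) // /cn.
Qed.

Local Open Scope ring_scope.

Lemma card_billiard_crossing_number n c : (n %% 3 != 2)%N -> (2 < c)%N ->
  #|[pred w : n.-tuple bool | `[< crossing_number (billiard_diagram w) = c >]]|
  = (\sum_(r <- cores c) core_count n r)%N.
Proof.
move=> n_mod3 c3.
rewrite -(count_mem_sum core _ (uniq_cores c)) -card_tuple_bitseqs; apply: eq_card => w.
by rewrite !inE; apply/asboolP/idP => /(crossing_number_billiard w n_mod3 c3).
Qed.

Lemma sum_core_count n c : (2 < c)%N ->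
  \sum_(r <- cores c) (core_count n r)%:R
  = 2 * \sum_(k < (c - 2).+1) 'C(c - 2, k)%:R * core_value n (c + k).
Proof.
move=> c3; have sum_half x : \sum_(ds <- bitseqs (c - 2)) core_value n (size (core_word x ds))
    = \sum_(k < (c - 2).+1) 'C(c - 2, k)%:R * core_value n (c + k).
  rewrite -(sum_bitseqs _ (fun k => core_value n (c + k))); apply: eq_big_seq => ds.
  by rewrite mem_bitseqs size_block_word /= => /eqP ->; congr core_value; lia.
under eq_big_seq => r r_in do rewrite (core_count_value n (is_core_cores c3 r_in)).
by rewrite big_cat !big_map !sum_half /= -mulr2n mulr_natl.
Qed.

Theorem theorem5p1 (n c : nat)
    (n_gt0 : (0 < n)%N)
    (n_mod3 : (n %% 3 = 0)%N \/ (n %% 3 = 1)%N)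
    (c_range : (3 <= c <= n)%N) :
  uniform_prob (fun w : n.-tuple bool =>
    crossing_number (billiard_diagram w) = c)
  = \sum_(k < (c - 2).+1 | (c + k == n %[mod 3])%N)
      'C(c - 2, k)%:R / 2 ^+ (n - 1) *
      F ((n%:Z - c%:Z - k%:Z) %/ 3)%Z (c + k).
Proof.
have n_neq2 : (n %% 3 != 2)%N by case: n_mod3 => ->.
have [c3 _] := andP c_range.
rewrite /uniform_prob card_billiard_crossing_number // natr_sum sum_core_count //.
have -> : #|{: n.-tuple bool}|%:R = 2 * 2 ^+ (n - 1) :> rat.
  by rewrite card_tuple card_bool natrX -exprS subn1 prednK.
rewrite -mulf_div divff ?pnatr_eq0 // mul1r mulr_suml [RHS]big_mkcond.
apply: eq_bigr => k _; rewrite core_value_div PoszD opprD addrA.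
by case: ifP => _; rewrite ?mulr0 ?mul0r // mulrAC.
Qed.
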